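(* For all integers $k\geq 3$ and $1\leq \ell\leq k-2$, there exists $n_0$ such that for all $n\geq n_0$ divisible by $2k-\ell$, we have $t_{k-1}(n,\mathcal{Y}_{k,\ell})=\frac{n}{2k-\ell}$. That is, every $k$-graph $H$ on $n$ vertices with $\delta_{k-1}(H)\geq \frac{n}{2k-\ell}$ contains a $\mathcal{Y}_{k,\ell}$-factor, and there exist $k$-graphs on $n$ vertices with minimum codegree $\frac{n}{2k-\ell}-1$ containing no $\mathcal{Y}_{k,\ell}$-factor.
   Context: A $k$-graph is a $k$-uniform hypergraph. For a $k$-graph $H$ and a $(k-1)$-set $S$ of vertices, $\deg_H(S)$ is the number of edges containing $S$; the minimum codegree $\delta_{k-1}(H)$ is the minimum of $\deg_H(S)$ over all $(k-1)$-subsets $S$ of $V(H)$. For integers $k\ge 3$ and $0\le \ell\le k-1$, $\mathcal{Y}_{k,\ell}$ denotes the $k$-graph consisting of two edges sharing exactly $\ell$ vertices (so it has $2k-\ell$ vertices). An $F$-factor of $H$ is a collection of vertex-disjoint copies of $F$ in $H$ covering all vertices of $H$. For a $k$-graph $F$ and $n$ divisible by $|V(F)|$, $t_{k-1}(n,F)$ is the minimum integer $t$ such that every $k$-graph $H$ on $n$ vertices with $\delta_{k-1}(H)\ge t$ contains an $F$-factor. *)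

(* Defs.v *)
From mathcomp Require Import all_boot.
From mathcomp Require Import zify.

Set Implicit Arguments.
Unset Strict Implicit.
Unset Printing Implicit Defensive.

(* A hypergraph on the finite vertex type V is its edge set {set {set V}}. *)
Definition uniform (V : finType) (k : nat) (H : {set {set V}}) : bool :=
  [forall e in H, #|e| == k].

Definition degree (V : finType) (H : {set {set V}}) (S : {set V}) : nat :=
  #|[set e in H | S \subset e]|.

(* The default value #|V| of the minimum is only reached when no (k-1)-set
   exists: in a k-graph (k > 0), a (k-1)-set has degree at most #|V|. *)
Definition min_codegree (V : finType) (k : nat) (H : {set {set V}}) : nat :=
  \big[minn/#|V|]_(S : {set V} | #|S| == k.-1) degree H S.

(* A copy of F in H is given by an injection of the vertices of F into those
   of H that maps edges to edges; the copy need not be induced. *)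
Definition is_copy (W V : finType) (F : {set {set W}}) (H : {set {set V}})
    (f : {ffun W -> V}) : bool :=
  injectiveb f && [forall e in F, (f @: e) \in H].

Definition is_factor (W V : finType) (F : {set {set W}}) (H : {set {set V}})
    (C : {set {ffun W -> V}}) : bool :=
  [&& [forall f in C, is_copy F H f],
      [forall f in C, forall g in C,
         (f != g) ==> [disjoint f @: [set: W] & g @: [set: W]]]
    & \bigcup_(f in C) (f @: [set: W]) == [set: V]].

Definition has_factor (W V : finType) (F : {set {set W}})
    (H : {set {set V}}) : bool :=
  [exists C : {set {ffun W -> V}}, is_factor F H C].

Definition codegree_forces_factor (W : finType) (k n : nat)
    (F : {set {set W}}) (t : nat) : bool :=
  [forall H : {set {set 'I_n}},
     uniform k H ==> (t <= min_codegree k H) ==> has_factor F H].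

Lemma min_codegree_le (V : finType) (k : nat) (H : {set {set V}}) :
  min_codegree k H <= #|V|.
Proof.
rewrite /min_codegree; elim/big_rec: _ => // S m _ le_m.
exact: leq_trans (geq_minr _ _) le_m.
Qed.

Lemma codegree_forces_factor_ex (W : finType) (k n : nat)
    (F : {set {set W}}) : exists t, codegree_forces_factor k n F t.
Proof.
exists n.+1; apply/forallP => H; apply/implyP => _; apply/implyP => le_n.
by have := leq_trans le_n (min_codegree_le k H); rewrite card_ord ltnn.
Qed.

(* t_{k-1}(n, F) *)
Definition factor_threshold (W : finType) (k n : nat) (F : {set {set W}}) :
    nat :=
  ex_minn (codegree_forces_factor_ex k n F).

(* Y_{k,l}, for l < k: the edges are the first k and the last k of 2k - l
   vertices. *)
Definition Yfirst (k l : nat) : {set 'I_(2 * k - l)} :=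
  [set i : 'I_(2 * k - l) | i < k].

Definition Ylast (k l : nat) : {set 'I_(2 * k - l)} :=
  [set i : 'I_(2 * k - l) | k - l <= i].

Definition Ygraph (k l : nat) : {set {set 'I_(2 * k - l)}} :=
  [set Yfirst k l; Ylast k l].

Lemma card_ord_interval (n a b : nat) :
  a <= b -> b <= n -> #|[set i : 'I_n | a <= i < b]| = b - a.
Proof.
move=> le_ab le_bn.
have lt_n (i : 'I_(b - a)) : a + i < n by have := ltn_ord i; lia.
pose f (i : 'I_(b - a)) : 'I_n := Ordinal (lt_n i).
have f_inj : injective f by move=> i j [] /addnI /val_inj.
rewrite -[RHS]card_ord -(card_imset _ f_inj); congr #|pred_of_set _|.
apply/setP => i; rewrite inE; apply/idP/imsetP => [/andP[le_ai lt_ib]|[j _ ->]].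
  have lt_ba : i - a < b - a by lia.
  by exists (Ordinal lt_ba) => //; apply: val_inj => /=; lia.
by have := ltn_ord j; rewrite /=; lia.
Qed.

Lemma card_Yfirst (k l : nat) : l <= k -> #|Yfirst k l| = k.
Proof.
move=> le_lk; rewrite -[RHS]subn0 -(@card_ord_interval (2 * k - l) 0 k); try lia.
by apply: eq_card => i; rewrite !inE.
Qed.

Lemma card_Ylast (k l : nat) : l <= k -> #|Ylast k l| = k.
Proof.
move=> le_lk; transitivity (2 * k - l - (k - l)); last by lia.
rewrite -(@card_ord_interval (2 * k - l) (k - l) (2 * k - l)); try lia.
by apply: eq_card => i; rewrite !inE ltn_ord andbT.
Qed.

Lemma card_YfirstI (k l : nat) : l <= k -> #|Yfirst k l :&: Ylast k l| = l.
Proof.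
move=> le_lk; transitivity (k - (k - l)); last by lia.
rewrite -(@card_ord_interval (2 * k - l) (k - l) k); try lia.
by apply: eq_card => i; rewrite !inE andbC.
Qed.

Lemma Ygraph_uniform (k l : nat) : l <= k -> uniform k (Ygraph k l).
Proof.
move=> le_lk; apply/'forall_implyP => e; rewrite !inE.
by case/orP => /eqP ->; rewrite ?card_Yfirst ?card_Ylast.
Qed.

Lemma card_Ygraph (k l : nat) : l < k -> #|Ygraph k l| = 2.
Proof.
move=> lt_lk; rewrite cards2; case: eqVneq => //= eqY.
have := card_YfirstI (ltnW lt_lk); rewrite -eqY setIid card_Yfirst; lia.
Qed.

(* Main.v *)
Require Import Defs.
From mathcomp Require Import all_boot ssralg zmodp zify.

Set Implicit Arguments.
Unset Strict Implicit.
Unset Printing Implicit Defensive.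

(** A copy of Y can absorb a vertex exchange between any two vertices [x] and [y]: a few
    greedily chosen vertices complete both [x] and [y] to copies of Y, so every
    (2k-l)-set has a positive proportion of absorbers.  A greedy averaging argument then
    selects a small set absorbing every leftover of bounded size.  Away from it, take a
    maximal Y-tiling.  If it leaves many vertices U, then each tile has at most one
    vertex whose link in U is dense, and codegree n/(2k-l) forces almost every tile to
    have one; the other vertices span few edges, since a copy of Y on them meeting
    2k-l distinct tiles could be traded for 2k-l+1 tiles.  So either we are done or H is
    close to the space barrier (a set A of about n/(2k-l) vertices meeting almost all
    edges).  In that case, A is corrected to the set of vertices with dense link outside A;
    copies of Y disjoint from A, or with two vertices in A, restore the ratio
    |V \ A| = (2k-l-1)|A|, atypical vertices of A are covered greedily, and the rest is
    tiled by starting from an arbitrary arrangement in rows and repairing bad rows by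
    cyclically shifting the columns of random rows. *)

(** * Counting tuples and greedy choices *)

(* [lia] case-splits on every boolean atom of the context, so all but the inequalities are cleared first. *)
Ltac keep_arith :=
  repeat match goal with
  | Hyp : is_true ?b |- _ => lazymatch b with leq _ _ => fail | _ => clear Hyp end
  | Hyp : forall _, _ |- _ => clear Hyp
  end.
Ltac nlia := keep_arith; lia.
Ltac nnia := keep_arith; nia.
Ltac perm_count :=
  let a := fresh "a" in
  apply/permP => a; clear -a; simpl; repeat (rewrite !count_cat; simpl); lia.

(** The leftover of a maximal tiling is either below a constant or already forces the structure of
    the space barrier. A constant number of disjoint sets, each absorbing one (2k-l)-set, is
    therefore enough, and no concentration inequality is needed: every random choice is an average
    or a union bound over tuples or functions. Densities appear as integer inequalities such as
    [n ^ r <= K * cnt r P]. The obstacle near the barrier is exactness. There is no slack in the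
    codegree, so an imbalance of a single vertex must be corrected by the same argument as a linear
    one; the size of the imbalance has to cancel from both sides of a double count
    ([missing_tiles]). The range of l enters through the freedom to move vertices between the shared
    and the private part of Y: at least one vertex is shared and each edge has at least two private
    ones. Connecting two arbitrary vertices ([reach]) and finding Y from bare positive codegree
    ([core_false]) both use this, so no divisibility barrier appears. *)

Section Counting.
Variable V : finType.
Implicit Types (P Q : pred (seq V)) (U E F : {set V}) (s : seq V).

Lemma cardU_le (A B : {set V}) : #|A :|: B| <= #|A| + #|B|.
Proof. by rewrite leq_card_setU. Qed.

Lemma disjoint_setU (A B C : {set V}) :
  [disjoint A :|: B & C] = [disjoint A & C] && [disjoint B & C].
Proof. by rewrite -!setI_eq0 setIUl setU_eq0. Qed.

Lemma card_set_of_seq s : #|[set x in s]| <= size s.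
Proof. by rewrite cardsE card_size. Qed.

(** Tuples rather than sets: their number obeys a recursion on one coordinate ([cntS]), and tuples
    with repeated entries are of lower order ([cnt_nonuniq]). *)
Definition cnt (r : nat) P : nat := #|[set x : r.-tuple V | P x]|.

Lemma cnt0 P : cnt 0 P = P [::].
Proof.
rewrite /cnt; case: (boolP (P [::])) => PE.
  rewrite (_ : [set _ | _] = setT) ?cardsT ?card_tuple //.
  by apply/setP => x; rewrite !inE tuple0.
by apply: eq_card0 => x; rewrite !inE tuple0 (negbTE PE).
Qed.

Lemma cntE (r : nat) P : cnt r P = \sum_(x : r.-tuple V | P x) 1.
Proof. by rewrite /cnt -sum1_card; apply: eq_bigl => x; rewrite inE. Qed.

Lemma cntS (r : nat) P : cnt r.+1 P = \sum_v cnt r (fun s => P (v :: s)).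
Proof.
rewrite cntE.
under eq_bigr => v _ do rewrite cntE.
rewrite pair_big_dep /=.
rewrite (reindex (fun p : V * r.-tuple V => [tuple of p.1 :: p.2])) //=.
exists (fun x : r.+1.-tuple V => (thead x, [tuple of behead x])) => [[v s] _|x _].
  by congr (_, _); apply: val_inj.
by rewrite /=; case/tupleP: x => v s; apply: val_inj.
Qed.

Lemma cnt_mono (r : nat) P Q :
  (forall s, size s = r -> P s -> Q s) -> cnt r P <= cnt r Q.
Proof.
move=> PQ; apply/subset_leq_card/subsetP => x; rewrite !inE.
by apply: PQ; rewrite size_tuple.
Qed.

Lemma cnt_none (r : nat) P : (forall s, P s = false) -> cnt r P = 0.
Proof. by move=> P0; apply: eq_card0 => x; rewrite inE P0. Qed.

Lemma eq_cnt (r : nat) P Q :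
  (forall s, size s = r -> P s = Q s) -> cnt r P = cnt r Q.
Proof.
by move=> PQ; apply/eqP; rewrite eqn_leq !cnt_mono // => s /PQ ->.
Qed.

Lemma cntU (r : nat) P Q R :
  (forall s, size s = r -> P s -> Q s || R s) -> cnt r P <= cnt r Q + cnt r R.
Proof.
move=> PQR; apply: leq_trans (leq_card_setU _ _).
apply/subset_leq_card/subsetP => x; rewrite !inE.
by apply: PQR; rewrite size_tuple.
Qed.

Lemma cnt_all U (r : nat) : cnt r (all (mem U)) = #|U| ^ r.
Proof.
elim: r => [|r IH]; first by rewrite cnt0.
rewrite cntS expnS -IH -sum_nat_const big_mkcond [RHS]big_mkcond /=.
apply: eq_bigr => v _; case: ifP => vU; first by apply: eq_cnt => s _ /=; rewrite ?vU.
by apply: cnt_none => s; rewrite /= ?vU.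
Qed.

Lemma cnt_all_le U (r : nat) P : cnt r (fun s => all (mem U) s && P s) <= #|U| ^ r.
Proof. by rewrite -cnt_all; apply: cnt_mono => s _ /andP[]. Qed.

Lemma cnt_hit U E (r : nat) :
  #|U| * cnt r (fun s => all (mem U) s && has (mem E) s) <= r * #|E| * #|U| ^ r.
Proof.
elim: r => [|r IH]; first by rewrite cnt0 andbF muln0.
rewrite cntS.
apply: (@leq_trans (#|U| * \sum_v
   ((v \in E) * #|U| ^ r + (v \in U) * cnt r (fun s => all (mem U) s && has (mem E) s)))).
  rewrite leq_mul2l; apply/orP; right; apply: leq_sum => v _.
  case: (boolP (v \in U)) => vU /=; last first.
    by rewrite (_ : cnt _ _ = 0) //; apply: eq_card0 => x; rewrite !inE /= (negbTE vU).
  case: (boolP (v \in E)) => vE /=; rewrite ?mul0n ?mul1n.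
    by apply: leq_trans (leq_addr _ _); apply: leq_trans (cnt_all_le U r xpredT);
      apply: cnt_mono => s _ /=; rewrite ?vE ?vU ?andbT.
  by rewrite add0n; apply: cnt_mono => s _; rewrite ?vU ?(negbTE vE).
rewrite big_split /= -!big_distrl /=.
have sumE (A : {set V}) : \sum_v (v \in A : nat) = #|A|.
  by rewrite -sum1_card [RHS]big_mkcond; apply: eq_bigr => v _; case: ifP.
rewrite !sumE expnS; move: IH; set c := cnt r _; move: c (#|U| ^ r) => c u; nia.
Qed.

(** A new head [v] collides with the tail only if the tail hits the fibre of [f] through [v], which
    has at most [b] points. The identity as [f] discards repeated entries; a map sending vertices to
    their tiles discards tuples that meet a tile twice. *)
Lemma cnt_nonuniq (T : eqType) (f : V -> T) (b : nat) U (r : nat) :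
  (forall v, #|[set w | f w == f v]| <= b) ->
  #|U| * cnt r (fun s => all (mem U) s && ~~ uniq (map f s)) <= r * r * b * #|U| ^ r.
Proof.
move=> fb; elim: r => [|r IH]; first by rewrite cnt0 /= muln0.
rewrite cntS big_distrr /=.
apply: (@leq_trans (\sum_(v in U) (r * b * #|U| ^ r + r * r * b * #|U| ^ r))).
  rewrite [X in _ <= X]big_mkcond; apply: leq_sum => v _.
  case: ifP => vU; last first.
    by rewrite cnt_none ?muln0 // => s; rewrite /= ?vU.
  apply: (@leq_trans (#|U| * (cnt r (fun s => all (mem U) s && has (mem [set w | f w == f v]) s)
     + cnt r (fun s => all (mem U) s && ~~ uniq (map f s))))).
    rewrite leq_mul2l; apply/orP; right; apply: cntU => s _ /=.
    rewrite ?vU /= negb_and negbK => /andP[-> /orP[fv|->]]; rewrite ?orbT //=.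
    apply/orP; left; case/mapP: fv => w ws ->; apply/hasP; exists w => //=.
    by rewrite inE.
  rewrite mulnDr; apply: leq_add => //.
  apply: leq_trans (cnt_hit _ _ _) _.
  by rewrite leq_mul2r; apply/orP; right; rewrite leq_mul2l fb orbT.
by rewrite sum_nat_const expnS; nia.
Qed.

(** Largeness in a form made for greedy choice: after any admissible prefix at least [d] admissible
    continuations remain, so forbidden sets smaller than [d] can be avoided at each step. *)
Fixpoint many (d r : nat) P : bool :=
  if r is r'.+1 then d <= #|[set v | many d r' (fun s => P (v :: s))]| else P [::].

Lemma many_mono (d r : nat) P Q :
  (forall s, size s = r -> P s -> Q s) -> many d r P -> many d r Q.
Proof.
elim: r P Q => [|r IH] P Q PQ /=; first exact: PQ.
move=> /leq_trans; apply; apply/subset_leq_card/subsetP => v; rewrite !inE.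
by apply: IH => s szs; apply: PQ; rewrite /= szs.
Qed.

Lemma many_cat (d r1 r2 : nat) P :
  many d r1 (fun s1 => many d r2 (fun s2 => P (s1 ++ s2))) -> many d (r1 + r2) P.
Proof.
elim: r1 P => [|r1 IH] P //=.
move=> /leq_trans; apply; apply/subset_leq_card/subsetP => v; rewrite !inE.
exact: IH.
Qed.

Lemma many_split (d r1 r2 : nat) P :
  many d (r1 + r2) P -> many d r1 (fun s1 => many d r2 (fun s2 => P (s1 ++ s2))).
Proof.
elim: r1 P => [|r1 IH] P //=.
move=> /leq_trans; apply; apply/subset_leq_card/subsetP => v; rewrite !inE.
exact: IH.
Qed.

Lemma many_cnt (d r : nat) P : many d r P -> d ^ r <= cnt r P.
Proof.
elim: r P => [|r IH] P /=; first by rewrite cnt0 => ->.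
move=> dP; rewrite cntS expnS.
apply: (@leq_trans (\sum_(v in [set v | many d r (fun s => P (v :: s))]) d ^ r)).
  by rewrite sum_nat_const leq_mul2r dP orbT.
rewrite big_mkcond; apply: leq_sum => v _; case: ifP => //.
by rewrite inE => /IH.
Qed.

Lemma pick_notin (d : nat) (A F : {set V}) :
  d <= #|A| -> #|F| < d -> exists2 v, v \in A & v \notin F.
Proof.
move=> dA Fd; case: (set_0Vmem (A :\: F)) => [AF0|[v]].
  have := cardsD A F; rewrite AF0 cards0; have := subset_leq_card (subsetIr A F); lia.
by rewrite inE => /andP[vF vA]; exists v.
Qed.

Lemma many_pick (d r : nat) P F :
  many d r P -> #|F| + r <= d ->
  exists s, [/\ size s = r, P s, uniq s & all (fun x => x \notin F) s].
Proof.
elim: r P F => [|r IH] P F /=; first by exists [::].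
move=> dP le_d; have [|v] := pick_notin (F := F) dP; first by lia.
rewrite inE => Pv vF; have [|s [szs Ps us sF]] := IH _ (v |: F) Pv.
  by rewrite cardsU1 vF; lia.
exists (v :: s); rewrite /= szs us vF; split=> //.
  by rewrite andbT; apply/negP => /(allP sF); rewrite !inE eqxx.
by apply/allP => x /(allP sF); rewrite !inE negb_or => /andP[].
Qed.

(* Markov's inequality, one coordinate at a time: each coordinate costs a factor 2 in the density. *)
Lemma dense_many (d K r : nat) U P :
  0 < d -> 0 < K -> 2 ^ r * K * d <= #|U| ->
  #|U| ^ r <= K * cnt r (fun s => all (mem U) s && P s) ->
  many d r (fun s => all (mem U) s && P s).
Proof.
move=> d0; elim: r K P => [|r IH] K P K0; first by rewrite cnt0 /=; case: (P [::]) => //; lia.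
move=> dU; rewrite cntS => dens.
pose G v s := all (mem U) s && P (v :: s).
pose S := [set v in U | #|U| ^ r <= 2 * K * cnt r (G v)].
have lt0U : 0 < #|U|.
  by apply: leq_trans dU; rewrite !muln_gt0 expn_gt0 K0 d0.
suff dS : d <= #|S|.
  apply: leq_trans dS _ => /=; apply/subset_leq_card/subsetP => v.
  rewrite !inE => /andP[vU dv].
  apply: many_mono (IH (2 * K) (fun s => P (v :: s)) _ _ dv) => [s _||]; [by rewrite vU|by rewrite muln_gt0|].
  by apply: leq_trans dU; rewrite expnS; lia.
have le_sum : 2 * K * \sum_v cnt r (fun s => all (mem U) (v :: s) && P (v :: s)) <=
   2 * K * #|S| * #|U| ^ r + #|U| * #|U| ^ r.
  rewrite big_distrr /=.
  apply: (@leq_trans (\sum_v ((v \in S) * (2 * K * #|U| ^ r) + (v \in U) * #|U| ^ r))).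
    apply: leq_sum => v _; rewrite !inE; case: (boolP (v \in U)) => vU /=; last first.
      by rewrite cnt_none ?muln0 // => s; rewrite /= ?(negbTE vU).
    case: (leqP (#|U| ^ r) (2 * K * cnt r (G v))) => le_v; rewrite ?mul1n ?mul0n.
      by apply: leq_trans (leq_addr _ _); rewrite leq_mul2l; apply/orP; right;
         apply: (cnt_all_le U r).
    by rewrite add0n ltnW.
  rewrite big_split /= -!big_distrl /=.
  have sumE (A : {set V}) : \sum_v (v \in A : nat) = #|A|.
    by rewrite -sum1_card [RHS]big_mkcond; apply: eq_bigr => v _; case: ifP.
  by rewrite !sumE; lia.
have lt0p : 0 < #|U| ^ r by rewrite expn_gt0 lt0U.
have : #|U| <= 2 * K * #|S|.
  rewrite -(leq_pmul2r lt0p).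
  move: dens le_sum; rewrite expnS; set B := \sum_v _.
  move: B (#|U| ^ r) => B u; nia.
move: dU; rewrite expnS.
have : 0 < 2 ^ r by rewrite expn_gt0.
move: (2 ^ r) => w w0 dU US.
have : 2 * K * (w * d) <= 2 * K * #|S| by lia.
rewrite leq_pmul2l ?muln_gt0 //; apply: leq_trans.
by rewrite leq_pmull.
Qed.

(** One prefix [I] with two disjoint continuations: for edges, this is a copy of Y with intersection
    [I]. The map [g] widens what [J'] must avoid: singletons give distinct vertices, tiles give
    vertices in distinct tiles. *)
Lemma pair_pick (d j r b : nat) P F (g : V -> {set V}) :
  (forall v, v \in g v) -> (forall v, #|g v| <= b) ->
  many d (j + r) P -> #|F| + b.+1 * (j + r) <= d ->
  exists I J J' : seq V,
   [/\ size I = j /\ size J = r /\ size J' = r, P (I ++ J) /\ P (I ++ J'),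
       uniq (I ++ J ++ J'), all (fun x => x \notin F) (I ++ J ++ J') &
       forall x y, x \in I ++ J -> y \in J' -> y \notin g x].
Proof.
move=> gr gb /many_split mP le_d.
have [|I [szI PI uI IF]] := many_pick (F := F) mP; first nia.
have [|J [szJ PJ uJ JF]] := many_pick (F := F :|: [set x in I]) PI.
  by have := cardU_le F [set x in I]; have := card_set_of_seq I; nia.
pose W := \bigcup_(x in I ++ J) g x.
have cW : #|W| <= b * (j + r).
  rewrite /W -big_enum /= .
  apply: (@leq_trans (\sum_(x <- enum [in I ++ J]) b)).
    elim/big_rec2: _ => [|x m A _ IHm]; first by rewrite cards0.
    by apply: leq_trans (leq_card_setU _ _) _; apply: leq_add.
  rewrite big_const_seq count_predT iter_addn_0 leq_mul2l; apply/orP; right.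
  by rewrite -cardE -szI -szJ -size_cat; apply: card_size.
have [|J' [szJ' PJ' uJ' J'F]] := many_pick (F := F :|: W) PI.
  by have := cardU_le F W; nia.
have J'g x y : x \in I ++ J -> y \in J' -> y \notin g x.
  move=> xIJ /(allP J'F); rewrite inE negb_or => /andP[_]; apply: contra => yx.
  by apply/bigcupP; exists x.
exists I, J, J'; split=> //.
  rewrite catA cat_uniq uJ' andbT cat_uniq uI uJ /= andbT; apply/andP; split.
    apply/hasPn => x /(allP JF); rewrite !inE negb_or => /andP[] //.
  by apply/hasPn => x xJ'; apply/negP => /= xIJ; have := J'g x x xIJ xJ'; rewrite gr.
rewrite !all_cat IF /=; apply/andP; split; apply/allP => x.
  by move/(allP JF); rewrite inE negb_or => /andP[].
by move/(allP J'F); rewrite inE negb_or => /andP[].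
Qed.

Lemma fresh (r : nat) (Z F : {set V}) :
  #|F| + r <= #|Z| ->
  exists s, [/\ size s = r, uniq s, all (mem Z) s & all (fun x => x \notin F) s].
Proof.
elim: r F => [|r IH] F le_d; first by exists [::].
have [|v vZ vF] := pick_notin (F := F) (leqnn #|Z|); first lia.
have [|s [szs us sZ sF]] := IH (v |: F); first by rewrite cardsU1 vF; lia.
exists (v :: s); rewrite /= szs us vF vZ sZ; split=> //.
  by rewrite andbT; apply/negP => /(allP sF); rewrite !inE eqxx.
by apply/allP => x /(allP sF); rewrite !inE negb_or => /andP[].
Qed.

Variable n : nat.
Hypothesis cardV : #|V| = n.

Lemma cardCE U : #|U| + #|~: U| = n.
Proof. by rewrite cardsC. Qed.

Lemma cnt_le (r : nat) P : cnt r P <= n ^ r.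
Proof.
rewrite -cardV -cardsT -cnt_all; apply: cnt_mono => s _ _.
by apply/allP => x _; rewrite inE.
Qed.

Lemma many_free (d r : nat) F :
  d + #|F| + r <= n -> many d r (fun s => uniq s && all (fun x => x \notin F) s).
Proof.
elim: r F => [|r IH] F //= le_d.
apply: (@leq_trans #|~: F|); first by have := cardCE F; lia.
apply/subset_leq_card/subsetP => v; rewrite !inE => vF.
have le_d' : d + #|v |: F| + r <= n by rewrite cardsU1 vF; lia.
apply: many_mono (IH _ le_d') => s _ /andP[us /allP sF].
rewrite us vF !andbT /=; apply/andP; split.
  by apply/negP => /sF; rewrite !inE eqxx.
by apply/allP => x /sF; rewrite !inE negb_or => /andP[].
Qed.

End Counting.

(** * Tilings and the space barrier *)

Lemma min_codegree_le_degree (V : finType) (k : nat) (H : {set {set V}}) (S : {set V}) :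
  #|S| = k.-1 -> min_codegree k H <= degree H S.
Proof.
move=> cS; rewrite /min_codegree -big_filter.
have: S \in [seq T : {set V} <- index_enum _ | #|T| == k.-1].
  by rewrite mem_filter cS eqxx mem_index_enum.
elim: [seq _ <- _ | _] => //= T r IH; rewrite inE big_cons geq_min.
by case/orP => [/eqP <-|/IH ->]; rewrite ?leqnn ?orbT.
Qed.

Lemma le_min_codegree (V : finType) (k c : nat) (H : {set {set V}}) :
  c <= #|V| -> (forall S : {set V}, #|S| = k.-1 -> c <= degree H S) ->
  c <= min_codegree k H.
Proof.
move=> cV cdeg; rewrite /min_codegree; elim/big_rec: _ => // S x /eqP /cdeg cS cx.
by rewrite leq_min cS cx.
Qed.

Section SpaceBarrier.
Variables (V : finType) (k l t n : nat) (A : {set V}).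
Hypotheses (hk : 3 <= k) (hl1 : 1 <= l) (hl2 : l <= k - 2) (t0 : 0 < t) (tk : k <= t).
Hypotheses (cardV : #|V| = n) (nE : n = t * (2 * k - l)) (cardA : #|A| = t.-1).
Let m := 2 * k - l.

Definition barrier : {set {set V}} := [set e : {set V} | (#|e| == k) && (e :&: A != set0)].

Let tkn : t + k <= n.
Proof. by rewrite nE; have : 2 <= 2 * k - l by [lia]; nia. Qed.

Lemma barrier_uniform : uniform k barrier.
Proof. by apply/'forall_implyP => e; rewrite inE => /andP[]. Qed.

(** A (k-1)-set disjoint from [A] is completed exactly by the [t.-1] vertices of [A]; one that meets
    [A] is completed by every other vertex, and by [tkn] there are at least [t.-1] of those. *)
Lemma barrier_codegree : (min_codegree k barrier).+1 = t.
Proof.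
have tn : t <= n by have := tkn; lia.
suff: min_codegree k barrier == t.-1 by move/eqP => ->; lia.
rewrite eqn_leq; apply/andP; split; last first.
  apply: le_min_codegree => [|S cS]; first by rewrite cardV; lia.
  case: (boolP (S :&: A == set0)) => SA.
    rewrite -cardA -(card_in_imset (f := fun v => v |: S) (D := mem A)); last first.
      move=> v w vA wA eq_vw; have: v \in w |: S by rewrite -eq_vw !inE eqxx.
      rewrite !inE => /orP[/eqP //|vS].
      by move/eqP/setP: SA => /(_ v); rewrite !inE vS => /esym; rewrite vA.
    apply/subset_leq_card/subsetP => e /imsetP[v vA ->]; rewrite !inE subsetUr andbT.
    have vS : v \notin S.
      by apply/negP => vS; move/eqP/setP: SA => /(_ v); rewrite !inE vS => /esym; rewrite vA.
    rewrite cardsU1 vS cS; apply/andP; split; first by apply/eqP; lia.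
    by apply/set0Pn; exists v; rewrite !inE eqxx; rewrite vA.
  apply: (@leq_trans #|~: S|).
    by have := cardCE cardV S; rewrite cS; have := tkn; lia.
  rewrite -(card_in_imset (f := fun v => v |: S) (D := mem (~: S))); last first.
    move=> v w vA wA eq_vw; have: v \in w |: S by rewrite -eq_vw !inE eqxx.
    by move: vA; rewrite !inE => /negbTE ->; rewrite orbF => /eqP.
  apply/subset_leq_card/subsetP => e /imsetP[v vS ->]; rewrite !inE subsetUr andbT.
  rewrite cardsU1 (_ : v \notin S) ?cS; last by move: vS; rewrite inE.
  apply/andP; split; first by apply/eqP; lia.
  case/set0Pn: SA => w; rewrite inE => /andP[wS wA]; apply/set0Pn; exists w.
  by rewrite !inE wS orbT wA.
have [|S [sS uS SA _]] := @fresh V k.-1 (~: A) set0.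
  by rewrite cards0; have := cardCE cardV A; rewrite cardA; have := tkn; lia.
have cS : #|[set x in S]| = k.-1 by rewrite cardsE -sS; apply/card_uniqP.
apply: leq_trans (min_codegree_le_degree _ cS) _.
rewrite -cardA -(card_in_imset (f := fun v => v |: [set x in S]) (D := mem A)); last first.
  move=> v w vA wA eq_vw; have: v \in w |: [set x in S] by rewrite -eq_vw !inE eqxx.
  rewrite !inE => /orP[/eqP //|vS].
  by move/allP: SA => /(_ v vS) /=; rewrite inE => /negP; case.
apply/subset_leq_card/subsetP => e; rewrite !inE => /andP[/andP[/eqP ce /set0Pn[v]]].
rewrite inE => /andP[ve vA] Se; apply/imsetP; exists v => //.
apply/eqP; rewrite eq_sym eqEcard; apply/andP; split.
  by apply/subsetP => x; rewrite in_setU1 => /orP[/eqP -> //|]; move/subsetP: Se; apply.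
rewrite cardsU1 cS ce inE; case: (boolP (v \in S)) => vS; last by rewrite /=; lia.
by move/allP: SA => /(_ v vS) /=; rewrite inE vA.
Qed.

(** Every copy uses a vertex of [A] and disjoint copies use different ones, so there are at most
    [t.-1] copies, too few to cover [t * (2 * k - l)] vertices. *)
Lemma barrier_no_factor : ~~ has_factor (Ygraph k l) barrier.
Proof.
apply/existsP => [[C /and3P[/'forall_implyP copyC /'forall_implyP disjC /eqP covC]]].
have hit (f : {ffun 'I_(2 * k - l) -> V}) : exists v, f \in C -> v \in A :&: f @: setT.
  case: (boolP (f \in C)) => fC; last first.
    have /card_gt0P[x _] : 0 < #|V| by rewrite cardV; have := tkn; lia.
    by exists x.
  have /andP[_ /'forall_implyP /(_ (Yfirst k l))] := copyC f fC.
  rewrite !inE eqxx => /(_ isT) /andP[_ /set0Pn[v]]; rewrite inE => /andP[vf vA].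
  by exists v => _; rewrite inE vA; move: vf; apply/subsetP/imsetS/subsetT.
have [g gP] := fin_all_exists hit.
have : #|C| <= t.-1.
  rewrite -cardA -(card_in_imset (f := g) (D := mem C)).
    by apply/subset_leq_card/subsetP => v /imsetP[f fC ->]; have := gP f fC; rewrite inE => /andP[].
  move=> f h fC hC eq_fh; apply/eqP/negP => /negP neq_fh.
  have /'forall_implyP /(_ h hC) /implyP /(_ neq_fh) := disjC f fC.
  rewrite disjoint_subset => /subsetP /(_ (g f)).
  have := gP f fC; rewrite inE => /andP[_ ->] /(_ isT).
  by rewrite inE eq_fh; have := gP h hC; rewrite inE => /andP[_ ->].
have : n <= #|C| * m.
  rewrite -cardV -cardsT -covC -sum_nat_const.
  elim/big_rec2: _ => [|f x U _ IH]; first by rewrite cards0.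
  apply: leq_trans (cardU_le _ _) _; apply: leq_add => //.
  by apply: leq_trans (leq_imset_card _ _) _; rewrite cardsT card_ord.
by rewrite nE -/m; have : 0 < m by [rewrite /m; lia]; nia.
Qed.

End SpaceBarrier.

Section Tilings.
Variables (V : finType) (H : {set {set V}}) (k l : nat).
Hypothesis lk : l < k.
Hypothesis unifH : forall e, e \in H -> #|e| = k.
Implicit Types (X T : {set V}) (P : {set {set V}}) (s I J : seq V).

Definition setof s : {set V} := [set x in s].
Definition edge s : bool := setof s \in H.

(** A copy is recorded by its vertex set alone, so that tilings can be joined and exchanged as
    families of sets; the labelled embedding is recovered in [isY_copy]. *)
Definition isY T : bool :=
  [exists e in H, exists f in H, (#|e :&: f| == l) && (e :|: f == T)].

Definition tileable X : bool :=
  [exists P : {set {set V}}, [&& trivIset P, cover P == X & [forall T in P, isY T]]].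

Lemma tileableP X :
  reflect (exists P, [/\ trivIset P, cover P = X & forall T, T \in P -> isY T]) (tileable X).
Proof.
apply: (iffP existsP) => [[P /and3P[tP /eqP cP /'forall_implyP YP]]|[P [tP cP YP]]]; exists P => //.
by rewrite tP cP eqxx; apply/'forall_implyP.
Qed.

Lemma isYP T :
  reflect (exists e f, [/\ e \in H, f \in H, #|e :&: f| = l & e :|: f = T]) (isY T).
Proof.
apply: (iffP 'exists_andP) => [[e [eH /'exists_andP[f [fH /andP[/eqP ef /eqP eT]]]]]|].
  by exists e, f.
case=> e [f [eH fH ef eT]]; exists e; split=> //; apply/'exists_andP; exists f.
by rewrite ef eT !eqxx.
Qed.

Lemma isY_card T : isY T -> #|T| = 2 * k - l.
Proof. by case/isYP => e [f [/unifH ce /unifH cf ef <-]]; rewrite cardsU ce cf ef; lia. Qed.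

Lemma card_setof s : uniq s -> #|setof s| = size s.
Proof. by move=> us; rewrite cardsE; apply/card_uniqP. Qed.

Lemma setof_cat I J : setof (I ++ J) = setof I :|: setof J.
Proof. by apply/setP => x; rewrite !inE mem_cat. Qed.

Lemma eq_setof I J : I =i J -> setof I = setof J.
Proof. by move=> IJ; apply/setP => x; rewrite !inE IJ. Qed.

Lemma edge_perm I J : perm_eq I J -> edge I = edge J.
Proof. by move/perm_mem/eq_setof; rewrite /edge => ->. Qed.

Lemma edge_uniq s : edge s -> size s = k -> uniq s.
Proof.
move=> /unifH; rewrite cardsE => cs sk; apply/card_uniqP; by rewrite cs sk.
Qed.

Lemma isY_seq I J J' : uniq (I ++ J ++ J') -> size I = l ->
  edge (I ++ J) -> edge (I ++ J') -> isY (setof (I ++ J ++ J')).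
Proof.
move=> u sI e1 e2; apply/isYP; exists (setof (I ++ J)), (setof (I ++ J')).
have uI : uniq I by move: u; rewrite cat_uniq => /andP[].
split=> //; last by apply/setP => x; rewrite !inE !mem_cat; case: (x \in I); case: (x \in J).
rewrite -sI -(card_setof uI); apply: eq_card => x; rewrite !inE !mem_cat.
case xI : (x \in I) => //=; apply/negP => /andP[xJ xJ'].
move: u; rewrite !cat_uniq => /and3P[_ _ /and3P[_ /hasP]]; case.
by exists x.
Qed.

Lemma tileable0 : tileable set0.
Proof.
apply/tileableP; exists set0; split=> [||T]; last by rewrite inE.
  by apply/trivIsetP => T; rewrite inE.
by rewrite /cover big_set0.
Qed.

Lemma tileable1 T : isY T -> tileable T.
Proof.
move=> YT; apply/tileableP; exists [set T]; split=> [||U].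
- by apply/trivIsetP => A B; rewrite !inE => /eqP -> /eqP ->; rewrite eqxx.
- by rewrite /cover big_set1.
- by rewrite inE => /eqP ->.
Qed.

Lemma tileableU X X' : [disjoint X & X'] -> tileable X -> tileable X' -> tileable (X :|: X').
Proof.
move=> dX /tileableP[P [tP cP YP]] /tileableP[P' [tP' cP' YP']].
apply/tileableP; exists (P :|: P'); split; last first.
- by move=> T; rewrite inE => /orP[/YP|/YP'].
- by rewrite /cover bigcup_setU -!/(cover _) cP cP'.
have dPP' A B : A \in P -> B \in P' -> [disjoint A & B].
  move=> AP BP; apply: disjointWl (_ : A \subset X) _; first by rewrite -cP; apply: bigcup_max AP _.
  by apply: disjointWr dX; rewrite -cP'; apply: bigcup_max BP _.
apply/trivIsetP => A B; rewrite !inE => /orP[AP|AP'] /orP[BP|BP'] neq.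
- by move/trivIsetP: tP; apply.
- exact: dPP'.
- by rewrite disjoint_sym dPP'.
- by move/trivIsetP: tP'; apply.
Qed.

Lemma card_tiling P : trivIset P -> (forall T, T \in P -> isY T) -> #|cover P| = #|P| * (2 * k - l).
Proof.
move=> /eqP <- YP; rewrite -sum_nat_const; apply: eq_bigr => T /YP; exact: isY_card.
Qed.

Lemma tileable_dvd X : tileable X -> 2 * k - l %| #|X|.
Proof. by case/tileableP => P [tP <- YP]; rewrite card_tiling // dvdn_mull. Qed.

(** Listing [e :\: f], then [e :&: f], then [f :\: e] puts [e] on the first k positions and [f] on
    the last k, which is the labelling of [Ygraph]. *)
Lemma isY_copy T : isY T ->
  exists f : {ffun 'I_(2 * k - l) -> V}, is_copy (Ygraph k l) H f && (f @: [set: _] == T).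
Proof.
case/isYP => e [f [eH fH cef eT]].
have ce := unifH eH; have cf := unifH fH.
have [x0 _] : exists x, x \in e by apply/set0Pn; rewrite -card_gt0 ce; lia.
pose s := enum (e :\: f) ++ enum (e :&: f) ++ enum (f :\: e).
have s1 : size (enum (e :\: f)) = k - l by rewrite -cardE cardsD cef ce.
have s2 : size (enum (e :&: f)) = l by rewrite -cardE cef.
have s3 : size (enum (f :\: e)) = k - l by rewrite -cardE cardsD setIC cef cf.
have sz : size s = 2 * k - l by rewrite !size_cat s1 s2 s3; lia.
have us : uniq s.
  rewrite !cat_uniq !enum_uniq /= andbT; apply/andP; split; apply/hasPn => x.
    by rewrite mem_cat !mem_enum !inE; case: (x \in e); case: (x \in f).
  by rewrite !mem_enum !inE; case: (x \in e); case: (x \in f).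
pose g := [ffun i : 'I_(2 * k - l) => nth x0 s i].
have injg : injective g.
  move=> i j; rewrite !ffunE => /eqP; rewrite nth_uniq ?sz //; first by move/eqP/val_inj.
have sub1 : g @: Yfirst k l \subset e.
  apply/subsetP => x /imsetP[i]; rewrite inE => ik ->; rewrite ffunE /s catA nth_cat.
  have lt : i < size (enum (e :\: f) ++ enum (e :&: f)) by rewrite size_cat s1 s2; lia.
  rewrite lt; have := mem_nth x0 lt.
  by rewrite mem_cat !mem_enum !inE => /orP[] /andP[].
have sub2 : g @: Ylast k l \subset f.
  apply/subsetP => x /imsetP[i]; rewrite inE => ik ->; rewrite ffunE /s nth_cat s1 ltnNge ik /=.
  have lt : i - (k - l) < size (enum (e :&: f) ++ enum (f :\: e)).
    by rewrite size_cat s2 s3; have := ltn_ord i; lia.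
  have := mem_nth x0 lt.
  by rewrite mem_cat !mem_enum !inE => /orP[] /andP[].
have im1 : g @: Yfirst k l = e.
  by apply/eqP; rewrite eqEcard sub1 card_imset // card_Yfirst ?ce //; lia.
have im2 : g @: Ylast k l = f.
  by apply/eqP; rewrite eqEcard sub2 card_imset // card_Ylast ?cf //; lia.
exists g; apply/andP; split.
  apply/andP; split; first exact/injectiveP.
  by apply/'forall_implyP => A; rewrite !inE => /orP[] /eqP ->; rewrite ?im1 ?im2.
have -> : [set: 'I_(2 * k - l)] = Yfirst k l :|: Ylast k l.
  by apply/setP => i; rewrite !inE; case: ltnP => //= ki; apply/esym; lia.
by rewrite imsetU im1 im2 eT.
Qed.

Lemma tileable_factor : tileable setT -> has_factor (Ygraph k l) H.
Proof.
case/tileableP => P [tP cP YP].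
have [x0 _|V0] := pickP V; last first.
  apply/existsP; exists set0; apply/and3P; split; try by apply/'forall_implyP => f; rewrite inE.
  by apply/eqP/setP => x; have := V0 x.
have ex (T : {set V}) : exists f : {ffun 'I_(2 * k - l) -> V},
    T \in P -> is_copy (Ygraph k l) H f && (f @: [set: _] == T).
  case: (boolP (T \in P)) => TP; first by have [f fP] := isY_copy (YP _ TP); exists f.
  by exists [ffun => x0].
have [g gP] := fin_all_exists ex.
apply/existsP; exists (g @: P); apply/and3P; split.
- by apply/'forall_implyP => f /imsetP[T /gP /andP[cT _] ->].
- apply/'forall_implyP => f /imsetP[T TP ->]; apply/'forall_implyP => h /imsetP[T' TP' ->].
  apply/implyP => neq; have /andP[_ /eqP ->] := gP _ TP; have /andP[_ /eqP ->] := gP _ TP'.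
  by move/trivIsetP: tP; apply=> //; apply: contra neq => /eqP ->.
- rewrite -cP /cover; apply/eqP/setP => x; apply/bigcupP/bigcupP => [[f /imsetP[T TP ->]]|[T TP xT]].
    by have /andP[_ /eqP ->] := gP _ TP; exists T.
  exists (g T); first exact: imset_f.
  by have /andP[_ /eqP ->] := gP _ TP.
Qed.

End Tilings.

(** * Reachability and absorbers *)

Section Reachability.
Variables (V : finType) (H : {set {set V}}) (k l n t : nat).
Hypotheses (hk : 3 <= k) (hl1 : 1 <= l) (hl2 : l <= k - 2).
Hypotheses (cardV : #|V| = n) (tn : t <= n).
Hypothesis codegH : forall s, uniq s -> size s = k.-1 -> t <= #|[set v | edge H (v :: s)]|.
Implicit Types (F R : {set V}) (s L : seq V).
Let m := 2 * k - l.

Lemma perm_uniq_sub (s s' L : seq V) : perm_eq s (s' ++ L) -> uniq s -> uniq s'.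
Proof. by move/perm_uniq ->; rewrite cat_uniq => /andP[]. Qed.

Lemma cardU_setof F L : #|F :|: setof L| <= #|F| + size L.
Proof. by apply: leq_trans (cardU_le _ _) _; rewrite leq_add2l card_set_of_seq. Qed.

Lemma notin_setofU F L x : (x \notin F :|: setof L) = (x \notin F) && (x \notin L).
Proof. by rewrite !inE negb_or. Qed.

Lemma uniq_disjoint s L : uniq (s ++ L) -> [disjoint setof s & setof L].
Proof.
rewrite cat_uniq => /and3P[_ /hasPn sL _]; rewrite disjoint_subset; apply/subsetP => x.
by rewrite !inE => xs; apply/negP => /sL; rewrite /= xs.
Qed.

Lemma many_nb (d : nat) F L s : uniq s -> size s = k.-1 -> d + #|F| + size L <= t ->
  forall P : pred (seq V), (forall v, edge H (v :: s) -> v \notin F -> v \notin L -> P [:: v]) -> many d 1 P.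
Proof.
move=> us ss le_d P Pv /=; have := codegH us ss; set N := [set v | _] => le_t.
have : d <= #|N :\: (F :|: setof L)|.
  have := cardsID (F :|: setof L) N; have := subset_leq_card (subsetIr N (F :|: setof L)).
  by have := cardU_setof F L; nlia.
move/leq_trans; apply; apply/subset_leq_card/subsetP => v.
by rewrite in_setD notin_setofU !inE => /andP[/andP[vF vL] ev]; apply: Pv.
Qed.

Lemma many_free_cat (d r : nat) F L : uniq L -> d + #|F| + size L + r <= n ->
  many d r (fun s => uniq (s ++ L) && all (fun x => x \notin F) s).
Proof.
move=> uL le_d; have le_d' : d + #|F :|: setof L| + r <= n.
  by have := cardU_setof F L; nlia.
apply: many_mono (many_free cardV le_d') => s _ /andP[us /allP sF].
rewrite cat_uniq us uL andbT /=; apply/andP; split; last first.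
  by apply/allP => x /sF; rewrite notin_setofU => /andP[].
by rewrite has_sym; apply/hasPn => x /sF; rewrite notin_setofU => /andP[].
Qed.

(* With [s = W ++ [:: p; q] ++ Z ++ [:: z]] and [W = X ++ Z'], the edge [pqXZz] completes
   both [ypXZ'] and [xqXZ'] to a copy of Y. *)
Lemma reach (d : nat) x y L F : uniq (x :: y :: L) -> d + #|F| + size L + 2 * m <= t ->
  many d (m - 1) (fun s => [&& uniq (s ++ x :: y :: L), all (fun v => v \notin F) s,
    isY H l (setof (x :: s)) & isY H l (setof (y :: s))]).
Proof.
move=> uL le_d.
have mE : m - 1 = (k - 2) + (1 + (1 + ((k - 2 - l) + 1))) by rewrite /m; nlia.
have mk : k + 2 <= m by rewrite /m; nlia.
rewrite mE; cbv beta; apply: many_cat.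
have le1 : d + #|F| + size (x :: y :: L) + (k - 2) <= n by rewrite /=; nlia.
apply: many_mono (many_free_cat uL le1) => W szW /andP[uW WF].
have uyW : uniq (y :: W).
  apply: (@perm_uniq_sub _ _ (x :: L)) uW; perm_count.
have uxW : uniq (x :: W).
  apply: (@perm_uniq_sub _ _ (y :: L)) uW; perm_count.
cbv beta; apply: many_cat; apply: (@many_nb _ F (W ++ x :: y :: L) (y :: W)) => //; first by rewrite /=; nlia.
  by rewrite size_cat /=; nlia.
move=> p ep pF pL; have up : uniq (p :: W ++ x :: y :: L) by rewrite /= pL.
cbv beta; apply: many_cat; apply: (@many_nb _ F (p :: W ++ x :: y :: L) (x :: W)) => //; first by rewrite /=; nlia.
  by rewrite /= size_cat /=; nlia.
move=> q eq qF qL; have uq : uniq (q :: p :: W ++ x :: y :: L) by rewrite cons_uniq qL.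
cbv beta; apply: many_cat.
have le2 : d + #|F| + size (q :: p :: W ++ x :: y :: L) + (k - 2 - l) <= n.
  by rewrite /= size_cat /=; nlia.
apply: many_mono (many_free_cat uq le2) => Z szZ /andP[uZ ZF].
pose X := take (l - 1) W; pose Z' := drop (l - 1) W.
have WE : W = X ++ Z' by rewrite cat_take_drop.
have szX : size X = l - 1 by rewrite size_take szW; case: ltnP; nlia.
have szZ' : size Z' = k - 1 - l by rewrite size_drop szW; nlia.
have us : uniq (p :: q :: X ++ Z).
  apply: (@perm_uniq_sub _ _ (Z' ++ x :: y :: L)) uZ.
  by rewrite WE; perm_count.
apply: (@many_nb _ F (Z ++ q :: p :: W ++ x :: y :: L) (p :: q :: X ++ Z)) => //.
- by rewrite /= size_cat szX szZ; nlia.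
- by rewrite /= size_cat /= size_cat /=; nlia.
move=> z ez zF zL.
have uz : uniq (z :: Z ++ q :: p :: W ++ x :: y :: L) by rewrite cons_uniq zL.
apply/and4P; split.
- rewrite -(perm_uniq (_ : perm_eq (z :: Z ++ q :: p :: W ++ x :: y :: L) _)) //.
  by perm_count.
- by rewrite !all_cat WF /= pF qF ZF zF.
- rewrite (@eq_setof _ _ ((q :: X) ++ (p :: Z ++ [:: z]) ++ (x :: Z'))); last first.
    by apply: perm_mem; rewrite WE; perm_count.
  apply: isY_seq; last 1 first.
  + rewrite -(edge_perm _ (_ : perm_eq (q :: x :: W) _)) //.
    by rewrite WE; perm_count.
  + apply: (@perm_uniq_sub _ _ (y :: L)) uz.
    by rewrite WE; perm_count.
  + by rewrite /= szX; nlia.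
  + rewrite -(edge_perm _ (_ : perm_eq (z :: p :: q :: X ++ Z) _)) //.
    by perm_count.
- rewrite (@eq_setof _ _ ((p :: X) ++ (q :: Z ++ [:: z]) ++ (y :: Z'))); last first.
    by apply: perm_mem; rewrite WE; perm_count.
  apply: isY_seq; last 1 first.
  + rewrite -(edge_perm _ (_ : perm_eq (p :: y :: W) _)) //.
    by rewrite WE; perm_count.
  + apply: (@perm_uniq_sub _ _ (x :: L)) uz.
    by rewrite WE; perm_count.
  + by rewrite /= szX; nlia.
  + rewrite -(edge_perm _ (_ : perm_eq (z :: p :: q :: X ++ Z) _)) //.
    by perm_count.
Qed.

Lemma reach_list (d : nat) xs ys L F : size ys = size xs -> uniq (xs ++ ys ++ L) ->
  d + #|F| + size L + size xs * (m + 1) + 2 * m <= t ->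
  many d (size xs * (m - 1)) (fun s => [&& uniq (s ++ xs ++ ys ++ L), all (fun v => v \notin F) s,
    tileable H l (setof (xs ++ s)) & tileable H l (setof (ys ++ s))]).
Proof.
elim: xs ys L => [|x xs IH] [|y ys] L //= => [_ uL _|[szy] uL le_d].
  by rewrite uL (_ : setof [::] = set0) ?tileable0 //; apply/setP => x; rewrite !inE.
rewrite mulSn; apply: many_cat.
have uL' : uniq (x :: y :: xs ++ ys ++ L).
  rewrite -(perm_uniq (_ : perm_eq ((x :: xs) ++ (y :: ys) ++ L) _)) //.
  by perm_count.
have le1 : d + #|F| + size (xs ++ ys ++ L) + 2 * m <= t by rewrite !size_cat szy; nnia.
apply: many_mono (reach uL' le1) => s1 sz1 /and4P[u1 F1 Yx Yy].
have u1' : uniq (xs ++ ys ++ s1 ++ x :: y :: L).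
  rewrite -(perm_uniq (_ : perm_eq (s1 ++ x :: y :: xs ++ ys ++ L) _)) //.
  by perm_count.
have mk : k + 2 <= m by rewrite /m; nlia.
have le2 : d + #|F| + size (s1 ++ x :: y :: L) + size xs * (m + 1) + 2 * m <= t.
  by rewrite size_cat sz1 /=; nnia.
apply: many_mono (IH _ _ szy u1' le2) => s2 sz2 /and4P[u2 F2 Tx Ty].
apply/and4P; split.
- rewrite -(perm_uniq (_ : perm_eq (s2 ++ xs ++ ys ++ s1 ++ x :: y :: L) _)) //.
  by perm_count.
- by rewrite all_cat F1 F2.
- rewrite (@eq_setof _ _ ((x :: s1) ++ (xs ++ s2))); last first.
    by apply: perm_mem; perm_count.
  rewrite setof_cat; apply: tileableU (tileable1 Yx) Tx; apply: uniq_disjoint.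
  apply: (@perm_uniq_sub _ _ (ys ++ y :: L)) u2.
  by perm_count.
- rewrite (@eq_setof _ _ ((y :: s1) ++ (ys ++ s2))); last first.
    by apply: perm_mem; perm_count.
  rewrite setof_cat; apply: tileableU (tileable1 Yy) Ty; apply: uniq_disjoint.
  apply: (@perm_uniq_sub _ _ (xs ++ x :: L)) u2.
  by perm_count.
Qed.

Lemma many_Y (d : nat) L F : uniq L -> d + #|F| + size L + m <= t ->
  many d m (fun s => [&& uniq (s ++ L), all (fun v => v \notin F) s & isY H l (setof s)]).
Proof.
move=> uL le_d.
have mE : m = l + ((k - 1 - l) + (1 + ((k - 1 - l) + 1))) by rewrite /m; nlia.
rewrite [in many _ m]mE; cbv beta; apply: many_cat.
have le1 : d + #|F| + size L + l <= n by nlia.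
apply: many_mono (many_free_cat uL le1) => I szI /andP[uI IF].
cbv beta; apply: many_cat.
have le2 : d + #|F| + size (I ++ L) + (k - 1 - l) <= n by rewrite size_cat; nlia.
apply: many_mono (many_free_cat uI le2) => J szJ /andP[uJ JF].
cbv beta; apply: many_cat; apply: (@many_nb _ F (J ++ I ++ L) (J ++ I)) => //.
- by move: uJ; rewrite catA cat_uniq => /andP[].
- by rewrite size_cat; nlia.
- by rewrite !size_cat; nlia.
move=> z ez zF zL; have uz : uniq (z :: J ++ I ++ L) by rewrite cons_uniq zL.
cbv beta; apply: many_cat.
have le3 : d + #|F| + size (z :: J ++ I ++ L) + (k - 1 - l) <= n by rewrite /= !size_cat; nlia.
apply: many_mono (many_free_cat uz le3) => J' szJ' /andP[uJ' J'F].
apply: (@many_nb _ F (J' ++ z :: J ++ I ++ L) (J' ++ I)) => //.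
- apply: (@perm_uniq_sub _ _ (z :: J ++ L)) uJ'.
  by perm_count.
- by rewrite size_cat; nlia.
- by rewrite /= !size_cat /= !size_cat; nlia.
move=> z' ez' z'F z'L; have uz' : uniq (z' :: J' ++ z :: J ++ I ++ L) by rewrite cons_uniq z'L.
apply/and3P; split.
- rewrite -(perm_uniq (_ : perm_eq (z' :: J' ++ z :: J ++ I ++ L) _)) //.
  by perm_count.
- by rewrite !all_cat IF JF /= zF J'F z'F.
- rewrite (@eq_setof _ _ (I ++ (J ++ [:: z]) ++ (J' ++ [:: z']))); last first.
    by apply: perm_mem; perm_count.
  apply: isY_seq => //.
  + apply: (@perm_uniq_sub _ _ L) uz'.
    by perm_count.
  + rewrite -(edge_perm _ (_ : perm_eq (z :: J ++ I) _)) //.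
    by perm_count.
  + rewrite -(edge_perm _ (_ : perm_eq (z' :: J' ++ I) _)) //.
    by perm_count.
Qed.

(** An absorber of [R] is a copy of Y on some [y] together with connectors exchanging [R] for [y].
    Without [R], the connectors are tiled with [y]; with [R], they are tiled with [R], and [y] is a
    tile by itself. This uses [m + m * (m - 1) = m * m] vertices. *)
Lemma many_absorbers (d : nat) R F : #|R| = m -> d + #|F| + m * (m + 5) <= t ->
  many d (m * m) (fun s => [&& uniq s, all (fun v => v \notin F) s, [disjoint setof s & R],
    tileable H l (setof s) & tileable H l (setof s :|: R)]).
Proof.
move=> cR le_d; have mk : k + 2 <= m by rewrite /m; nlia.
have RE : R = setof (enum R) by apply/setP => x; rewrite inE mem_enum.
have mE : m * m = m + size (enum R) * (m - 1) by rewrite -cardE cR; nnia.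
rewrite mE; cbv beta; apply: many_cat.
have le1 : d + #|F| + size (enum R) + m <= t by rewrite -cardE cR; nnia.
apply: many_mono (many_Y (enum_uniq _) le1) => y szy /and3P[uy yF Yy].
have u1 : uniq (enum R ++ y ++ [::]) by rewrite cats0 uniq_catC.
have szy' : size y = size (enum R) by rewrite szy -cardE cR.
have le2 : d + #|F| + size (@nil V) + size (enum R) * (m + 1) + 2 * m <= t.
  by rewrite /= -cardE cR; nnia.
apply: many_mono (reach_list szy' u1 le2) => s _ /and4P[us sF TR Ty].
rewrite cats0 in us.
apply/and5P; split.
- apply: (@perm_uniq_sub _ _ (enum R)) us.
  by perm_count.
- by rewrite all_cat yF sF.
- rewrite RE; apply: uniq_disjoint.
  rewrite -(perm_uniq (_ : perm_eq (s ++ enum R ++ y) _)) //.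
  by perm_count.
- by [].
- rewrite RE -setof_cat (@eq_setof _ _ (y ++ (enum R ++ s))); last first.
    by apply: perm_mem; perm_count.
  rewrite setof_cat; apply: tileableU (tileable1 Yy) TR; apply: uniq_disjoint.
  rewrite -(perm_uniq (_ : perm_eq (s ++ enum R ++ y) _)) //.
  by perm_count.
Qed.

End Reachability.

(** * Absorbing sets *)

Lemma ffact_le_exp n r : n ^_ r <= n ^ r.
Proof.
elim: r n => [|r IH] [|n]; rewrite ?ffactn0 ?ffact0n //.
rewrite ffactSS expnS leq_mul2l /=; apply: leq_trans (IH n) _.
by case: (r) => // r'; rewrite leq_exp2r.
Qed.

Lemma bernoulli_nat E s : E ^ s * (E + s) <= E.+1 ^ s * E.
Proof.
elim: s => [|s IH]; first by rewrite !mul1n addn0.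
rewrite !expnS; move: (E ^ s) (E.+1 ^ s) IH => a b IH.
have : a * (E + s) * E.+1 <= b * E * E.+1 by rewrite leq_mul2r IH orbT.
nnia.
Qed.

(** Linearly many steps are allowed where logarithmically many would do, so a crude bound is enough:
    Bernoulli gives [(1 + 1/E)^s >= s/E], and the (m+1)-st power of the right side exceeds [n ^ m]
    once [s] is large and [n <= Q * s]. *)
Lemma geometric_beats_power E Q n m s :
  0 < E -> n <= Q * s -> Q ^ m * E ^ m.+1 < s ->
  E ^ (s * m.+1) * n ^ m < E.+1 ^ (s * m.+1).
Proof.
move=> E0 nQ sE.
have lt0E : 0 < E ^ m.+1 by rewrite expn_gt0 E0.
have lt0Es : 0 < E ^ (s * m.+1) by rewrite expn_gt0 E0.
have s0 : 0 < s by apply: leq_trans sE.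
have b1 : E ^ (s * m.+1) * (E + s) ^ m.+1 <= E.+1 ^ (s * m.+1) * E ^ m.+1.
  by rewrite !expnM -!expnMn leq_exp2r // bernoulli_nat.
have b2 : n ^ m <= Q ^ m * s ^ m by rewrite -expnMn; case: (m) => // ?; rewrite leq_exp2r.
have b3 : s * s ^ m <= (E + s) ^ m.+1 by rewrite -expnS leq_exp2r // leq_addl.
have sm0 : 0 < s ^ m by rewrite expn_gt0 s0.
rewrite -(ltn_pmul2r lt0E); apply: leq_trans b1.
rewrite -mulnA ltn_pmul2l //; apply: leq_trans b3.
apply: (@leq_ltn_trans (Q ^ m * s ^ m * E ^ m.+1)); first by rewrite leq_mul2r b2 orbT.
by rewrite mulnAC ltn_pmul2r.
Qed.

Section Absorbing.
Variables (V : finType) (H : {set {set V}}) (k l n t : nat).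
Hypotheses (hk : 3 <= k) (hl1 : 1 <= l) (hl2 : l <= k - 2).
Hypotheses (cardV : #|V| = n) (tn : t <= n).
Hypothesis codegH : forall s, uniq s -> size s = k.-1 -> t <= #|[set v | edge H (v :: s)]|.
Implicit Types (A F R U : {set V}).
Let m := 2 * k - l.
Let q := m * m.

Definition unabsorbed A : {set {set V}} :=
  [set R : {set V} | [&& #|R| == m, [disjoint R & A] & ~~ tileable H l (A :|: R)]].

(** Averaging: at least [d ^ q] of the [n ^ q] tuples absorb a given [R], so some tuple absorbs a
    fraction [1 / K ^ q] of the unabsorbed sets. That tuple is tileable by itself, so adding it to
    [A] spoils no set already absorbed. *)
Lemma absorb_step (d K : nat) F A :
  0 < d -> n <= K * d -> d + #|F| + #|A| + m * (m + 5) <= t ->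
  [disjoint A & F] -> tileable H l A ->
  exists A', [/\ [disjoint A' & F], tileable H l A', #|A'| <= #|A| + q &
     K ^ q * #|unabsorbed A'| <= (K ^ q).-1 * #|unabsorbed A|].
Proof.
move=> d0 nK le_d dAF TA; set D := K ^ q.
case: (set_0Vmem (unabsorbed A)) => [un0|[R0 R0un]].
  by exists A; rewrite un0 cards0 !muln0 leq_addr; split.
pose abs s R := [&& uniq s, all (fun v => v \notin F :|: A) s, [disjoint setof s & R],
    tileable H l (setof s) & tileable H l (setof s :|: R)].
pose N (x : q.-tuple V) := #|[set R in unabsorbed A | abs x R]|.
have un_gt0 : 0 < #|unabsorbed A| by apply/card_gt0P; exists R0.
have n0 : 0 < n by nlia.
have [x le_x] : exists x, #|unabsorbed A| <= D * N x.
  apply/existsP; apply: contraT => /existsPn lt_x.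
  have sumN : \sum_x N x = \sum_(R in unabsorbed A) cnt q (fun s => abs s R).
    rewrite (eq_bigr (fun x : q.-tuple V => \sum_(R in unabsorbed A | abs x R) 1)); last first.
      by move=> x _; rewrite /N -sum1_card; apply: eq_bigl => R; rewrite inE.
    rewrite (exchange_big_dep (fun R => R \in unabsorbed A)) /=; last by move=> x R _ /andP[].
    apply: eq_bigr => R Run; rewrite cntE; apply: eq_bigl => x; by rewrite Run.
  have le_sum : #|unabsorbed A| * d ^ q <= \sum_x N x.
    rewrite sumN -sum_nat_const; apply: leq_sum => R; rewrite inE => /and3P[/eqP cR _ _].
    apply: many_cnt; apply: (@many_absorbers V H k l n t) => //.
    by rewrite -/m; have := cardU_le F A; nlia.
  have lt_sum : \sum_x D * N x < n ^ q * #|unabsorbed A|.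
    apply: (@leq_ltn_trans (\sum_(x : q.-tuple V) #|unabsorbed A|.-1)).
      by apply: leq_sum => x _; have := lt_x x; rewrite -ltnNge; nlia.
    rewrite sum_nat_const card_tuple cardV ltn_pmul2l; first by nlia.
    by rewrite expn_gt0 n0.
  move: lt_sum; rewrite -big_distrr /= => lt_sum.
  have : n ^ q <= D * d ^ q.
    by rewrite /D -expnMn; case: (q) => // ?; rewrite leq_exp2r.
  move: le_sum lt_sum; move: (\sum_x N x) (n ^ q) (d ^ q) (#|unabsorbed A|) => S a b u le1 lt2 le3.
  have : D * (u * b) <= D * S by rewrite leq_mul2l le1 orbT.
  have : a * u <= D * b * u by rewrite leq_mul2r le3 orbT.
  by nlia.
have [R1] : exists R, R \in [set R in unabsorbed A | abs x R].
  by apply/card_gt0P; move: le_x; rewrite -/(N x); case: (N x) => //; rewrite muln0 leqn0 => /eqP un0; move: un_gt0; rewrite un0.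
rewrite inE => /andP[_ /and5P[ux /allP xF _ Tx _]].
have xFA v : v \in x -> (v \notin F) && (v \notin A) by move/xF; rewrite inE negb_or.
have dAx : [disjoint A & setof x].
  rewrite disjoint_sym disjoint_subset; apply/subsetP => v; rewrite !inE => /xFA /andP[_ vA]; exact: vA.
exists (A :|: setof x); split.
- rewrite disjoint_setU dAF /= disjoint_subset; apply/subsetP => v; rewrite !inE => /xFA /andP[vF _]; exact: vF.
- exact: tileableU.
- apply: leq_trans (cardU_le _ _) _; rewrite leq_add2l.
  by apply: leq_trans (card_set_of_seq _) _; rewrite size_tuple.
have sub : unabsorbed (A :|: setof x) \subset unabsorbed A :\: [set R in unabsorbed A | abs x R].
  apply/subsetP => R; rewrite !inE => /and3P[cR]; rewrite disjoint_sym disjoint_setU.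
  move=> /andP[dAR dxR] nT; rewrite cR [in [disjoint R & A]]disjoint_sym dAR /=.
  apply/andP; split; last first.
    apply: contra nT => TAR; rewrite setUAC; apply: tileableU => //.
    by rewrite disjoint_setU dAx disjoint_sym.
  rewrite negb_and; apply/orP; right; apply: contra nT => /and5P[_ _ _ _ TxR].
  by rewrite -setUA; apply: tileableU => //; rewrite disjoint_sym disjoint_setU ![[disjoint _ & A]]disjoint_sym dAx dAR.
have := subset_leq_card sub; rewrite cardsD (setIidPr _); last first.
  by apply/subsetP => R; rewrite inE => /andP[].
move: le_x; rewrite -/(N x); move: (N x) #|unabsorbed A| #|unabsorbed _| => a b c.
case: (D) => [|D']; first by rewrite mul0n.
rewrite /=; nnia.
Qed.

(** At most [n ^ m] sets are unabsorbed at the start, so after [s] steps fewer than one is left. The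
    result absorbs any single m-set, but only one at a time. *)
Lemma absorbing_round (d K s : nat) F :
  0 < d -> n <= K * d -> d + #|F| + s * q + m * (m + 5) <= t ->
  (K ^ q).-1 ^ s * n ^ m < (K ^ q) ^ s ->
  exists A, [/\ [disjoint A & F], tileable H l A, #|A| <= s * q &
     forall R, #|R| = m -> [disjoint R & A] -> tileable H l (A :|: R)].
Proof.
move=> d0 nK le_d lt_s; set D := K ^ q in lt_s.
have [A [dAF TA cA le_A]] : exists A, [/\ [disjoint A & F], tileable H l A, #|A| <= s * q &
    D ^ s * #|unabsorbed A| <= D.-1 ^ s * #|unabsorbed set0|].
  elim: (s) le_d => [|s' IH] le_d.
    by exists set0; rewrite cards0 disjoints_subset sub0set tileable0; split.
  have [|A [dAF TA cA le_A]] := IH; first by nlia.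
  have [|A' [dAF' TA' cA' le_A']] := absorb_step d0 nK _ dAF TA; first by nlia.
  exists A'; split=> //; first by nlia.
  rewrite !expnS; move: le_A le_A'; rewrite -/D.
  move: #|unabsorbed A'| #|unabsorbed A| #|unabsorbed set0| (D ^ s') (D.-1 ^ s') => a b c x y le1 le2.
  have : x * (D * a) <= x * (D.-1 * b) by rewrite leq_mul2l le2 orbT.
  have : D.-1 * (x * b) <= D.-1 * (y * c) by rewrite leq_mul2l le1 orbT.
  by move: (D.-1) => D1; nlia.
exists A; split=> // R cR dRA; apply: contraT => nT.
have un_gt0 : 0 < #|unabsorbed A|.
  by apply/card_gt0P; exists R; rewrite inE cR eqxx dRA.
have : #|unabsorbed set0| <= n ^ m.
  apply: (@leq_trans #|[set R : {set V} | #|R| == m]|).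
    by apply/subset_leq_card/subsetP => R'; rewrite !inE => /and3P[].
  rewrite card_draws cardV; apply: leq_trans (ffact_le_exp n m).
  by rewrite -bin_ffact leq_pmulr // fact_gt0.
move=> le_n; suff : D ^ s <= D.-1 ^ s * n ^ m by rewrite leqNgt lt_s.
apply: leq_trans (leq_trans le_A _); first by rewrite leq_pmulr.
by rewrite leq_mul2l le_n orbT.
Qed.

(** [L] disjoint sets from [absorbing_round], each absorbing one m-set cut from the leftover; the
    sets left over when [r < L] are tiled by themselves. *)
Lemma absorbing_set (d K s L : nat) :
  0 < d -> n <= K * d -> d + L * (s * q) + m * (m + 5) <= t ->
  (K ^ q).-1 ^ s * n ^ m < (K ^ q) ^ s ->
  exists2 A : {set V}, #|A| <= L * (s * q) &
     forall r U, r <= L -> [disjoint U & A] -> #|U| = r * m -> tileable H l (A :|: U).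
Proof.
move=> d0 nK le_d lt_s; elim: L le_d => [|L IH] le_d.
  exists set0; first by rewrite cards0.
  move=> r U; rewrite leqn0 => /eqP -> _ /eqP; rewrite mul0n cards_eq0 => /eqP ->.
  by rewrite setU0 tileable0.
have [|A cA absA] := IH; first by nlia.
have [|B [dBA TB cB absB]] := absorbing_round (F := A) d0 nK _ lt_s; first by nlia.
exists (A :|: B); first by have := cardU_le A B; nlia.
move=> r U le_r; rewrite disjoint_sym disjoint_setU => /andP[dAU dBU] cU.
case: r le_r cU => [|r] le_r cU.
  have -> : U = set0 by apply/eqP; rewrite -cards_eq0 cU.
  rewrite setU0; apply: tileableU => //; first by rewrite disjoint_sym.
  by rewrite -[A]setU0; apply: (absA 0); rewrite ?cards0 // disjoints_subset sub0set.
have [|R [szR uR RU _]] := @fresh V m U set0; first by rewrite cards0 cU mulSn leq_addr.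
have sRU : setof R \subset U by apply/subsetP => x; rewrite inE => /(allP RU).
have cR : #|setof R| = m by rewrite card_setof.
have -> : A :|: B :|: U = (A :|: (U :\: setof R)) :|: (B :|: setof R).
  rewrite setUACA; congr (_ :|: _); apply/setP => x; rewrite !inE.
  case xR: (x \in R) => /=; last by rewrite orbF.
  by move/subsetP: sRU => /(_ x); rewrite inE xR => ->.
apply: tileableU.
- rewrite disjoint_setU ![[disjoint _ & _ :|: _]]disjoint_sym !disjoint_setU.
  rewrite dBA /= [X in X && _]disjoint_sym (disjointWr sRU dAU) /=.
  rewrite (disjointWr (subsetDl _ _) dBU) /= disjoint_sym.
  by rewrite -setI_eq0 setIDAC setIC setDIl setDv setI0 || (rewrite disjoint_subset; apply/subsetP => x; rewrite !inE => /andP[]).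
- apply: (absA r) => //; first by rewrite disjoint_sym (disjointWr (subsetDl _ _) dAU).
  by rewrite cardsD (setIidPr sRU) cU cR mulSn addKn.
- by apply: absB => //; rewrite disjoint_sym (disjointWr sRU dBU).
Qed.

End Absorbing.

(** * Copies of Y from positive codegree *)

Lemma card_union_bound (T I : finType) (A : {set T}) (B : I -> {set T}) :
  (forall x, x \in A -> exists i, x \in B i) -> #|A| <= \sum_i #|B i|.
Proof.
move=> AB; apply: (@leq_trans #|\bigcup_i B i|).
  by apply/subset_leq_card/subsetP => x /AB[i xi]; apply/bigcupP; exists i.
elim/big_rec2: _ => [|i c U _ IH]; first by rewrite cards0.
by apply: leq_trans (cardU_le _ _) _; rewrite leq_add2l.
Qed.

(** The cost of one bad event in a union bound over functions [rho]: the coordinates in [js] form a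
    bad tuple and the others are free. The maps [F j] let each coordinate be read through its own
    injection, as needed when coordinates are rows seen in different columns. *)
Lemma proj_cnt (p : nat) (T V : finType) (js : seq 'I_p) (F : 'I_p -> T -> V) (Bd : pred (seq V)) :
  uniq js -> (forall j, injective (F j)) ->
  #|[set rho : {ffun 'I_p -> T} | Bd [seq F j (rho j) | j <- js]]|
    <= cnt (size js) Bd * #|T| ^ (p - size js).
Proof.
move=> ujs injF.
pose B (y : (size js).-tuple V) := if Bd y then
   [set rho : {ffun 'I_p -> T} | [seq F j (rho j) | j <- js] == y] else set0.
apply: leq_trans (card_union_bound (B := B) _) _.
  move=> rho; rewrite inE => bd; exists (map_tuple (fun j => F j (rho j)) (in_tuple js)).
  by rewrite /B /= bd inE.
rewrite cntE big_distrl /= [X in _ <= X]big_mkcond; apply: leq_sum => y _.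
rewrite /B; case: ifP => _; last by rewrite cards0.
rewrite mul1n.
pose S : finType := {j : 'I_p | j \notin js}.
have cS : #|S| = p - size js.
  rewrite card_sig; apply/eqP; rewrite -(eqn_add2l (size js)) -(card_uniqP ujs).
  have le_js : #|js| <= p by rewrite -[X in _ <= X](card_ord p) max_card.
  rewrite subnKC // -[X in _ == X](card_ord p) -(cardC (mem js)) eqn_add2l.
  by apply/eqP/eq_card.
rewrite -cS -card_ffun -(card_in_imset (f := fun rho : {ffun 'I_p -> T} => [ffun j : S => rho (val j)])).
  exact: max_card.
move=> rho rho'; rewrite !inE => /eqP mp /eqP mp' /ffunP eq_out; apply/ffunP => j.
case: (boolP (j \in js)) => jjs; last first.
  by have := eq_out (exist _ j jjs); rewrite !ffunE.
by apply: (injF j); move: j jjs; apply/eq_in_map; rewrite mp mp'.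
Qed.

Section Core.
Variables (V : finType) (H : {set {set V}}) (k l : nat).
Hypotheses (hk : 3 <= k) (hl1 : 1 <= l) (hl2 : l <= k - 2).
Hypothesis unifH : forall e, e \in H -> #|e| = k.
Implicit Types (P Z F : {set V}) (I J s : seq V).

Section CoreStep.
Variables P Z : {set V}.
Hypotheses (PZ : P \subset Z) (cP : k * k + 4 * k <= #|P|).
Hypothesis nbP : forall s, uniq s -> all (mem P) s -> size s = k.-1 ->
  exists2 u, u \in Z & edge H (u :: s).
Hypothesis noY : forall I J J', uniq (I ++ J ++ J') -> size I = l ->
  all (mem Z) (I ++ J ++ J') -> edge H (I ++ J) -> edge H (I ++ J') -> False.

Let allPZ s : all (mem P) s -> all (mem Z) s.
Proof. by apply: sub_all => x /=; apply/subsetP. Qed.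

(** By [noY], two edges in [Z] through [I] never meet exactly in [I]. If [c] fails to complete some
    [I ++ J], a neighbour [w] of [I ++ J] gives an edge through [I] without [c], and every edge
    [c :: I ++ J'] has to meet [w :: J] in [J']. The sets [w :: J], with at most k vertices each,
    make up [B]. *)
Lemma core_blockers I (C : seq V) : uniq I -> size I = l -> all (mem P) I ->
  (forall c, c \in C -> [/\ c \in Z, c \notin I &
     exists J, [/\ uniq (c :: I ++ J), size J = k - 1 - l, all (mem P) J & ~~ edge H (c :: I ++ J)]]) ->
  exists2 B : {set V}, #|B| <= size C * k &
    forall J u, uniq (I ++ J) -> size J = k - 1 - l -> all (mem P) J ->
      all (fun x => x \notin B) J -> u \in C -> ~~ edge H (u :: I ++ J).
Proof.
move=> uI sI PI; elim: C => [|c C IH] hC.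
  by exists set0; rewrite ?cards0.
have [|B cB hB] := IH; first by move=> c' c'C; apply: hC; rewrite inE c'C orbT.
have [cZ cI [J [uJ sJ PJ neJ]]] := hC c (mem_head _ _).
have [|||w wZ ew] := nbP (s := I ++ J); first by case/andP: uJ.
- by rewrite all_cat PI PJ.
- by rewrite size_cat sI sJ; nlia.
exists (setof (w :: J) :|: B).
  have := cardU_le (setof (w :: J)) B; have := card_set_of_seq (w :: J).
  rewrite -/(setof _) /= sJ; nlia.
move=> J' u uJ' sJ' PJ' J'B; rewrite inE => /orP[/eqP ->{u}|uC]; last first.
  apply: hB => //; apply/allP => x /(allP J'B); rewrite inE negb_or; by case/andP.
apply/negP => ec.
have uc : uniq (c :: I ++ J') by apply: (edge_uniq unifH ec); rewrite /= size_cat sI sJ'; nlia.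
have cw : c != w by apply/eqP => cw; move: neJ; rewrite cw ew.
have uw : uniq (w :: I ++ J) by apply: (edge_uniq unifH ew); rewrite /= size_cat sI sJ; nlia.
have dJ : uniq ((c :: J') ++ w :: I ++ J).
  rewrite cat_uniq uw andbT; apply/andP; split.
    by move: uc; rewrite /= cat_uniq mem_cat negb_or => /andP[/andP[_ ->] /and3P[_ _ ->]].
  rewrite has_sym; apply/hasPn => x; rewrite inE => /orP[/eqP ->|xJ'].
    by move: uJ => /= /andP[cIJ _]; rewrite inE negb_or cw cIJ.
  have := allP J'B x xJ'; rewrite !inE !negb_or => /andP[/andP[xw xJ] _].
  rewrite ?inE ?mem_cat !negb_or xw xJ andbT /=; apply/negP => xI; move: uJ'; rewrite cat_uniq => /and3P[_ /hasPn /(_ x xJ')].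
  by rewrite /= xI.
apply: (@noY I (c :: J') (w :: J)) => //.
- by rewrite -(perm_uniq (_ : perm_eq ((c :: J') ++ w :: I ++ J) _)) //; perm_count.
- by rewrite !all_cat /= cZ wZ !allPZ.
- by rewrite -(edge_perm _ (_ : perm_eq (c :: I ++ J') _)) //; perm_count.
- by rewrite -(edge_perm _ (_ : perm_eq (w :: I ++ J) _)) //; perm_count.
Qed.

(** Otherwise every vertex of a first edge [v1 :: I ++ J1] outside [I] has blockers. If [J] avoids
    this edge and all blockers, then the neighbour [u] of [I ++ J] lies outside the edge as well,
    and the two edges meet exactly in [I]. *)
Lemma core_extend I : uniq I -> size I = l -> all (mem P) I ->
  exists v, [/\ v \in Z, v \notin I & forall J, uniq (v :: I ++ J) -> size J = k - 1 - l ->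
     all (mem P) J -> edge H (v :: I ++ J)].
Proof.
move=> uI sI PI.
pose good v := [&& v \in Z, v \notin I & [forall J : (k - 1 - l).-tuple V,
  uniq (v :: I ++ J) ==> all (mem P) J ==> edge H (v :: I ++ J)]].
have [v /and3P[vZ vI /forallP vP]|nogood] := pickP good.
  exists v; split=> // J uJ sJ PJ.
  have := vP (Tuple (introT eqP sJ)); rewrite uJ PJ; exact.
exfalso.
have [|J1 [sJ1 uJ1 PJ1 J1I]] := @fresh V (k - 1 - l) P (setof I).
  by have := card_set_of_seq I; rewrite -/(setof I) sI; nlia.
have uIJ1 : uniq (I ++ J1).
  rewrite cat_uniq uI uJ1 andbT /=; apply/hasPn => x /(allP J1I); by rewrite inE.
have [||v1 v1Z e1] := nbP uIJ1; first by rewrite all_cat PI PJ1.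
  by rewrite size_cat sI sJ1; nlia.
have uv1 : uniq (v1 :: I ++ J1) by apply: (edge_uniq unifH e1); rewrite /= size_cat sI sJ1; nlia.
have [|B cB hB] := @core_blockers I (v1 :: J1) uI sI PI.
  move=> c cC; have cZ : c \in Z.
    by move: cC; rewrite inE => /orP[/eqP -> //|/(allP (allPZ PJ1))].
  have cI : c \notin I.
    move: cC; rewrite inE => /orP[/eqP ->|/(allP J1I)]; last by rewrite inE.
    by move: uv1; rewrite /= mem_cat negb_or => /andP[/andP[]].
  split=> //; have /negbT := nogood c; rewrite /good cZ cI /= => /forallPn[J].
  rewrite !negb_imply => /and3P[uJ PJ nJ]; exists J; split=> //; exact: size_tuple.
have [|J [sJ uJ PJ JF]] := @fresh V (k - 1 - l) P (setof (v1 :: I ++ J1) :|: B).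
  have := cardU_le (setof (v1 :: I ++ J1)) B; have := card_set_of_seq (v1 :: I ++ J1).
  move: cB; rewrite -/(setof _) /= size_cat sI sJ1; nnia.
have JB : all (fun x => x \notin B) J by apply/allP => x /(allP JF); rewrite inE negb_or => /andP[].
have Jv x : x \in J -> x \notin v1 :: I ++ J1 by move/(allP JF); rewrite inE negb_or inE => /andP[].
have uIJ : uniq (I ++ J).
  rewrite cat_uniq uI uJ andbT /=; apply/hasPn => x /Jv; rewrite /= inE mem_cat !negb_or => /and3P[_ xI _].
  exact: xI.
have [||u uZ eu] := nbP uIJ; first by rewrite all_cat PI PJ.
  by rewrite size_cat sI sJ; nlia.
have uu : uniq (u :: I ++ J) by apply: (edge_uniq unifH eu); rewrite /= size_cat sI sJ; nlia.
have uC : u \notin v1 :: J1 by apply/negP => uC; move: eu; rewrite (negbTE (hB _ _ uIJ sJ PJ JB uC)).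
apply: (@noY I (v1 :: J1) (u :: J)) => //.
- rewrite -(perm_uniq (_ : perm_eq ((u :: J) ++ v1 :: I ++ J1) _)) //; last by perm_count.
  rewrite cat_uniq uv1 andbT; apply/andP; split.
    by move: uu; rewrite /= cat_uniq mem_cat negb_or => /andP[/andP[_ ->] /and3P[_ _ ->]].
  rewrite has_sym; apply/hasPn => x; rewrite inE => /orP[/eqP ->|/Jv //].
  move: uC uu; rewrite inE negb_or => /andP[uv uJ'] /= /andP[].
  rewrite mem_cat negb_or => /andP[uI' _] _.
  by rewrite inE mem_cat !negb_or uv uI' uJ'.
- by rewrite !all_cat /= v1Z uZ !allPZ.
- by rewrite -(edge_perm _ (_ : perm_eq (v1 :: I ++ J1) _)) //; perm_count.
- by rewrite -(edge_perm _ (_ : perm_eq (u :: I ++ J) _)) //; perm_count.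
Qed.

(** Two l-sets [a :: I0] and [b :: I0] have universal extensions [v1] and [v2]. If [v1 = v2], two
    edges can be made to share exactly [v1 :: I0]; if [v2 = a], exactly [a :: I0]; otherwise one
    vertex [c] is put into both edges, which then share [c :: I0]. The first cases need a vertex to
    replace in the l-set, and [c] needs a free place besides the extension. *)
Lemma core_false : False.
Proof.
have [|I1 [sI1 uI1 PI1 _]] := @fresh V l P set0; first by rewrite cards0; nnia.
case: I1 sI1 uI1 PI1 => [|a I0] sI1 uI1 PI1; first by move: sI1 hl1 => /= <-.
have [v1 [v1Z v1I hv1]] := core_extend uI1 sI1 PI1.
have [|bs [sb _ Pb bF]] := @fresh V 1 P (setof (v1 :: a :: I0)).
  have := card_set_of_seq (v1 :: a :: I0); rewrite -/(setof _) /=.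
  by move: sI1 => /= sI1; nnia.
case: bs sb Pb bF => [|b [|b' bs]] // _ Pb bF.
have bI : b \notin v1 :: a :: I0 by move: bF; rewrite /= inE andbT.
have sI0 : (size I0).+1 = l by [].
have [Pa PI0] : a \in P /\ all (mem P) I0 by apply/andP.
have [aI0 uI0] : a \notin I0 /\ uniq I0 by apply/andP; rewrite -cons_uniq.
have [|||v2 [v2Z v2I hv2]] := @core_extend (b :: I0).
- by rewrite cons_uniq uI0 andbT; move: bI; rewrite !inE !negb_or => /and3P[].
- by rewrite /= sI0.
- by move: Pb => /= /andP[-> _].
have bP : b \in P by move: Pb => /= /andP[].
have [|M [sM uM PM MF]] := @fresh V (2 * (k - 1 - l)) P (setof (v1 :: v2 :: a :: b :: I0)).
  have := card_set_of_seq (v1 :: v2 :: a :: b :: I0); rewrite -/(setof _) /=; nnia.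
have [c [c2 [J1 [J2 [ME sJ1 sJ2]]]]] : exists c c2 J1 J2,
    [/\ M = (c :: J1) ++ (c2 :: J2), size J1 = k - 2 - l & size J2 = k - 2 - l].
  move: (cat_take_drop (k - 1 - l) M) (size_take (k - 1 - l) M) (size_drop (k - 1 - l) M).
  case: (take _ _) (drop _ _) => [|c J1] [|c2 J2] /=; rewrite sM; try (case: ltnP; nlia).
  move=> <- s1 s2; exists c, c2, J1, J2; split=> //; move: s1; case: ltnP; nlia.
rewrite {}ME in sM uM PM MF.
have uA : uniq (a :: b :: I0).
  rewrite !cons_uniq uI0 inE negb_or aI0 !andbT; move: bI; rewrite !inE !negb_or => /and3P[_ ba bI0].
  by rewrite eq_sym ba bI0.
have M1 s : {subset s <= v1 :: v2 :: a :: b :: I0} -> uniq s -> uniq (((c :: J1) ++ (c2 :: J2)) ++ s).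
  move=> sub us; rewrite cat_uniq uM us andbT; rewrite has_sym; apply/hasPn => x /(allP MF).
  by rewrite inE; apply: contra => /sub.
have ua1 : uniq (v1 :: a :: b :: I0).
  rewrite cons_uniq uA andbT; move: v1I bI; rewrite !inE !negb_or => /andP[-> ->] /and3P[nb _ _].
  by rewrite eq_sym nb.
have [PJ1 PJ2] : all (mem P) (c :: J1) /\ all (mem P) (c2 :: J2).
  by apply/andP; rewrite -all_cat.
have [Pc PJ1'] : c \in P /\ all (mem P) J1 by apply/andP.
have [Pc2 PJ2'] : c2 \in P /\ all (mem P) J2 by apply/andP.
have ZP x : x \in P -> x \in Z by apply/subsetP.
have [[Za Zb] [Zc Zc2]] : (a \in Z /\ b \in Z) /\ (c \in Z /\ c2 \in Z) by split; split; apply: ZP.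
have [ZI0 [ZJ1 ZJ2]] : all (mem Z) I0 /\ all (mem Z) J1 /\ all (mem Z) J2 by split; [|split]; apply: allPZ.
have u1 := M1 (v1 :: a :: b :: I0) _ ua1.
have {}u1 : uniq (((c :: J1) ++ c2 :: J2) ++ [:: v1, a, b & I0]).
  apply: u1 => x; rewrite !inE => /or4P[] ->; rewrite ?orbT //.
have e1 : edge H (v1 :: (a :: I0) ++ c :: J1).
  apply: hv1 => //; last by rewrite /= sJ1; nlia.
  apply: (@perm_uniq_sub _ _ _ (b :: c2 :: J2)) u1; perm_count.
have [v12|v12] := eqVneq v1 v2.
  have e2 : edge H (v2 :: (b :: I0) ++ c2 :: J2).
    apply: hv2 => //; last by rewrite /= sJ2; nlia.
    rewrite -v12; apply: (@perm_uniq_sub _ _ _ (a :: c :: J1)) u1; perm_count.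
  apply: (@noY (v1 :: I0) (a :: c :: J1) (b :: c2 :: J2)).
  - rewrite -(perm_uniq (_ : perm_eq (((c :: J1) ++ c2 :: J2) ++ [:: v1, a, b & I0]) _)) //; perm_count.
  - by rewrite /= sI0.
  - by rewrite /= ?all_cat /= ?all_cat /= ?v1Z ?Za ?Zb ?Zc ?Zc2 ?ZI0 ?ZJ1 ?ZJ2.
  - by rewrite -(edge_perm _ (_ : perm_eq (v1 :: (a :: I0) ++ c :: J1) _)) //; perm_count.
  - by rewrite v12 -(edge_perm _ (_ : perm_eq (v2 :: (b :: I0) ++ c2 :: J2) _)) //; perm_count.
have [v2a|v2a] := eqVneq v2 a.
  have e2 : edge H (v2 :: (b :: I0) ++ c2 :: J2).
    apply: hv2 => //; last by rewrite /= sJ2; nlia.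
    rewrite v2a; apply: (@perm_uniq_sub _ _ _ (v1 :: c :: J1)) u1; perm_count.
  apply: (@noY (a :: I0) (v1 :: c :: J1) (b :: c2 :: J2)).
  - rewrite -(perm_uniq (_ : perm_eq (((c :: J1) ++ c2 :: J2) ++ [:: v1, a, b & I0]) _)) //; perm_count.
  - by rewrite /= sI0.
  - by rewrite /= ?all_cat /= ?all_cat /= ?v1Z ?Za ?Zb ?Zc ?Zc2 ?ZI0 ?ZJ1 ?ZJ2.
  - by rewrite -(edge_perm _ (_ : perm_eq (v1 :: (a :: I0) ++ c :: J1) _)) //; perm_count.
  - by rewrite -v2a -(edge_perm _ (_ : perm_eq (v2 :: (b :: I0) ++ c2 :: J2) _)) //; perm_count.
have ua2 : uniq (v2 :: v1 :: a :: b :: I0).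
  rewrite cons_uniq ua1 andbT; move: v2I; rewrite !inE !negb_or => /andP[-> ->].
  by rewrite v2a eq_sym v12.
have u2 : uniq (((c :: J1) ++ c2 :: J2) ++ [:: v2, v1, a, b & I0]).
  by apply: M1 => // x; rewrite !inE => /orP[->|/or4P[] ->]; rewrite ?orbT.
have e2 : edge H (v2 :: (b :: I0) ++ c :: J2).
  apply: hv2; last by rewrite /= Pc.
    apply: (@perm_uniq_sub _ _ _ (v1 :: a :: c2 :: J1)) u2; perm_count.
  by rewrite /= sJ2; nlia.
apply: (@noY (c :: I0) (v1 :: a :: J1) (v2 :: b :: J2)).
- apply: (@perm_uniq_sub _ _ _ [:: c2]) u2; perm_count.
- by rewrite /= sI0.
- by rewrite /= ?all_cat /= ?all_cat /= ?v1Z ?v2Z ?Za ?Zb ?Zc ?Zc2 ?ZI0 ?ZJ1 ?ZJ2.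
- by rewrite -(edge_perm _ (_ : perm_eq (v1 :: (a :: I0) ++ c :: J1) _)) //; perm_count.
- by rewrite -(edge_perm _ (_ : perm_eq (v2 :: (b :: I0) ++ c :: J2) _)) //; perm_count.
Qed.

End CoreStep.

(** Only a constant number of vertices is asked of [P], and the neighbours may lie anywhere in [Z],
    so a random sample of [Z] can serve as [P]. *)
Lemma core_Y P Z : P \subset Z -> k * k + 4 * k <= #|P| ->
  (forall s, uniq s -> all (mem P) s -> size s = k.-1 -> exists2 u, u \in Z & edge H (u :: s)) ->
  exists2 T, isY H l T & T \subset Z.
Proof.
move=> PZ cP nbP; have [T /andP[YT TZ]|noT] := pickP (fun T => isY H l T && (T \subset Z)).
  by exists T.
exfalso; apply: (core_false PZ cP nbP) => I J J' u sI /allP aZ e1 e2.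
have := noT (setof (I ++ J ++ J')); rewrite isY_seq //= => /negP; case.
by apply/subsetP => x; rewrite inE => /aZ.
Qed.

End Core.

(** * Copies of Y through dense vertices and by random sampling *)

Section DenseCores.
Variables (V : finType) (H : {set {set V}}) (k l : nat).
Hypotheses (hk : 3 <= k) (hl1 : 1 <= l) (hl2 : l <= k - 2).
Hypothesis unifH : forall e, e \in H -> #|e| = k.
Implicit Types (X T U F Z : {set V}) (s : seq V).
Let m := 2 * k - l.

(** The vertex [v] goes into the intersection: [l - 1] entries of a link tuple complete it to the
    shared part, and two continuations of length [k - l] give the two edges. *)
Lemma dense_Y (d : nat) (U F : {set V}) v :
  many d k.-1 (fun s => all (mem U) s && edge H (v :: s)) -> #|F| + 2 * k <= d ->
  exists T, [/\ isY H l T, v \in T & forall x, x \in T -> x != v -> (x \in U) && (x \notin F)].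
Proof.
move=> mU le_d.
have kE : k.-1 = (l - 1) + (k - l) by nlia.
rewrite kE in mU.
have [|||I [J [J' [[sI [sJ sJ']] [/andP[UIJ e1] /andP[UIJ' e2]] u avF _]]]] :=
   pair_pick (g := fun x => [set x]) (b := 1) (F := v |: F) _ _ mU.
- by move=> x; rewrite inE.
- by move=> x; rewrite cards1.
- by have := cardU_le [set v] F; rewrite cards1; nlia.
have uv : uniq ((v :: I) ++ J ++ J').
  by rewrite /= u andbT; apply/negP => /(allP avF); rewrite !inE eqxx.
exists (setof ((v :: I) ++ J ++ J')); split.
- by apply: isY_seq => //=; rewrite sI; nlia.
- by rewrite !inE eqxx.
- move=> x; rewrite inE in_cons => /orP[->//|xs] _.
  have /allP/(_ x xs) := avF; rewrite !inE negb_or => /andP[_ ->]; rewrite andbT.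
  move: UIJ UIJ'; rewrite !all_cat => /andP[UI UJ] /andP[_ UJ'].
  by move: xs; rewrite !mem_cat => /or3P[/(allP UI)|/(allP UJ)|/(allP UJ')].
Qed.

Lemma dense_Ys (d : nat) (U F : {set V}) (vs : seq V) : uniq vs -> {subset vs <= F} ->
  (forall v, v \in vs -> many d k.-1 (fun s => all (mem U) s && edge H (v :: s))) ->
  #|F| + size vs * m + 2 * k <= d ->
  exists X, [/\ tileable H l X, #|X| = size vs * m &
    forall x, x \in X -> (x \in vs) || (x \in U) && (x \notin F)].
Proof.
elim: vs F => [|v vs IH] F /=.
  by exists set0; rewrite tileable0 cards0; split=> // x; rewrite inE.
move=> /andP[nv uvs] sF mU le_d.
have [|T [YT vT Tx]] := dense_Y (F := F) (mU v (mem_head _ _)); first by nlia.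
have cT : #|T| = m by apply: isY_card YT => //; nlia.
have [|||X [TX cX Xx]] := IH (F :|: T) uvs.
- by move=> x xvs; rewrite inE sF // inE xvs orbT.
- by move=> x xvs; apply: mU; rewrite inE xvs orbT.
- by have := cardU_le F T; nlia.
have dTX : [disjoint T & X].
  rewrite disjoint_sym disjoint_subset; apply/subsetP => x /Xx; rewrite !inE.
  case/orP => [xvs|/andP[_]]; last by rewrite negb_or => /andP[].
  apply/negP => /Tx; rewrite (_ : x != v); last by apply: contraNneq nv => <-.
  by move=> /(_ isT) /andP[_]; rewrite sF // inE xvs orbT.
exists (T :|: X); split.
- exact: tileableU (tileable1 YT) TX.
- by rewrite cardsU (disjoint_setI0 dTX) cards0 cT cX; nlia.
- move=> x; rewrite !inE => /orP[/Tx|/Xx].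
    by case: eqVneq => //= _ /(_ isT) ->; rewrite orbT.
  by rewrite inE negb_or => /orP[-> //|/and3P[-> -> _]]; rewrite ?orbT.
Qed.

(** A random map from [p] points to [V] stays in [Z] with probability at least [2 ^ - p].
    Collisions, and sampled (k-1)-tuples without a neighbour in [Z], each have total probability at
    most a quarter of that, so some injective sample in [Z] meets the hypotheses of [core_Y]. *)
Lemma find_core (n : nat) Z (p : nat) : #|V| = n -> p = k * k + 4 * k -> 0 < n -> n <= 2 * #|Z| ->
  4 * 2 ^ p * (p * p) <= n ->
  4 * 2 ^ p * p ^ k.-1 * cnt k.-1 (fun s => [&& all (mem Z) s, uniq s &
     ~~ [exists u in Z, edge H (u :: s)]]) <= n ^ k.-1 ->
  exists2 T, isY H l T & T \subset Z.
Proof.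
move=> cardV pE n0 nZ np; set Bd := fun s => [&& _, _ & _]; set c := cnt _ _ => le_c.
have p0 : 0 < p by nlia.
have kp : k.-1 <= p by nnia.
pose A := [set rho : {ffun 'I_p -> V} | [forall i, rho i \in Z]].
have cA : #|A| = #|Z| ^ p.
  rewrite -[in RHS](card_ord p) -card_ffun_on; apply: eq_card => rho; rewrite inE.
  exact/forallP/ffun_onP.
pose B (x : ('I_p * 'I_p) + (k.-1).-tuple 'I_p) : {set {ffun 'I_p -> V}} := match x with
  | inl (i, j) => if i != j then [set rho : {ffun 'I_p -> V} | rho i == rho j] else set0
  | inr js => if uniq js then [set rho : {ffun 'I_p -> V} | Bd [seq rho j | j <- js]] else set0
  end.
have [/existsP[rho /andP[rhoZ /forallP rhoB]]|bad] :=
    boolP [exists rho, (rho \in A) && [forall x, rho \notin B x]].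
  have inj_rho : injective rho.
    move=> i j eq_ij; apply/eqP/negPn/negP => nij.
    by have := rhoB (inl (i, j)); rewrite /= nij inE eq_ij eqxx.
  have {}rhoZ i : rho i \in Z by move: rhoZ; rewrite inE => /forallP.
  apply: (@core_Y V H k l hk hl1 hl2 unifH [set rho i | i : 'I_p]).
  - by apply/subsetP => v /imsetP[i _ ->].
  - by rewrite card_imset // card_ord pE.
  move=> s us /allP sP ss.
  (* A left inverse on the image of [rho]; the default value is never reached there. *)
  pose g v := odflt (Ordinal p0) [pick i | rho i == v].
  have gK v : v \in s -> rho (g v) = v.
    move=> /sP /= /imsetP[i _ ->]; rewrite /g; case: pickP => [j /eqP //|/(_ i)].
    by rewrite eqxx.
  have sg : size (map g s) == k.-1 by rewrite size_map ss.
  have sE : [seq rho j | j <- map g s] = s.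
    by rewrite -map_comp -[RHS]map_id; apply/eq_in_map => v vs; rewrite /= gK.
  have ug : uniq (map g s) by apply: (@map_uniq _ _ rho); rewrite sE.
  have := rhoB (inr (Tuple sg)); rewrite /= ug inE sE /Bd us.
  have -> : all (mem Z) s by rewrite -sE; apply/allP => v /mapP[j _ ->]; apply: rhoZ.
  by rewrite negbK => /exists_inP[u uZ eu]; exists u.
have le_A : #|A| <= \sum_x #|B x|.
  apply: card_union_bound => rho rhoA; apply/existsP; move: bad; rewrite negb_exists => /forallP /(_ rho).
  rewrite rhoA negb_forall => /existsP[x]; rewrite negbK => xB; by apply/existsP; exists x.
have {le_A} : #|Z| ^ p <= p * p * n ^ p.-1 + p ^ k.-1 * (c * n ^ (p - k.-1)).
  rewrite -cA; apply: leq_trans le_A _; rewrite big_sumType /=; apply: leq_add.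
    apply: (@leq_trans (\sum_(x : 'I_p * 'I_p) n ^ p.-1)).
      apply: leq_sum => [[i j] _] /=; case: eqP => [_|/eqP nij]; first by rewrite cards0.
      have u2 : uniq [:: i; j] by rewrite /= inE nij.
      have := @proj_cnt p V V [:: i; j] (fun _ => id) (fun s => if s is [:: x; y] then x == y else false) u2.
      move=> /(_ (fun _ => @inj_id V)) /=; rewrite cardV => /leq_trans; apply.
      have -> : cnt 2 (fun s => if s is [:: x; y] then x == y else false) = n.
        rewrite cntS -cardV -sum1_card; apply: eq_bigr => v _; rewrite cntS (bigD1 v) //= big1 => [|w wv].
          by rewrite cnt0 eqxx.
        by rewrite cnt0 eq_sym (negbTE wv).
      rewrite -expnS leq_pexp2l //; by have := ltn_ord i; have := ltn_ord j; move: nij; rewrite -val_eqE /=; nlia.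
    by rewrite sum_nat_const card_prod card_ord.
  apply: (@leq_trans (\sum_(js : k.-1.-tuple 'I_p) c * n ^ (p - k.-1))); last first.
    by rewrite sum_nat_const card_tuple card_ord.
  apply: leq_sum => js _; case: ifP => ujs; last by rewrite cards0.
  have := @proj_cnt p V V js (fun _ => id) Bd ujs (fun _ => @inj_id V).
  by rewrite size_tuple cardV.
have le_n : n ^ p <= 2 ^ p * #|Z| ^ p by rewrite -expnMn leq_exp2r.
have np0 : 0 < n ^ p by rewrite expn_gt0 n0.
have e1 : 4 * 2 ^ p * (p * p * n ^ p.-1) <= n ^ p.
  have -> : n ^ p = n * n ^ p.-1 by rewrite -expnS prednK.
  by rewrite mulnA leq_mul2r np orbT.
have e2 : 4 * 2 ^ p * (p ^ k.-1 * (c * n ^ (p - k.-1))) <= n ^ p.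
  have -> : n ^ p = n ^ k.-1 * n ^ (p - k.-1) by rewrite -expnD subnKC.
  by rewrite !mulnA leq_mul2r le_c orbT.
move: e1 e2 le_n np0; move: (p * p * _) (p ^ _ * _) (#|Z| ^ p) (n ^ p) (2 ^ p) => a b z N w e1 e2 le_n N0 le_z.
exfalso; have : w * z <= w * (a + b) by rewrite leq_mul2l le_z orbT.
by nlia.
Qed.

End DenseCores.

(** * Almost perfect tilings *)

Section AlmostTiling.
Variables (V : finType) (H : {set {set V}}) (k l n t : nat).
Hypotheses (hk : 3 <= k) (hl1 : 1 <= l) (hl2 : l <= k - 2).
Hypothesis unifH : forall e, e \in H -> #|e| = k.
Let m := 2 * k - l.
Hypotheses (cardV : #|V| = n) (nE : n = t * m) (n0 : 0 < n).
Hypothesis codegH : forall s, uniq s -> size s = k.-1 -> t <= #|[set v | edge H (v :: s)]|.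
Implicit Types (X T U F Z : {set V}) (P Q : {set {set V}}) (s : seq V).

Section MaximalTiling.
Variables (Abs : {set V}) (P : {set {set V}}).
Hypotheses (trivP : trivIset P) (YP : forall T, T \in P -> isY H l T).
Hypothesis dPA : [disjoint cover P & Abs].
Hypothesis maxP : forall Q, trivIset Q -> (forall T, T \in Q -> isY H l T) ->
  [disjoint cover Q & Abs] -> #|Q| <= #|P|.
Let lk : l < k. Proof. lia. Qed.

(** Replacing the tiles of [T1] by a tiling of [X] again gives a tiling disjoint from [Abs]. Three
    such exchanges drive this section: no tile for one ([dense_in_cover]), one for two
    ([one_dense]), and [m] for [m + 1] ([no_crossing_Y]). *)
Lemma tiling_no_gain (T1 : {set {set V}}) X : T1 \subset P -> tileable H l X ->
  [disjoint X & Abs] -> [disjoint X & cover (P :\: T1)] -> #|X| <= #|T1| * m.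
Proof.
move=> sT1 /tileableP[Q [tQ cQ YQ]] dXA dXP.
have tD : trivIset (P :\: T1) by apply: trivIsetS trivP; apply: subsetDl.
have YD T : T \in P :\: T1 -> isY H l T by rewrite inE => /andP[_ /YP].
have dQ A B : A \in P :\: T1 -> B \in Q -> [disjoint A & B].
  move=> AP BQ; rewrite disjoint_sym; apply: disjointWl (_ : B \subset X) _.
    by rewrite -cQ; apply: bigcup_max BQ _.
  by apply: disjointWr dXP; apply: bigcup_max AP _.
have tU : trivIset ((P :\: T1) :|: Q).
  apply/trivIsetP => A B; rewrite ![_ \in _ :|: _]inE => /orP[AP|AQ] /orP[BP|BQ] nAB.
  - by move/trivIsetP: tD; apply.
  - exact: dQ.
  - by rewrite disjoint_sym dQ.
  - by move/trivIsetP: tQ; apply.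
have YU T : T \in (P :\: T1) :|: Q -> isY H l T by rewrite in_setU => /orP[/YD|/YQ].
have cU : cover ((P :\: T1) :|: Q) = cover (P :\: T1) :|: X.
  by rewrite -cQ /cover bigcup_setU.
have le_U : #|(P :\: T1) :|: Q| <= #|P|.
  apply: maxP => //; rewrite cU disjoint_setU dXA andbT; apply: disjointWl dPA.
  by apply/bigcupsP => A; rewrite inE => /andP[_ AP]; apply: bigcup_max AP _.
have := card_tiling lk unifH tU YU; rewrite cU cardsU setIC (disjoint_setI0 dXP) cards0 subn0.
rewrite (card_tiling lk unifH tD YD) cardsD (setIidPr sT1) -/m.
have := subset_leq_card sT1.
move: le_U; move: #|(P :\: T1) :|: Q| #|P| #|T1| #|X| => u p t1 x.
move=> le1 le2 eq.
have : u * m <= p * m by rewrite leq_mul2r le1 orbT.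
by rewrite mulnBl in eq; nlia.
Qed.

Variables (U0 : {set V}) (C K d : nat).
Hypotheses (dU0 : [disjoint U0 & cover P :|: Abs]) (cU0 : #|U0| = C).
Hypotheses (K0 : 0 < K) (d0 : 0 < d) (Cd : 2 ^ k.-1 * K * d <= C) (CK : K * (k * k) <= C).
Hypothesis d_large : (m + 1) * (m + 1) + 2 * k + m <= d.

Definition dense_vertices : {set V} :=
  [set v | C ^ k.-1 <= K * cnt k.-1 (fun s => all (mem U0) s && edge H (v :: s))].
Let D := dense_vertices.
Let A0 := D :&: cover P.

Lemma dense_verticesP v : v \in D -> many d k.-1 (fun s => all (mem U0) s && edge H (v :: s)).
Proof. by rewrite inE -cU0 => dv; apply: (dense_many (K := K)) => //; rewrite cU0. Qed.

Lemma U0_notin x : x \in U0 -> (x \notin cover P) && (x \notin Abs).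
Proof.
move=> xU; rewrite -negb_or -in_setU; move: dU0; rewrite disjoint_subset => /subsetP /(_ x xU).
by rewrite inE.
Qed.

Lemma dense_in_cover v : v \in D -> v \notin Abs -> v \in cover P.
Proof.
move=> vD vA; apply: contraT => vP.
have [||||X [TX cX Xx]] := @dense_Ys V H k l hk hl1 hl2 unifH d U0 [set v] [:: v].
- by [].
- by move=> x; rewrite !inE.
- by move=> x; rewrite inE => /eqP ->; apply: dense_verticesP.
- by rewrite cards1 /= -/m; nnia.
have XP x : x \in X -> (x \notin cover P) && (x \notin Abs).
  by move=> /Xx /orP[|/andP[/U0_notin //]]; rewrite inE => /eqP ->; rewrite vP vA.
have dXA : [disjoint X & Abs].
  by rewrite disjoint_subset; apply/subsetP => x /XP /andP[_]; rewrite inE.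
have dXP : [disjoint X & cover (P :\: set0)].
  by rewrite setD0 disjoint_subset; apply/subsetP => x /XP /andP[]; rewrite inE.
have := tiling_no_gain (sub0set _) TX dXA dXP.
by rewrite cards0 mul0n cX mul1n /m; nlia.
Qed.

Lemma cover_cover_setD (T1 : {set {set V}}) x :
  T1 \subset P -> x \in cover T1 -> x \notin cover (P :\: T1).
Proof.
move=> sT1 /bigcupP[A AT1 xA]; apply/negP => /bigcupP[B]; rewrite inE => /andP[BT1 BP] xB.
have AB : A != B by apply: contraNneq BT1 => <-.
move/trivIsetP: trivP => /(_ A B (subsetP sT1 _ AT1) BP AB).
by rewrite -setI_eq0 => /eqP/setP /(_ x); rewrite !inE xA xB.
Qed.

Lemma one_dense T v w : T \in P -> v \in T -> w \in T -> v \in D -> w \in D -> v = w.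
Proof.
move=> TP vT wT vD wD; apply/eqP; apply: contraT => nvw.
have [||||X [TX cX Xx]] := @dense_Ys V H k l hk hl1 hl2 unifH d U0 [set v; w] [:: v; w].
- by rewrite /= inE nvw.
- by move=> x; rewrite !inE.
- by move=> x; rewrite !inE => /orP[] /eqP ->; apply: dense_verticesP.
- by rewrite cards2 nvw /= -/m; nnia.
have XP x : x \in X -> (x \in T) || (x \notin cover P) && (x \notin Abs).
  move=> /Xx /orP[|/andP[/U0_notin -> _]]; last by rewrite orbT.
  by rewrite !inE => /orP[] /eqP ->; rewrite ?vT ?wT.
have sT : [set T] \subset P by rewrite sub1set.
have m0 : 0 < m by rewrite /m; nlia.
have sTP : T \subset cover P by apply: bigcup_max TP _.
have dXA : [disjoint X & Abs].
  rewrite disjoint_subset; apply/subsetP => x /XP /orP[xT|/andP[_]]; last by rewrite inE.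
  by move: dPA; rewrite disjoint_subset => /subsetP; apply; apply: (subsetP sTP).
have dXP : [disjoint X & cover (P :\: [set T])].
  rewrite disjoint_subset; apply/subsetP => x /XP /orP[xT|/andP[xP _]]; rewrite inE.
    by apply: cover_cover_setD => //; rewrite /cover big_set1.
  apply: contra xP => /bigcupP[B]; rewrite inE => /andP[_ BP] xB; apply/bigcupP; by exists B.
have := tiling_no_gain sT TX dXA dXP.
by rewrite cards1 mul1n cX /= -/m; nlia.
Qed.

Lemma pblock_inj_dense : {in A0 &, injective (pblock P)}.
Proof.
move=> v w /setIP[vD vP] /setIP[wD wP] eq_vw.
apply: (one_dense (T := pblock P v)); rewrite ?pblock_mem ?mem_pblock //.
by rewrite eq_vw mem_pblock.
Qed.

Lemma card_dense_le : #|A0| <= t.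
Proof.
have m0 : 0 < m by rewrite /m; nlia.
rewrite -(card_in_imset pblock_inj_dense).
apply: (@leq_trans #|P|).
  apply/subset_leq_card/subsetP => T /imsetP[v]; rewrite inE => /andP[_ vP] ->; exact: pblock_mem.
rewrite -(leq_pmul2r m0) -nE -cardV -(card_tiling lk unifH trivP YP); exact: max_card.
Qed.

(** Double counting of (k-1)-tuples in [U0] with a neighbour: an injective tuple has at least [t],
    while a vertex outside [A0] and [Abs] carries less than a fraction [1 / K] of all tuples. The
    error [3 * n] consists of one [n] for those vertices, one for [Abs] and one for tuples with
    repetitions. *)
Lemma card_dense_ge : K * #|Abs| <= n -> K * t <= K * #|A0| + 3 * n.
Proof.
move=> KA; set w := C ^ k.-1.
have C0 : 0 < C by apply: leq_trans CK; rewrite !muln_gt0 K0; nlia.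
have w0 : 0 < w by rewrite expn_gt0 C0.
pose c v := cnt k.-1 (fun s => all (mem U0) s && edge H (v :: s)).
have sumc : \sum_v c v = \sum_(x : k.-1.-tuple V | all (mem U0) x) #|[set v | edge H (v :: x)]|.
  rewrite /c; under eq_bigr => v _ do rewrite cntE.
  rewrite (exchange_big_dep (fun x : k.-1.-tuple V => all (mem U0) x)) /=; last by move=> v x _ /andP[].
  apply: eq_bigr => x xU; rewrite -sum1_card; apply: eq_bigl => v; by rewrite inE xU.
have ge_sum : t * cnt k.-1 (fun s => all (mem U0) s && uniq s) <= \sum_v c v.
  rewrite sumc cntE big_distrr /= [X in _ <= X]big_mkcond [X in X <= _]big_mkcond /=.
  apply: leq_sum => x _; case: (all _ _) => //=; case: ifP => // ux.
  by rewrite muln1; apply: codegH; rewrite ?size_tuple.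
have le_sum : K * \sum_v c v <= (K * #|A0| + K * #|Abs| + n) * w.
  rewrite big_distrr /=.
  apply: (@leq_trans (\sum_v ((v \in A0) * (K * w) + (v \in Abs) * (K * w) + w))).
    apply: leq_sum => v _.
    have cw : c v <= w by rewrite /w -cU0; apply: cnt_all_le.
    case: (boolP (v \in A0)) => vA0; first by have : K * c v <= K * w by [rewrite leq_mul2l cw orbT]; nlia.
    case: (boolP (v \in Abs)) => vA; first by have : K * c v <= K * w by [rewrite leq_mul2l cw orbT]; nlia.
    rewrite !mul0n !add0n ltnW // ltnNge; apply/negP => vD.
    have vD' : v \in D by rewrite inE.
    by move: vA0; rewrite inE vD' dense_in_cover.
  rewrite !big_split /= -!big_distrl /= sum_nat_const cardV.
  have sumE (A : {set V}) : \sum_v (v \in A : nat) = #|A|.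
    by rewrite -sum1_card [RHS]big_mkcond; apply: eq_bigr => v _; case: ifP.
  by rewrite !sumE; nlia.
set u := cnt _ _ in ge_sum.
have le_w : C * w <= C * u + k.-1 * k.-1 * w.
  have all_split : w <= u + cnt k.-1 (fun s => all (mem U0) s && ~~ uniq (map id s)).
    rewrite /w -cU0 -cnt_all; apply: cntU => s _ /= ->; rewrite map_id /=; by case: uniq.
  have := @cnt_nonuniq V V id 1 U0 k.-1; rewrite cU0 muln1 => /(_ _)/= h.
  have {}h : C * cnt k.-1 (fun s => all (mem U0) s && ~~ uniq (map id s)) <= k.-1 * k.-1 * w.
    by apply: h => v; rewrite (_ : [set _ | _] = [set v]) ?cards1 //; apply/setP => y; rewrite !inE.
  move: all_split h; set z := cnt _ _ => all_split h.
  have : C * w <= C * (u + z) by rewrite leq_mul2l all_split orbT.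
  by nlia.
have tn : t <= n by rewrite nE; have : 0 < m by [rewrite /m; nlia]; nnia.
have kk : K * (k.-1 * k.-1) * t <= C * n.
  apply: leq_mul => //; apply: leq_trans CK; rewrite leq_mul2l; apply/orP; right.
  by apply: leq_mul; apply: leq_pred.
suff : C * w * (K * t) <= C * w * (K * #|A0| + 3 * n).
  by rewrite leq_pmul2l // muln_gt0 C0 w0.
have h1 : K * t * (C * w) <= K * t * (C * u + k.-1 * k.-1 * w) by rewrite leq_mul2l le_w orbT.
have h2 : C * (K * (t * u)) <= C * ((K * #|A0| + K * #|Abs| + n) * w).
  rewrite leq_mul2l; apply/orP; right; apply: leq_trans le_sum.
  by rewrite leq_mul2l ge_sum orbT.
have h3 : w * (K * (k.-1 * k.-1) * t) <= w * (C * n) by rewrite leq_mul2l kk orbT.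
have h4 : C * w * (K * #|Abs|) <= C * w * n by rewrite leq_mul2l KA orbT.
move: h1 h2 h3 h4; move: (#|A0|) (#|Abs|) => a b; clear.
move: (k.-1 * k.-1) => kk; nlia.
Qed.

Let P1 := [set pblock P v | v in A0].

Lemma sub_P1 : P1 \subset P.
Proof. by apply/subsetP => T /imsetP[v /setIP[_ vP] ->]; apply: pblock_mem. Qed.

Lemma pblock_P1 w : w \in cover P1 -> pblock P w \in P1.
Proof.
case/bigcupP => T TP1 wT; rewrite (def_pblock trivP _ wT) //; exact: (subsetP sub_P1).
Qed.

Lemma sub_cover_P1 : cover P1 \subset cover P.
Proof.
by apply/subsetP => x /bigcupP[T TP1 xT]; apply/bigcupP; exists T => //; apply: (subsetP sub_P1).
Qed.

(** Each tile met by [L] has a dense vertex, which is not in [L]; it starts a copy of Y with all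
    other vertices in [U0]. These [m] copies and [L] itself replace the [m] tiles. *)
Lemma no_crossing_Y (L : seq V) : isY H l (setof L) -> uniq [seq pblock P x | x <- L] ->
  all (mem (cover P1 :\: A0)) L -> False.
Proof.
move=> YL uL /allP LP1.
have LP x : x \in L -> (x \in cover P1) && (x \notin A0).
  by move/LP1 => /=; rewrite in_setD andbC.
have sL : size L = m by rewrite -card_setof ?(map_uniq uL) ?(isY_card lk unifH YL).
have ex (w : V) : exists a, w \in cover P1 -> (a \in A0) && (pblock P a == pblock P w).
  case: (boolP (w \in cover P1)) => [/pblock_P1 /imsetP[a aA ->]|]; last by exists w.
  by exists a; rewrite aA eqxx.
have [a aP] := fin_all_exists ex.
pose vs := map a L.
have vsA x : x \in vs -> x \in A0.
  by case/mapP => w /LP /andP[/aP /andP[? _] _] ->.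
have uvs : uniq vs.
  apply: (@map_uniq _ _ (pblock P)); rewrite -map_comp.
  rewrite (_ : map _ L = [seq pblock P x | x <- L]) //.
  by apply/eq_in_map => w /LP /andP[/aP /andP[_ /eqP]].
have svs : size vs = m by rewrite size_map.
have [||||X [TX cX Xx]] := @dense_Ys V H k l hk hl1 hl2 unifH d U0 (setof vs) vs.
- by [].
- by move=> x; rewrite inE.
- by move=> x /vsA /setIP[xD _]; apply: dense_verticesP.
- by have := card_set_of_seq vs; rewrite -/(setof vs) svs -/m; nlia.
have XP x : x \in X -> (x \in A0) || (x \notin cover P) && (x \notin Abs).
  by move=> /Xx /orP[/vsA -> //|/andP[/U0_notin -> _]]; rewrite orbT.
have dLX : [disjoint setof L & X].
  rewrite disjoint_subset; apply/subsetP => x; rewrite inE => /LP /andP[xP1 xA0].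
  by rewrite inE; apply/negP => /XP; rewrite (negbTE xA0) (subsetP sub_cover_P1 _ xP1).
pose T1 := setof [seq pblock P x | x <- L].
have sT1 : T1 \subset P.
  apply/subsetP => T; rewrite inE => /mapP[w /LP /andP[/pblock_P1 wP _] ->].
  exact: (subsetP sub_P1).
have LT1 x : x \in L -> x \in cover T1.
  move=> xL; apply/bigcupP; exists (pblock P x); first by rewrite inE map_f.
  by rewrite mem_pblock; apply: (subsetP sub_cover_P1); case/andP: (LP x xL).
have vsT1 x : x \in vs -> x \in cover T1.
  move=> /[dup] /vsA /setIP[_ xP] /mapP[w wL xE]; apply/bigcupP; exists (pblock P w).
    by rewrite inE map_f.
  have /andP[/aP /andP[_ /eqP <-] _] := LP w wL.
  by rewrite -xE mem_pblock.
have T1P : cover T1 \subset cover P.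
  by apply/subsetP => x /bigcupP[T TT1 xT]; apply/bigcupP; exists T => //; apply: (subsetP sT1).
have Z x : x \in setof L :|: X -> (x \in cover T1) || (x \in U0).
  rewrite in_setU inE => /orP[/LT1 -> //|/Xx /orP[/vsT1 -> //|/andP[-> _]]]; by rewrite orbT.
have dXA : [disjoint setof L :|: X & Abs].
  rewrite disjoint_subset; apply/subsetP => x /Z /orP[xT|/U0_notin /andP[_]]; last by rewrite inE.
  by move: dPA; rewrite disjoint_subset => /subsetP; apply; apply: (subsetP T1P).
have dXP : [disjoint setof L :|: X & cover (P :\: T1)].
  rewrite disjoint_subset; apply/subsetP => x /Z /orP[xT|/U0_notin /andP[xP _]]; rewrite inE.
    exact: cover_cover_setD.
  apply: contra xP => /bigcupP[B]; rewrite inE => /andP[_ BP] xB; apply/bigcupP; by exists B.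
have := tiling_no_gain sT1 (tileableU dLX (tileable1 YL) TX) dXA dXP.
have := card_set_of_seq [seq pblock P x | x <- L]; rewrite -/(setof _) -/T1 size_map sL.
rewrite cardsU (disjoint_setI0 dLX) cards0 (isY_card lk unifH YL) cX svs -/m.
have m0 : 0 < m by rewrite /m; nlia.
move: #|T1| => x xm le_x; have : x * m <= m * m by rewrite leq_mul2r xm orbT.
by nlia.
Qed.

Lemma card_pblock_P x : x \in cover P -> #|pblock P x| = m.
Proof. by move=> /pblock_mem /YP; apply: isY_card. Qed.

(** An edge avoiding [A0] leaves the tiles of [P1], or has two vertices in one of them, or is
    crossing. The first two kinds are few by counting; if crossing edges were dense, [pair_pick]
    with whole tiles forbidden would build a copy excluded by [no_crossing_Y]. Each kind gets a
    third of the bound, hence the factor 3 next to [K2]. *)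
Lemma sparse_outside (K2 d1 : nat) : 0 < K2 -> K * #|Abs| <= n ->
  2 ^ k * (3 * K2) * d1 <= n -> (m + 1) * k <= d1 -> 9 * m * k * K2 <= K ->
  3 * K2 * (k * k * m) <= n ->
  K2 * cnt k (fun s => all (fun x => x \notin A0) s && edge H s) <= n ^ k.
Proof.
move=> K20 KA nd1 md1 K2K K2n.
have m0 : 0 < m by rewrite /m; nlia.
have d10 : 0 < d1 by nnia.
(* Outside the tiles of [P1] a vertex is its own block, so that all fibres of [f] have at most [m]
   elements. *)
pose f w := if w \in cover P1 then pblock P w else [set w].
have ff w : w \in f w.
  rewrite /f; case: ifP => [wP|_]; last by rewrite inE.
  by rewrite mem_pblock (subsetP sub_cover_P1).
have fm w : #|f w| <= m.
  rewrite /f; case: ifP => [wP|_]; last by rewrite cards1.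
  by rewrite card_pblock_P // (subsetP sub_cover_P1).
pose G s := all (mem (cover P1 :\: A0)) s && (uniq (map f s) && edge H s).
have notG : ~ many d1 k G.
  have kE : l + (k - l) = k by nlia.
  rewrite -[X in many _ X]kE => mG.
  have [|I [J [J' [[sI [sJ sJ']] [/and3P[PIJ uIJ e1] /and3P[PIJ' uIJ' e2]] u _ avf]]]] :=
    pair_pick (F := set0) ff fm mG; first by rewrite cards0 kE; nlia.
  have PL : all (mem (cover P1 :\: A0)) (I ++ J ++ J').
    by move: PIJ PIJ'; rewrite !all_cat => /andP[-> ->] /andP[_ ->].
  apply: (no_crossing_Y _ _ PL); first exact: isY_seq.
  have -> : [seq pblock P x | x <- I ++ J ++ J'] = map f (I ++ J ++ J').
    by apply/eq_in_map => x /(allP PL); rewrite /= in_setD /f => /andP[_ ->].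
  rewrite catA map_cat cat_uniq uIJ /=; apply/andP; split; last first.
    by move: uIJ'; rewrite map_cat cat_uniq => /and3P[].
  apply/hasPn => T /mapP[y yJ' ->]; apply/negP => /= /mapP[x xIJ eq_f].
  by have := avf x y xIJ yJ'; rewrite -eq_f ff.
have cG : 3 * K2 * cnt k G < n ^ k.
  rewrite ltnNge; apply/negP => dens; apply: notG.
  apply: many_mono (_ : many d1 k (fun s => all (mem [set: V]) s && G s)) => [s _ /andP[]//|].
  apply: (dense_many (K := 3 * K2)); rewrite ?cardsT ?cardV ?muln_gt0 //.
  by rewrite (eq_cnt (Q := G)) // => s _; rewrite (_ : all _ _) //; apply/allP => x _; rewrite /= inE.
pose E := ~: cover P1.
(* [P1] has one tile for each vertex of [A0], so the lower bound on [#|A0|] leaves few vertices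
   outside its tiles. *)
have cE : K * #|E| <= 3 * m * n.
  have := cardCE cardV (cover P1); rewrite -/E.
  have tP1 : trivIset P1 by apply: trivIsetS sub_P1 trivP.
  have YP1 T : T \in P1 -> isY H l T by move/(subsetP sub_P1)/YP.
  rewrite (card_tiling lk unifH tP1 YP1) (card_in_imset pblock_inj_dense) -/m => cE.
  have := card_dense_ge KA; move: #|A0| #|E| cE => a e cE.
  rewrite nE in cE * => le_t.
  have : m * (K * t) <= m * (K * a + 3 * (t * m)) by rewrite leq_mul2l le_t orbT.
  have : K * (a * m + e) = K * (t * m) by rewrite cE.
  by rewrite mulnDr; nlia.
have split3 : cnt k (fun s => all (fun x => x \notin A0) s && edge H s) <=
    cnt k (fun s => all (mem [set: V]) s && has (mem E) s) +
    (cnt k (fun s => all (mem [set: V]) s && ~~ uniq (map f s)) + cnt k G).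
  pose G' s := (all (mem [set: V]) s && ~~ uniq (map f s)) || G s.
  apply: leq_trans (_ : cnt k (fun s => all (mem [set: V]) s && has (mem E) s) + cnt k G' <= _); last first.
    by rewrite leq_add2l; apply: cntU => s _.
  apply: cntU => s _ /andP[/allP sA es].
  have sT : all (mem [set: V]) s by apply/allP => x _; rewrite /= inE.
  rewrite sT.
  rewrite /G' /G es andbT /=; have [//|/hasPn nE'] := boolP (has _ s).
  have -> : all (mem (cover P1 :\: A0)) s.
    apply/allP => x xs; rewrite /= in_setD sA //.
    by have := nE' x xs; rewrite /= inE negbK.
  by rewrite sT; case: uniq.
have h1 := @cnt_hit V setT E k; rewrite cardsT cardV in h1.
have h2 := @cnt_nonuniq V _ f m setT k; rewrite cardsT cardV in h2.
have {}h2 : n * cnt k (fun s => all (mem [set: V]) s && ~~ uniq (map f s)) <= k * k * m * n ^ k.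
  apply: h2 => v; apply: leq_trans (fm v).
  by apply/subset_leq_card/subsetP => w; rewrite inE => /eqP <-.
rewrite -(leq_pmul2l n0); move: split3 h1 h2 cG.
move: (cnt _ _) (cnt _ _) (cnt _ _) (cnt _ _) (n ^ k) => g b a z N le_z ha hb hg.
have KE : 3 * (K2 * k) * #|E| <= n.
  have m30 : 0 < 3 * m by rewrite muln_gt0 m0.
  rewrite -(leq_pmul2l m30); apply: leq_trans cE.
  by have := leq_mul K2K (leqnn #|E|); nlia.
have r1 : 3 * K2 * (n * a) <= n * N.
  apply: (@leq_trans (3 * K2 * (k * #|E| * N))); first by rewrite leq_mul2l ha orbT.
  by have := leq_mul KE (leqnn N); nlia.
have r2 : 3 * K2 * (n * b) <= n * N.
  apply: (@leq_trans (3 * K2 * (k * k * m * N))); first by rewrite leq_mul2l hb orbT.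
  by have := leq_mul K2n (leqnn N); nlia.
have r3 : n * (3 * K2 * g) <= n * N by rewrite leq_mul2l ltnW ?orbT.
have r4 : 3 * K2 * n * z <= 3 * K2 * n * (a + (b + g)) by rewrite leq_mul2l le_z orbT.
by nlia.
Qed.

End MaximalTiling.
Lemma almost_tiling (Abs : {set V}) (C K K2 d d1 : nat) :
  0 < K2 -> 2 ^ k.-1 * K * d <= C -> K * (k * k) <= C -> (m + 1) * (m + 1) + 2 * k + m <= d ->
  2 ^ k * (3 * K2) * d1 <= n -> (m + 1) * k <= d1 -> 9 * m * k * K2 <= K ->
  3 * K2 * (k * k * m) <= n -> K * #|Abs| <= n ->
  (exists P, [/\ trivIset P, forall T, T \in P -> isY H l T, [disjoint cover P & Abs] &
     #|~: (cover P :|: Abs)| < C]) \/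
  (exists A0 : {set V}, [/\ #|A0| <= t, K * t <= K * #|A0| + 3 * n &
     K2 * cnt k (fun s => all (fun x => x \notin A0) s && edge H s) <= n ^ k]).
Proof.
move=> K20 Cd CK d_large nd1 md1 K2K K2n KA.
pose tiling P := [&& trivIset P, [forall T in P, isY H l T] & [disjoint cover P & Abs]].
have t0 : tiling set0.
  rewrite /tiling /cover big_set0; apply/and3P; split.
  - by apply/trivIsetP => A B; rewrite inE.
  - by apply/'forall_implyP => T; rewrite inE.
  - by rewrite -setI_eq0 set0I.
case: (arg_maxnP (fun P => #|P|) t0) => P /and3P[tP /'forall_implyP YP dP] maxP.
have {}maxP Q : trivIset Q -> (forall T, T \in Q -> isY H l T) -> [disjoint cover Q & Abs] -> #|Q| <= #|P|.
  by move=> tQ YQ dQ; apply: maxP; apply/and3P; split=> //; apply/'forall_implyP.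
have [small|large] := ltnP #|~: (cover P :|: Abs)| C; [by left; exists P | right].
have K0 : 0 < K by apply: leq_trans K2K; rewrite !muln_gt0 K20 /m; nlia.
have d0 : 0 < d by nnia.
(* Exactly [C] of the uncovered vertices are kept: all densities towards them are then relative to a
   constant, however large the leftover is. *)
have [|s [ss us sU _]] := @fresh V C (~: (cover P :|: Abs)) set0; first by rewrite cards0.
have cU0 : #|setof s| = C by rewrite card_setof.
have dU0 : [disjoint setof s & cover P :|: Abs].
  rewrite disjoint_subset; apply/subsetP => x; rewrite inE => /(allP sU) /=.
  by rewrite !inE.
exists (dense_vertices (setof s) C K :&: cover P); split.
- exact: (card_dense_le tP YP dP maxP dU0 cU0 K0 d0 Cd CK d_large).
- exact: (card_dense_ge tP YP dP maxP dU0 cU0 K0 d0 Cd CK d_large).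
- exact: (sparse_outside tP YP dP maxP dU0 cU0 K0 d0 Cd CK d_large K20 KA nd1).
Qed.

End AlmostTiling.

(** * Nearly complete instances *)

Section NearComplete.
Variables (V : finType) (H : {set {set V}}) (k l m1 n t c K : nat) (A B : {set V}).
Hypotheses (hk : 3 <= k) (hl1 : 1 <= l) (hl2 : l <= k - 2) (mE : m1.+1 = 2 * k - l).
Hypothesis unifH : forall e, e \in H -> #|e| = k.
Hypotheses (dAB : [disjoint A & B]) (cA : #|A| = t) (cB : #|B| = m1 * t).
Let m := m1.+1.
Hypotheses (c0 : 0 < c) (nt : n <= c * t) (t_large : 2 * (m * m) < t) (K_large : 4 * m * c ^ k.-1 <= K).

(** Only injective tuples count as missing, since a tuple with a repeated entry cannot give an edge
    in any k-graph. *)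
Definition bad_link_A a s := [&& all (mem B) s, uniq s & ~~ edge H (a :: s)].
(** The tuple starts with a vertex of [A], because the tiles to be built use edges with exactly one
    vertex there. *)
Definition bad_link_B b s :=
  if s is a :: y then [&& a \in A, all (mem B) y, uniq (b :: y) & ~~ edge H (b :: a :: y)]
  else false.

Hypothesis goodA : forall a, a \in A -> K * cnt k.-1 (bad_link_A a) <= n ^ k.-1.
Hypothesis goodB : forall b, b \in B -> K * cnt k.-1 (bad_link_B b) <= n ^ k.-1.

(** Places in a row of [m] vertices: [posI] is the shared part, [posJ] and [posJ'] are the private
    parts. Place 0 will hold the only vertex of [A]; it is shared because [1 <= l], so both edges
    contain it. *)
Definition posI : seq 'I_m := [seq inord j | j <- iota 0 l].
Definition posJ : seq 'I_m := [seq inord j | j <- iota l (k - l)].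
Definition posJ' : seq 'I_m := [seq inord j | j <- iota k (k - l)].

Lemma pos_all : posI ++ posJ ++ posJ' = [seq inord j | j <- iota 0 m].
Proof.
have -> : iota 0 m = iota 0 (l + ((k - l) + (k - l))) by congr iota; rewrite /m mE; nlia.
by rewrite !iotaD !map_cat add0n subnKC //; nlia.
Qed.

Lemma uniq_pos : uniq (posI ++ posJ ++ posJ').
Proof.
rewrite pos_all map_inj_in_uniq ?iota_uniq // => i j; rewrite !mem_iota !add0n /= => im jm /(congr1 val).
by rewrite /= !inordK.
Qed.

Lemma mem_pos j : j \in posI ++ posJ ++ posJ'.
Proof.
by rewrite pos_all; apply/mapP; exists (val j); rewrite ?mem_iota ?inord_val //= ltn_ord.
Qed.

Lemma posI_cons : exists p, posI = ord0 :: p.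
Proof.
rewrite /posI; case: (l) hl1 => // l' _ /=; eexists; congr (_ :: _).
by apply: val_inj; rewrite /= inordK.
Qed.

Definition pattern (b : bool) := if b then posI ++ posJ else posI ++ posJ'.

Lemma pattern_uniq b : uniq (pattern b).
Proof.
by case: b; [apply: (perm_uniq_sub (L := posJ')) uniq_pos | apply: (perm_uniq_sub (L := posJ)) uniq_pos];
  rewrite /pattern; perm_count.
Qed.

Lemma pattern_size b : size (pattern b) = k.
Proof. by case: b; rewrite size_cat !size_map !size_iota; nlia. Qed.

Lemma pattern_cons b : exists p, pattern b = ord0 :: p.
Proof. by case: posI_cons => p pE; case: b; rewrite /pattern pE; eexists. Qed.

Definition arrangement (sg : {ffun 'I_t * 'I_m -> V}) : bool :=
  injectiveb sg && [forall p, if p.2 == ord0 then sg p \in A else sg p \in B].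

Definition good_row (sg : {ffun 'I_t * 'I_m -> V}) i : bool :=
  [forall b, edge H [seq sg (i, j) | j <- pattern b]].

Lemma arrangement_ex : exists sg, arrangement sg.
Proof.
have t0 : 0 < t by nlia.
have [a0 a0A] : exists a, a \in A by apply/card_gt0P; rewrite cA.
have eA (i : 'I_t) : i < size (enum A) by rewrite -cardE cA.
have eB (i : 'I_t) (j : 'I_m) : j != ord0 -> i * m1 + j.-1 < size (enum B).
  rewrite -cardE cB -val_eqE /= -lt0n => j0; have := ltn_ord i; have := ltn_ord j; rewrite /m.
  move: (val i) (val j) j0 => x y y0 ym xt.
  have : x.+1 * m1 <= t * m1 by rewrite leq_mul2r xt orbT.
  by nlia.
pose sg := [ffun p : 'I_t * 'I_m => if p.2 == ord0 then nth a0 (enum A) p.1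
   else nth a0 (enum B) (p.1 * m1 + p.2.-1)].
have sgP p : if p.2 == ord0 then sg p \in A else sg p \in B.
  rewrite ffunE; case p2: (p.2 == ord0); rewrite -mem_enum mem_nth // eB //; by rewrite p2.
exists sg; apply/andP; split; last exact/forallP.
apply/injectiveP => [[i j] [i' j']] eq_sg.
have := sgP (i, j); have := sgP (i', j'); rewrite -eq_sg /=.
have notAB x : x \in A -> x \in B -> False.
  by move=> xA xB; move: dAB; rewrite disjoint_subset => /subsetP /(_ x xA); rewrite inE xB.
case: eqVneq => [j'0|j'0]; case: eqVneq => [j0|j0] h1 h2; try by case: (notAB _ h1 h2) || case: (notAB _ h2 h1).
  move: eq_sg; rewrite !ffunE /= j0 j'0 eqxx => /eqP.
  by rewrite nth_uniq ?enum_uniq // => /eqP/val_inj ->.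
move: eq_sg; rewrite !ffunE /= (negbTE j0) (negbTE j'0) => /eqP.
rewrite nth_uniq ?enum_uniq ?eB // => /eqP eq_ij.
move: j0 j'0; rewrite -!val_eqE /= -!lt0n => j0 j'0.
have jm : j.-1 < m1 by have := ltn_ord j; rewrite /m; nlia.
have jm' : j'.-1 < m1 by have := ltn_ord j'; rewrite /m; nlia.
have m10 : 0 < m1 by nlia.
have ii : i = i'.
  apply: val_inj; have := congr1 (divn^~ m1) eq_ij.
  by rewrite /= !divnMDl // !divn_small // !addn0.
rewrite ii; congr (_, _); apply: val_inj => /=.
by move: eq_ij; rewrite ii => /addnI; rewrite -(prednK j0) -(prednK j'0) => /= ->.
Qed.

Lemma good_rows_tileable sg : arrangement sg -> (forall i, good_row sg i) -> tileable H l (A :|: B).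
Proof.
move=> /andP[/injectiveP inj_sg /forallP sgP] good.
pose row i := setof [seq sg (i, j) | j <- posI ++ posJ ++ posJ'].
have mem_row i x : reflect (exists j, x = sg (i, j)) (x \in row i).
  rewrite inE; apply: (iffP mapP) => [[j _ ->]|[j ->]]; first by exists j.
  by exists j => //; apply: mem_pos.
have Yrow i : isY H l (row i).
  rewrite /row !map_cat; have /forallP gi := good i.
  have e1 := gi true; have e2 := gi false; rewrite /pattern !map_cat in e1 e2.
  apply: isY_seq => //; last by rewrite size_map size_map size_iota.
  have u : uniq [seq sg (i, j) | j <- posI ++ posJ ++ posJ'].
    by rewrite map_inj_uniq ?uniq_pos // => j j' /inj_sg [].
  by rewrite !map_cat in u.
apply/tileableP; exists [set row i | i : 'I_t]; split.
- apply/trivIsetP => T T' /imsetP[i _ ->] /imsetP[i' _ ->] nT.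
  rewrite disjoint_subset; apply/subsetP => x /mem_row[j xE]; rewrite inE; apply/negP => /mem_row[j'].
  by rewrite xE => /inj_sg [ii _]; move: nT; rewrite ii eqxx.
- apply/eqP; have dU : #|A :|: B| = t * m by rewrite cardsU (disjoint_setI0 dAB) cards0 cA cB /m; nlia.
  rewrite eqEcard dU; apply/andP; split.
    apply/subsetP => x /bigcupP[T /imsetP[i _ ->] /mem_row[j ->]]; have := sgP (i, j).
    by rewrite inE; case: ifP => _ ->; rewrite ?orbT.
  rewrite -[t * m](_ : #|[set sg p | p : 'I_t * 'I_m]| = _); last by rewrite card_imset // card_prod !card_ord.
  apply/subset_leq_card/subsetP => x /imsetP[[i j] _ ->]; apply/bigcupP; exists (row i).
    exact: imset_f.
  by apply/mem_row; exists j.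
- by move=> T /imsetP[i _ ->].
Qed.

(** * Repairing a bad row by shifting columns *)

Section Switch.
Variables (sg : {ffun 'I_t * 'I_m -> V}) (r0 : 'I_t).
Hypothesis arr_sg : arrangement sg.
Local Open Scope ring_scope.
Import GRing.Theory.

Let inj_sg : injective sg. Proof. by case/andP: arr_sg => /injectiveP. Qed.

Let sg0 i : sg (i, ord0) \in A.
Proof. by case/andP: arr_sg => _ /forallP /(_ (i, ord0)). Qed.

Let sgB i j : j != ord0 -> sg (i, j) \in B.
Proof. by case/andP: arr_sg => _ /forallP /(_ (i, j)) /=; case: eqP. Qed.

(** Addition is modulo [m]: among the rows [e x], column [j] is shifted by [j]. A new row therefore
    takes its entries from [m] different old rows, exactly one of them from [r0 = e 0]. *)
Definition shifted (e : 'I_m -> 'I_t) : {ffun 'I_t * 'I_m -> V} :=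
  [ffun p => if [pick x | e x == p.1] is Some x then sg (e (x + p.2), p.2) else sg p].

Lemma shifted_row e x j : injective e -> shifted e (e x, j) = sg (e (x + j), j).
Proof.
move=> inj_e; rewrite ffunE /=; case: pickP => [y /eqP/inj_e -> //|/(_ x)].
by rewrite eqxx.
Qed.

Lemma shifted_out e i j : (forall x, e x != i) -> shifted e (i, j) = sg (i, j).
Proof. by move=> out; rewrite ffunE /=; case: pickP => [y|//]; rewrite (negbTE (out y)). Qed.

Lemma shifted_arrangement e : injective e -> arrangement (shifted e).
Proof.
move=> inj_e.
have col i j : exists i', shifted e (i, j) = sg (i', j).
  by rewrite ffunE /=; case: pickP => [y _|_]; eexists.
apply/andP; split; last first.
  apply/forallP => [[i j]] /=; have [i' ->] := col i j.
  by case: eqVneq => [->|j0]; [apply: sg0 | apply: sgB].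
apply/injectiveP => [[i j] [i' j']].
have [ii eqi] := col i j; have [ii' eqi'] := col i' j'.
move=> eq_s; have jj : j = j' by move: eq_s; rewrite eqi eqi' => /inj_sg [].
move: eq_s; rewrite -{}jj {j' eqi eqi' ii ii'} !ffunE /=.
case: pickP => [x /eqP <-|out]; case: pickP => [x' /eqP <-|out'] /inj_sg [].
- by move=> /inj_e /addIr ->.
- by move=> eq_i; have := out' (x + j); rewrite eq_i eqxx.
- by move=> eq_i; have := out (x' + j); rewrite eq_i eqxx.
- by move=> ->.
Qed.

Lemma shifted_better e : injective e -> e 0 = r0 -> ~~ good_row sg r0 ->
  (forall x b, edge H [seq sg (e (x + j), j) | j <- pattern b]) ->
  (#|[set i | good_row sg i]| < #|[set i | good_row (shifted e) i]|)%N.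
Proof.
move=> inj_e e0 bad_r0 good_e; apply: proper_card; apply/properP; split.
  apply/subsetP => i; rewrite !inE => /forallP gi; apply/forallP => b.
  have [/existsP[x /eqP <-]|/existsPn out] := boolP [exists x, e x == i].
    by rewrite (eq_map (fun j => shifted_row x j inj_e)); apply: good_e.
  by rewrite (eq_map (fun j => shifted_out j out)); apply: gi.
exists r0; rewrite !inE // -e0; apply/forallP => b.
by rewrite (eq_map (fun j => shifted_row 0 j inj_e)); apply: good_e.
Qed.

(** The row [r0] is prescribed and the others are random; drawing all [m] values and overriding the
    one at 0 keeps the sample space a full power. *)
Definition ext (rho : {ffun 'I_m -> 'I_t}) (x : 'I_m) : 'I_t := if x == 0 then r0 else rho x.

(** New row [x] takes from [r0] only its entry in column [- x]. If the pattern omits this column,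
    all its entries are random, and [goodA] is summed over the vertex in column 0. Otherwise one
    entry is fixed, in [A] or in [B] according to whether the column is 0, and [goodA] or [goodB]
    bounds its missing links. *)
Lemma bad_pattern_count x b :
  (K * #|[set rho : {ffun 'I_m -> 'I_t} | ~~ edge H [seq sg (ext rho (x + j)%R, j) | j <- pattern b]]| <= c ^ k.-1 * t ^ m)%N.
Proof.
have [p patE] := pattern_cons b; have uP := pattern_uniq b; have sP := pattern_size b.
have injF (i : 'I_m) : injective (fun r : 'I_t => sg (r, i - x)) by move=> r r' /inj_sg [].
have km : (k <= m)%N by rewrite /m mE; nlia.
have pB s : all (mem B) [seq sg (ext s (x + j)%R, j) | j <- p].
  apply/allP => v /mapP[j jp ->]; apply: sgB; apply/eqP => j0.
  by move: uP; rewrite patE /= -j0 jp.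
have t_pow r : (r <= m)%N -> (t ^ r * t ^ (m - r) = t ^ m)%N by move=> rm; rewrite -expnD subnKC.
have nk : (n ^ k.-1 <= c ^ k.-1 * t ^ k.-1)%N by rewrite -expnMn leq_exp2r //; nlia.
have inj_seq s : uniq [seq sg (ext s (x + j)%R, j) | j <- pattern b].
  by rewrite map_inj_uniq // => j j' /inj_sg [].
have [qP|qP] := boolP (- x \in pattern b); last first.
  pose Bd s := if s is a :: y then (a \in A) && bad_link_A a y else false.
  pose cs := [seq x + j | j <- pattern b].
  have ucs : uniq cs by rewrite map_inj_uniq //; exact: addrI.
  have scs : size cs = k by rewrite size_map.
  have cBd : (K * cnt k Bd <= t * n ^ k.-1)%N.
    have {1}-> : k = k.-1.+1 by nlia.
    rewrite cntS big_distrr /= -cA -sum_nat_const [X in (_ <= X)%N]big_mkcond; apply: leq_sum => a _.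
    case: ifP => aA; last by rewrite cnt_none ?muln0 // => s; rewrite /Bd aA.
    by rewrite (eq_cnt (Q := bad_link_A a)) ?goodA // => s _; rewrite /Bd aA.
  have le_bad : (#|[set rho : {ffun 'I_m -> 'I_t} | ~~ edge H [seq sg (ext rho (x + j)%R, j) | j <- pattern b]]| <=
      cnt k Bd * t ^ (m - k))%N.
    have := proj_cnt Bd ucs injF; rewrite card_ord scs; apply: leq_trans.
    apply/subset_leq_card/subsetP => rho; rewrite !inE => bad.
    have eq_s : [seq sg (rho j, j - x) | j <- cs] = [seq sg (ext rho (x + j)%R, j) | j <- pattern b].
      rewrite /cs -map_comp; apply/eq_in_map => j jP /=; rewrite addrAC subrr add0r /ext.
      case: eqP => // xj; case/negP: qP; suff -> : - x = j by [].
      by apply/eqP; rewrite eq_sym -addr_eq0 addrC xj.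
    rewrite eq_s; have := pB rho; have := inj_seq rho; move: bad; rewrite patE /Bd /bad_link_A /= sg0.
    by move=> -> /andP[_ ->] ->.
  apply: leq_trans (_ : (K * (cnt k Bd * t ^ (m - k)) <= _)%N).
    by rewrite leq_mul2l le_bad orbT.
  rewrite -(t_pow k km) mulnA; apply: leq_trans (_ : (t * n ^ k.-1 * t ^ (m - k) <= _)%N).
    by rewrite leq_mul2r cBd orbT.
  rewrite mulnA leq_mul2r; apply/orP; right.
  have {3}-> : k = k.-1.+1 by nlia.
  by rewrite expnS mulnCA leq_mul2l nk orbT.
pose q := - x; pose v := sg (r0, q).
pose js := rem q (pattern b).
pose Bd := if q == 0 then bad_link_A v else bad_link_B v.
pose cs := [seq x + j | j <- js].
have ujs : uniq js by apply: rem_uniq.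
have ucs : uniq cs by rewrite map_inj_uniq //; exact: addrI.
have scs : size cs = k.-1 by rewrite size_map size_rem // sP.
have cBd : (K * cnt k.-1 Bd <= n ^ k.-1)%N.
  rewrite /Bd /v; case: eqP => [->|/eqP q0]; first by apply: goodA; apply: sg0.
  by apply: goodB; apply: sgB.
have km1 : (k.-1 <= m)%N by nlia.
have le_bad : (#|[set rho : {ffun 'I_m -> 'I_t} | ~~ edge H [seq sg (ext rho (x + j)%R, j) | j <- pattern b]]| <=
    cnt k.-1 Bd * t ^ (m - k.-1))%N.
  have := proj_cnt Bd ucs injF; rewrite card_ord scs; apply: leq_trans.
  apply/subset_leq_card/subsetP => rho; rewrite !inE => bad.
  have jsq j : j \in js -> (j != q) && (j \in pattern b).
    by rewrite /js mem_rem_uniq // !inE.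
  have eq_s : [seq sg (rho j, j - x) | j <- cs] = [seq sg (ext rho (x + j)%R, j) | j <- js].
    rewrite /cs -map_comp; apply/eq_in_map => j /jsq /andP[jq _] /=; rewrite addrAC subrr add0r /ext.
    case: eqP => // xj; case/eqP: jq; apply/eqP; by rewrite -addr_eq0 addrC xj.
  have eq_v : v = sg (ext rho (x + q), q) by rewrite /ext subrr eqxx.
  have perm_s : perm_eq [seq sg (ext rho (x + j)%R, j) | j <- pattern b]
      (v :: [seq sg (ext rho (x + j)%R, j) | j <- js]).
    by rewrite eq_v; apply: (perm_map (fun j => sg (ext rho (x + j), j)) (perm_to_rem qP)).
  have bad' : ~~ edge H (v :: [seq sg (ext rho (x + j)%R, j) | j <- js]).
    by rewrite -(edge_perm H perm_s).
  have u' : uniq (v :: [seq sg (ext rho (x + j)%R, j) | j <- js]) by rewrite -(perm_uniq perm_s).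
  rewrite eq_s /Bd; case: eqP => [q0|/eqP q0].
    rewrite /bad_link_A bad' andbT; move: u'; rewrite cons_uniq => /andP[_ ->]; rewrite andbT.
    by rewrite /js q0 patE /= ?eqxx; apply: pB.
  have jsE : js = ord0 :: rem q p by rewrite /js patE /= eq_sym (negbTE q0).
  move: bad' u'; rewrite jsE map_cons => bad' u'.
  rewrite /bad_link_B /= -/(ext _ _) sg0 bad' /= andbT.
  have -> : all (mem B) [seq sg (ext rho (x + j)%R, j) | j <- rem q p].
    by apply/allP => w /mapP[j /mem_rem jp ->]; apply: (allP (pB rho)); apply: map_f.
  move: u'; rewrite /= !inE !negb_or -!andbA => /and4P[_ -> _ ->]; by [].
apply: leq_trans (_ : (K * (cnt k.-1 Bd * t ^ (m - k.-1)) <= _)%N).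
  by rewrite leq_mul2l le_bad orbT.
rewrite -(t_pow k.-1 km1) !mulnA leq_mul2r; apply/orP; right.
exact: leq_trans cBd nk.
Qed.

(** A union bound over [rho]: [t_large] keeps collisions below one half of all functions, and
    [K_large] gives the [2 * m] pattern conditions at most the other half. *)
Lemma switch_ex : exists e, [/\ injective e, e 0 = r0 &
  forall x b, edge H [seq sg (e (x + j), j) | j <- pattern b]].
Proof.
have t0 : (0 < t)%N by nlia.
pose Bad (z : (('I_m * 'I_m) + ('I_m * bool))%type) : {set {ffun 'I_m -> 'I_t}} := match z with
  | inl (i, j) => if i != j then [set rho : {ffun 'I_m -> 'I_t} | ext rho i == ext rho j] else set0
  | inr (x, b) => [set rho : {ffun 'I_m -> 'I_t} | ~~ edge H [seq sg (ext rho (x + j)%R, j) | j <- pattern b]]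
  end.
have [/existsP[rho /forallP good]|bad] := boolP [exists rho, [forall z, rho \notin Bad z]].
  exists (ext rho); split; last first.
  - by move=> x b; have := good (inr (x, b)); rewrite inE negbK.
  - by rewrite /ext eqxx.
  - move=> i j eq_ij; apply/eqP/negPn/negP => nij.
    by have := good (inl (i, j)); rewrite /= nij inE eq_ij eqxx.
exfalso; move: bad; rewrite negb_exists => /forallP bad.
have : (#|[set: {ffun 'I_m -> 'I_t}]| <= \sum_z #|Bad z|)%N.
  apply: card_union_bound => rho _; have := bad rho; rewrite negb_forall => /existsP[z].
  by rewrite negbK => zB; exists z.
rewrite cardsT card_ffun !card_ord big_sumType.
have m0 : (0 < m)%N by [].
have m2 : (2 <= m)%N by rewrite /m mE; nlia.
have tm : (t ^ m = t * t ^ m.-1)%N by rewrite -expnS.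
have one j : (#|[set rho : {ffun 'I_m -> 'I_t} | rho j == r0]| <= t ^ m.-1)%N.
  have := @proj_cnt m 'I_t 'I_t [:: j] (fun _ => id) (fun s => if s is [:: y] then y == r0 else false) isT.
  move=> /(_ (fun _ => @inj_id _)) /=; rewrite card_ord subn1 => /leq_trans; apply.
  rewrite cntS (bigD1 r0) //= big1 => [|w wr]; first by rewrite cnt0 eqxx mul1n.
  by rewrite cnt0 (negbTE wr).
have s1 : (\sum_(z : 'I_m * 'I_m) #|Bad (inl z)| <= m * m * t ^ m.-1)%N.
  apply: (@leq_trans (\sum_(z : 'I_m * 'I_m) t ^ m.-1)%N); last by rewrite sum_nat_const card_prod card_ord.
  apply: leq_sum => [[i j] _] /=; case: eqP => [_|/eqP nij]; first by rewrite cards0.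
  have [i0|i0] := eqVneq i 0.
    apply: leq_trans (one j); apply/subset_leq_card/subsetP => rho; rewrite !inE /ext i0 eqxx.
    by rewrite (negbTE (_ : j != 0)) 1?eq_sym // -i0.
  have [j0|j0] := eqVneq j 0.
    apply: leq_trans (one i); apply/subset_leq_card/subsetP => rho; rewrite !inE /ext j0 eqxx.
    by rewrite (negbTE i0).
  have u2 : uniq [:: i; j] by rewrite /= inE nij.
  have := @proj_cnt m 'I_t 'I_t [:: i; j] (fun _ => id) (fun s => if s is [:: y; z] then y == z else false) u2.
  move=> /(_ (fun _ => @inj_id _)) /=; rewrite card_ord => le2.
  apply: (@leq_trans #|[set rho : {ffun 'I_m -> 'I_t} | rho i == rho j]|).
    by apply/subset_leq_card/subsetP => rho; rewrite !inE /ext (negbTE i0) (negbTE j0).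
  apply: leq_trans le2 _.
  have -> : cnt 2 (fun s : seq 'I_t => if s is [:: y; z] then y == z else false) = t.
    rewrite cntS -[RHS]card_ord -sum1_card; apply: eq_bigr => v _.
    rewrite cntS (bigD1 v) //= big1 => [|w wv]; first by rewrite cnt0 eqxx.
    by rewrite cnt0 eq_sym (negbTE wv).
  by rewrite -expnS leq_pexp2l //; nlia.
have s2 : (K * \sum_(z : 'I_m * bool) #|Bad (inr z)| <= 2 * m * (c ^ k.-1 * t ^ m))%N.
  rewrite big_distrr /=.
  apply: (@leq_trans (\sum_(z : 'I_m * bool) c ^ k.-1 * t ^ m)%N).
    by apply: leq_sum => [[x b] _]; apply: bad_pattern_count.
  by rewrite sum_nat_const card_prod card_ord card_bool [(m * 2)%N]mulnC.
have ck0 : (0 < c ^ k.-1)%N by rewrite expn_gt0 c0.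
have tm0 : (0 < t ^ m.-1)%N by rewrite expn_gt0 t0.
have s2' : (2 * \sum_(z : 'I_m * bool) #|Bad (inr z)| <= t ^ m)%N.
  have mc0 : (0 < 2 * m * c ^ k.-1)%N by rewrite !muln_gt0 ck0.
  rewrite -(leq_pmul2l mc0); apply: leq_trans (_ : (2 * m * (c ^ k.-1 * t ^ m) <= _)%N); last by rewrite mulnA.
  apply: leq_trans s2; rewrite mulnA; apply: leq_mul => //.
  by apply: leq_trans K_large; nlia.
move=> le_ab; move: s1 s2'; rewrite tm in le_ab *; move: le_ab.
set a := (\sum_(z : 'I_m * 'I_m) _)%N; set b := (\sum_(z : 'I_m * bool) _)%N.
have : (2 * (m * m) * t ^ m.-1 < t * t ^ m.-1)%N by rewrite ltn_pmul2r.
by move: (m * m)%N (t ^ m.-1)%N a b => mm T a b /=; nlia.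
Qed.

End Switch.

Lemma near_complete_tileable : tileable H l (A :|: B).
Proof.
have [s0 arr0] := arrangement_ex.
case: (arg_maxnP (fun sg => #|[set i | good_row sg i]|) arr0) => sg arr_sg max_sg.
apply: (good_rows_tileable arr_sg) => r0; apply: contraT => bad_r0.
have [e [inj_e e0 good_e]] := switch_ex r0 arr_sg.
have := max_sg _ (shifted_arrangement arr_sg inj_e).
by rewrite /= leqNgt (shifted_better inj_e e0 bad_r0 good_e).
Qed.

End NearComplete.

(** * Completing a near-extremal tiling *)

Section Completion.
Variables (V : finType) (H : {set {set V}}) (k l n t : nat).
Hypotheses (hk : 3 <= k) (hl1 : 1 <= l) (hl2 : l <= k - 2).
Hypothesis unifH : forall e, e \in H -> #|e| = k.
Let m := 2 * k - l.
Hypotheses (cardV : #|V| = n) (nE : n = t * m).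
Hypothesis codegH : forall s, uniq s -> size s = k.-1 -> t <= #|[set v | edge H (v :: s)]|.
Variables (A1 Bad : {set V}) (e Ka Kb Kc p : nat).
Let B1 := ~: A1.
Let w := 2 ^ k.-1.
Let d := 2 * e * m + 4 * k.
Hypotheses (A1_le : #|A1| <= t + e) (A1_ge : t <= #|A1| + e) (Bad_le : #|Bad| <= e).
Hypotheses (et : 8 * e + 8 <= t) (mt : 4 * (m * m) < t).
Hypotheses (Ka0 : 0 < Ka) (pE : p = k * k + 4 * k) (np : 4 * 2 ^ p * (p * p) <= n).
Hypothesis KbE : m * (4 * 2 ^ p * p ^ k.-1) <= Kb.
Hypotheses (KcE : 4 * m * (2 * m) ^ k.-1 <= Kc) (Kcw : 4 * w <= Kc).
Hypotheses (wn : 4 * w * (k * k) <= n) (dn : w * (4 * w + Ka) * d <= n).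
Hypothesis denseA : forall v, v \in A1 ->
  n ^ k.-1 <= Ka * cnt k.-1 (fun s => all (mem B1) s && edge H (v :: s)).
Hypothesis sparseB : forall b, b \in B1 ->
  Kb * cnt k.-1 (fun s => all (mem B1) s && edge H (b :: s)) <= n ^ k.-1.
Hypothesis fullA : forall a, a \in A1 -> a \notin Bad -> Kc * cnt k.-1 (bad_link_A H B1 a) <= n ^ k.-1.
Hypothesis fullB : forall b, b \in B1 -> Kc * cnt k.-1 (bad_link_B H A1 B1 b) <= n ^ k.-1.
Let lk : l < k. Proof. lia. Qed.
Let mk : k + 2 <= m. Proof. rewrite /m; lia. Qed.
Let w0 : 0 < w. Proof. by rewrite expn_gt0. Qed.
Let d0 : 0 < d. Proof. rewrite /d; nlia. Qed.
Let n0 : 0 < n. Proof. rewrite nE; nnia. Qed.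
Let N0 : 0 < n ^ k.-1. Proof. by rewrite expn_gt0 n0. Qed.
Let tn : 5 * t <= n. Proof. rewrite nE mulnC leq_mul2l; apply/orP; right; nlia. Qed.

(** A (k-1)-tuple in [Z] without neighbours in [Z] has its at least [t] neighbours in [A1] and [X],
    hence at least [s = t - #|A1|] of them in [X]. Since [X] has fewer than [s * m] vertices, all
    with sparse links in [B1], the factor [s] cancels: such tuples are rare even for a deficit of
    one, and [find_core] provides a further tile. *)
Lemma missing_tiles j : j <= t - #|A1| ->
  exists X, [/\ tileable H l X, X \subset B1 & #|X| = j * m].
Proof.
elim: j => [|j IH] js; first by exists set0; rewrite tileable0 sub0set cards0.
have [|X [TX sX cX]] := IH; first by nlia.
pose Z := B1 :\: X; set s := t - #|A1| in js.
pose P x := [&& all (mem Z) x, uniq x & ~~ [exists u in Z, edge H (u :: x)]].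
have s0 : 0 < s by nlia.
have cB1 := cardCE cardV A1; rewrite -/B1 in cB1.
have cZ : n <= 2 * #|Z|.
  have -> : #|Z| = #|B1| - #|X| by rewrite cardsD (setIidPr sX).
  rewrite cX; have : j * m <= e * m by rewrite leq_mul2r; apply/orP; right; nlia.
  have : 8 * e * m <= t * m by rewrite leq_mul2r; apply/orP; right; nlia.
  by rewrite -nE; nlia.
have sum_le : s * cnt k.-1 P <=
    \sum_(v in X) cnt k.-1 (fun x => all (mem B1) x && edge H (v :: x)).
  rewrite cntE big_distrr /=.
  under [X in _ <= X]eq_bigr => v _ do rewrite cntE.
  rewrite (exchange_big_dep (fun x : k.-1.-tuple V => all (mem B1) x)) /=; last by move=> v x _ /andP[].
  rewrite [X in X <= _]big_mkcond [X in _ <= X]big_mkcond /=; apply: leq_sum => x _.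
  case: ifP => //; rewrite muln1 => /and3P[xZ ux /existsPn noZ].
  have xB1 : all (mem B1) x by apply/allP => v /(allP xZ); rewrite /= in_setD => /andP[].
  rewrite xB1 /= sum1dep_card /s; have := codegH ux (size_tuple x).
  set Nx := [set v | _]; set Nx' := [set v | _] => le_t.
  suff : #|Nx| <= #|A1 :|: Nx'| by have := cardU_le A1 Nx'; nlia.
  apply/subset_leq_card/subsetP => v; rewrite in_setU !inE => ev; rewrite ev andbT.
  have := noZ v; rewrite ev andbT !inE negb_and !negbK; case/orP => -> //.
  by rewrite orbT.
have le2 : Kb * (s * cnt k.-1 P) <= s * m * n ^ k.-1.
  apply: leq_trans (_ : Kb * \sum_(v in X) cnt k.-1 (fun x => all (mem B1) x && edge H (v :: x)) <= _).
    by rewrite leq_mul2l sum_le orbT.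
  rewrite big_distrr /=; apply: (@leq_trans (\sum_(v in X) n ^ k.-1)).
    by apply: leq_sum => v vX; apply: sparseB; apply: (subsetP sX).
  by rewrite sum_nat_const cX leq_mul2r leq_mul2r; apply/orP; right; apply/orP; right; nlia.
have le_c : 4 * 2 ^ p * p ^ k.-1 * cnt k.-1 P <= n ^ k.-1.
  have sm0 : 0 < s * m by rewrite muln_gt0 s0; nlia.
  rewrite -(leq_pmul2l sm0); apply: leq_trans le2.
  by have := leq_mul KbE (leqnn (s * cnt k.-1 P)); nlia.
have [T YT TZ] := find_core hk hl1 hl2 unifH cardV pE n0 cZ np le_c.
have dXT : [disjoint X & T].
  rewrite disjoint_sym disjoint_subset; apply/subsetP => x /(subsetP TZ); rewrite inE => /andP[xX _].
  exact: xX.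
exists (X :|: T); split.
- exact: tileableU (tileable1 YT).
- by rewrite subUset sX (subset_trans TZ (subsetDl _ _)).
- by rewrite cardsU (disjoint_setI0 dXT) cards0 subn0 cX (isY_card lk unifH YT) addnC -mulSn.
Qed.

(** Each new tile has a private vertex of [A1] in each of its edges, so it uses two where the final
    ratio allows one, and the excess drops by one. Both vertices avoid [Bad], so a positive
    proportion of the (k-1)-tuples of [B1] completes both. *)
Lemma excess_tiles j : t < #|A1| -> j <= #|A1| - t ->
  exists X, [/\ tileable H l X, #|X| = j * m & #|A1 :\: X| + 2 * j = #|A1|].
Proof.
move=> tA; elim: j => [|j IH] js.
  by exists set0; rewrite tileable0 cards0 setD0 addn0.
have [|X [TX cX cAX]] := IH; first by nlia.
have [|[|a [|a' [|? ?]]] [// _ /= uaa aA aX]] := @fresh V 2 (A1 :\: X) Bad; first by nlia.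
move: aA => /= /and3P[aA a'A _]; move: aX => /= /and3P[aBad a'Bad _].
move: aA a'A; rewrite !in_setD => /andP[aX aA] /andP[a'X a'A].
pose G s := [&& all (mem B1) s, uniq s, edge H (a :: s) & edge H (a' :: s)].
have cB1 := cardCE cardV A1; rewrite -/B1 in cB1.
have nB : n ^ k.-1 <= w * #|B1| ^ k.-1.
  by rewrite /w -expnMn leq_exp2r; nlia.
have le_B : #|B1| ^ k.-1 <= cnt k.-1 G + (cnt k.-1 (bad_link_A H B1 a) +
    (cnt k.-1 (bad_link_A H B1 a') + cnt k.-1 (fun s => all (mem [set: V]) s && ~~ uniq (map id s)))).
  rewrite -cnt_all.
  pose P1 s := bad_link_A H B1 a' s || (all (mem [set: V]) s && ~~ uniq (map id s)).
  pose P2 s := bad_link_A H B1 a s || P1 s.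
  apply: leq_trans (_ : cnt k.-1 G + cnt k.-1 P2 <= _).
    apply: cntU => s _ sB; rewrite /G /P2 /P1 /bad_link_A sB map_id /=.
    have -> : all (mem [set: V]) s by apply/allP => x _; rewrite /= inE.
    by case: uniq => //=; case: edge => //=; case: edge.
  rewrite leq_add2l; apply: (@leq_trans (cnt k.-1 (bad_link_A H B1 a) + cnt k.-1 P1)).
    by apply: cntU => s _.
  by rewrite leq_add2l; apply: cntU => s _.
have nu := @cnt_nonuniq V V id 1 setT k.-1; rewrite cardsT cardV muln1 in nu.
have {}nu : n * cnt k.-1 (fun s => all (mem [set: V]) s && ~~ uniq (map id s)) <= k.-1 * k.-1 * n ^ k.-1.
  by apply: nu => v; rewrite (_ : [set _ | _] = [set v]) ?cards1 //; apply/setP => y; rewrite !inE.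
(* There are at least [n ^ k.-1 / w] tuples in [B1], and each of the three losses is at most
   [n ^ k.-1 / (4 * w)]. *)
have dens : n ^ k.-1 <= 4 * w * cnt k.-1 G.
  move: nu (fullA aA aBad) (fullA a'A a'Bad) le_B nB.
  move: (cnt _ _) (cnt _ _) (cnt _ _) => y2 y1 u; move: (cnt _ _) (n ^ k.-1) (#|B1| ^ _) => g N b nu f1 f2 le_b le_N.
  have r1 : 4 * w * y1 <= N by apply: leq_trans f1; rewrite leq_mul2r Kcw orbT.
  have r2 : 4 * w * y2 <= N by apply: leq_trans f2; rewrite leq_mul2r Kcw orbT.
  have r3 : 4 * w * u <= N.
    rewrite -(leq_pmul2l n0); apply: (@leq_trans (4 * w * (k * k) * N)); last by rewrite leq_mul2r wn orbT.
    have : 4 * w * (n * u) <= 4 * w * (k.-1 * k.-1 * N) by rewrite leq_mul2l nu orbT.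
    have kk : k.-1 * k.-1 <= k * k by apply: leq_mul; apply: leq_pred.
    have : 4 * w * N * (k.-1 * k.-1) <= 4 * w * N * (k * k) by rewrite leq_mul2l kk orbT.
    by nlia.
  have : w * b <= w * (g + (y1 + (y2 + u))) by rewrite leq_mul2l le_b orbT.
  by nlia.
have mG : many d k.-1 (fun s => all (mem [set: V]) s && G s).
  apply: (dense_many (K := 4 * w)); rewrite ?muln_gt0 ?w0 //.
    by rewrite cardsT cardV; apply: leq_trans dn; rewrite -/w leq_mul2r leq_mul2l leq_addr !orbT.
  rewrite cardsT cardV (eq_cnt (Q := G)) // => s _.
  by rewrite (_ : all _ _) //; apply/allP => x _; rewrite /= inE.
have kE : k.-1 = l + (k - 1 - l) by clear -hk hl2; lia.
rewrite kE in mG.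
have [|||I [J [J' [[sI [sJ sJ']] [/andP[_ /and4P[BIJ _ e1 _]] /andP[_ /and4P[BIJ' _ _ e2]]] u avF _]]]] :=
   pair_pick (g := fun x => [set x]) (b := 1) (F := X :|: setof [:: a; a']) _ _ mG.
- by move=> x; rewrite inE.
- by move=> x; rewrite cards1.
- have := cardU_setof X [:: a; a']; rewrite cX /= /d.
  have : j * m <= e * m by rewrite leq_mul2r; apply/orP; right; clear -js A1_le; lia.
  by clear -hk hl2; lia.
have BL x : x \in I ++ J ++ J' -> x \notin A1.
  move: BIJ BIJ'; rewrite !all_cat => /andP[BI BJ] /andP[_ BJ'].
  by rewrite !mem_cat => /or3P[/(allP BI)|/(allP BJ)|/(allP BJ')]; rewrite /= inE.
have uL : uniq (a :: a' :: I ++ J ++ J').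
  rewrite !cons_uniq u andbT inE negb_or; move: uaa; rewrite inE andbT => ->.
  by rewrite /=; apply/andP; split; apply/negP => /BL; rewrite ?aA ?a'A.
pose T := setof (I ++ (a :: J) ++ (a' :: J')).
have pT : perm_eq (a :: a' :: I ++ J ++ J') (I ++ (a :: J) ++ (a' :: J')) by perm_count.
have YT : isY H l T.
  apply: isY_seq => //; first by rewrite -(perm_uniq pT).
    by rewrite -(edge_perm H (_ : perm_eq (a :: I ++ J) _)) //; perm_count.
  by rewrite -(edge_perm H (_ : perm_eq (a' :: I ++ J') _)) //; perm_count.
have memT x : (x \in T) = [|| x == a, x == a' | x \in I ++ J ++ J'].
  by rewrite /T inE -(perm_mem pT) !inE.
have dXT : [disjoint X & T].
  rewrite disjoint_sym disjoint_subset; apply/subsetP => x; rewrite memT inE.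
  case/or3P => [/eqP -> //|/eqP -> //|/(allP avF)]; by rewrite notin_setofU => /andP[].
exists (X :|: T); split.
- exact: tileableU (tileable1 YT).
- by rewrite cardsU (disjoint_setI0 dXT) cards0 subn0 cX (isY_card lk unifH YT) addnC -mulSn.
- have -> : A1 :\: (X :|: T) = (A1 :\: X) :\: [set a; a'].
    apply/setP => x; rewrite !in_setD in_setU memT !inE !negb_or.
    case xA: (x \in A1); rewrite ?andbF // !andbT.
    have -> : x \notin I ++ J ++ J' by apply/negP => /BL; rewrite xA.
    by rewrite andbT andbC.
  have sub : [set a; a'] \subset A1 :\: X by rewrite subUset !sub1set !inE aX aA a'X a'A.
  have c2 : #|[set a; a']| = 2 by rewrite cards2; move: uaa; rewrite inE andbT => ->.
  rewrite cardsD (setIidPr sub) c2 -cAX; have := subset_leq_card sub; rewrite c2; clear; lia.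
Qed.

(** Outside [X] there remain [(t - j) * m] vertices, of which [t - j] are in [A1]: the proportion
    for one vertex of [A1] in each further tile. *)
Definition balanced X j := [/\ tileable H l X, #|X| = j * m & #|A1 :\: X| + j = t].

Lemma balanced_ex : exists X j, balanced X j /\ j <= e.
Proof.
case: (leqP #|A1| t) => le_A.
  have [X [TX sX cX]] := missing_tiles (leqnn _).
  exists X, (t - #|A1|); split; last by nlia.
  split=> //; rewrite (_ : A1 :\: X = A1); first by nlia.
  apply/setDidPl; rewrite disjoint_sym disjoint_subset; apply/subsetP => x /(subsetP sX).
  by rewrite !inE.
have [X [TX cX cA]] := excess_tiles le_A (leqnn _).
exists X, (#|A1| - t); split; last by nlia.
by split=> //; nlia.
Qed.

(** Atypical vertices of [A1] still have dense links in [B1], so each lies in a copy of Y that meets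
    [A1] nowhere else; such a tile preserves the balance. *)
Lemma cover_bad q X j : balanced X j -> #|(Bad :&: A1) :\: X| <= q -> j + q <= 2 * e ->
  exists X' j', [/\ balanced X' j', Bad :&: A1 \subset X' & j' <= 2 * e].
Proof.
elim: q X j => [|q IH] X j balX; case: (set_0Vmem ((Bad :&: A1) :\: X)) => [B0|[v vB]].
- by move=> _ jq; exists X, j; rewrite -setD_eq0 B0; split=> //; nlia.
- by rewrite leqn0 cards_eq0 => /eqP B0; rewrite B0 inE in vB.
- by move=> _ jq; exists X, j; rewrite -setD_eq0 B0; split=> //; nlia.
move=> Bq jq; case: (balX) => TX cX cA.
move: (vB); rewrite !inE => /and3P[vX vBad vA].
have mv : many d k.-1 (fun s => all (mem B1) s && edge H (v :: s)).
  apply: many_mono (_ : many d k.-1 (fun s => all (mem [set: V]) s && (all (mem B1) s && edge H (v :: s)))) => [s _ /andP[]//|].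
  apply: (dense_many (K := Ka)) => //; rewrite cardsT cardV.
    by apply: leq_trans dn; rewrite -/w; nlia.
  apply: leq_trans (denseA vA) _; rewrite leq_mul2l; apply/orP; right; apply: cnt_mono => s _ ->.
  by rewrite andbT; apply/allP => x _; rewrite /= inE.
have [|T [YT vT Tx]] := dense_Y hk hl1 hl2 (F := X) mv.
  rewrite cX /d; have : j * m <= 2 * e * m by rewrite leq_mul2r; apply/orP; right; nlia.
  by nlia.
have dXT : [disjoint X & T].
  rewrite disjoint_sym disjoint_subset; apply/subsetP => x /Tx; rewrite inE.
  by case: eqVneq => [-> _ //|_ /(_ isT) /andP[]].
have TA : T :&: A1 = [set v].
  apply/setP => x; rewrite !inE; case: eqVneq => [->|xv]; first by rewrite vT vA.
  by apply/negP => /andP[/Tx /(_ xv)]; rewrite inE => /andP[/negbTE ->].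
have cXT : #|A1 :\: (X :|: T)|.+1 = #|A1 :\: X|.
  have -> : A1 :\: (X :|: T) = (A1 :\: X) :\ v.
    apply/setP => x; move/setP: TA => /(_ x); rewrite !inE negb_or => <-.
    by case: (x \in A1); case: (x \in X); case: (x \in T).
  have vAX : v \in A1 :\: X by rewrite inE vX.
  by rewrite (cardsD1 v (A1 :\: X)) vAX.
apply: (IH (X :|: T) j.+1); last by nlia.
- split; first exact: tileableU (tileable1 YT).
    by rewrite cardsU (disjoint_setI0 dXT) cards0 subn0 cX (isY_card lk unifH YT) addnC -mulSn.
  by nlia.
- rewrite -ltnS; apply: leq_trans Bq; apply: proper_card; apply/properP; split.
    by apply: setDS; apply: subsetUl.
  by exists v => //; rewrite !inE vT orbT.
Qed.

Lemma completion : tileable H l [set: V].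
Proof.
have [X0 [j0 [bal0 j0e]]] := balanced_ex.
have [||X [j [[TX cX cA] sB je]]] := cover_bad (q := e) bal0.
- by apply: leq_trans (subset_leq_card (subsetDl _ _)) (leq_trans (subset_leq_card (subsetIl _ _)) Bad_le).
- by nlia.
have cX' := cardCE cardV X.
pose A := A1 :\: X; pose B := B1 :\: X.
have dAB : [disjoint A & B].
  by rewrite disjoint_subset; apply/subsetP => x; rewrite !inE => /andP[_ ->]; rewrite andbF.
have AB : A :|: B = ~: X.
  by apply/setP => x; rewrite !inE; case: (x \in A1); case: (x \in X).
have cAB : #|A| + #|B| = #|~: X| by rewrite -AB cardsU (disjoint_setI0 dAB) cards0 subn0.
have mE : m.-1.+1 = m by clear -mk; lia.
have cB : #|B| = m.-1 * #|A|.
  have : #|A| + #|B| = m * #|A|.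
    by rewrite cAB; move: cX'; rewrite cX nE -cA -/A; nlia.
  have mm x : m * x = x + m.-1 * x by rewrite -mulSn mE.
  by rewrite mm => /addnI.
have Aj : #|A| + j = t := cA.
(* At most [2 * e] tiles were removed, which by [et] leaves more than half of [t]; this is the
   constant [2 * m] passed on as [c]. *)
have nA : n <= 2 * m * #|A|.
  rewrite nE mulnAC [2 * _ * m]mulnC [t * m]mulnC leq_mul2l; apply/orP; right; nlia.
have TAB : tileable H l (A :|: B).
  apply: (@near_complete_tileable V H k l m.-1 n #|A| (2 * m) Kc A B) => //.
  - by clear -mk; lia.
  - by rewrite mE; nlia.
  - by rewrite mE.
  - move=> a; rewrite inE => /andP[aX aA].
    have aBad : a \notin Bad by apply: contra aX => aB; apply: (subsetP sB); rewrite inE aB.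
    apply: leq_trans (fullA aA aBad); rewrite leq_mul2l; apply/orP; right; apply: cnt_mono => s _.
    case/and3P => sB' us ne; rewrite /bad_link_A us ne !andbT.
    by apply: sub_all sB' => x /=; rewrite in_setD => /andP[].
  - move=> b; rewrite inE => /andP[bX bB].
    apply: leq_trans (fullB bB); rewrite leq_mul2l; apply/orP; right; apply: cnt_mono => [[|a s]] // _.
    rewrite /bad_link_B => /and4P[]; rewrite in_setD => /andP[_ ->] sB' -> ->; rewrite !andbT /=.
    by apply: sub_all sB' => x /=; rewrite in_setD => /andP[].
rewrite -(setUCr X) -AB; apply: tileableU => //.
by rewrite AB disjoint_subset; apply/subsetP => x xX; rewrite !inE negbK.
Qed.

End Completion.

(** * Structure near the space barrier *)

Section NearExtremal.
Variables (V : finType) (H : {set {set V}}) (k l n t : nat).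
Hypotheses (hk : 3 <= k) (hl1 : 1 <= l) (hl2 : l <= k - 2).
Hypothesis unifH : forall e, e \in H -> #|e| = k.
Let m := 2 * k - l.
Hypotheses (cardV : #|V| = n) (nE : n = t * m) (n0 : 0 < n).
Hypothesis codegH : forall s, uniq s -> size s = k.-1 -> t <= #|[set v | edge H (v :: s)]|.
Variables (A0 : {set V}) (Ka Kc M : nat).
Let K := M * (Ka + Kc + 1).
Let w := 2 ^ k.-1.
Let N := n ^ k.-1.
Let B0 := ~: A0.
Hypotheses (A0_le : #|A0| <= t) (A0_ge : K * (t - #|A0|) <= n).
Hypothesis sparse0 : K * cnt k (fun s => all (mem B0) s && edge H s) <= n ^ k.
Hypotheses (Kaw : 4 * w <= Ka) (Kcw : 2 * w <= Kc) (wn : 4 * w * (k * k) <= n).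
Hypothesis MK : 2 * k * (Ka + Kc) <= M.

Let D v := cnt k.-1 (fun s => all (mem B0) s && edge H (v :: s)).
Let Df v := cnt k.-1 (bad_link_A H B0 v).

Definition heavy : {set V} := [set v | N <= Ka * D v].
Definition deficient : {set V} := [set v in A0 | N < Kc * Df v].
Let A1 := heavy.
Let B1 := ~: A1.
Let W := deficient.
Definition exceptional : {set V} := (A1 :\: A0) :|: W.
(** A single measure of the distance from the ideal barrier: it bounds the difference between
    [#|A1|] and [t], both differences between [A0] and [A1], and the number of atypical vertices. *)
Definition excess : nat := #|A1 :\: A0| + #|W| + (t - #|A0|).
Let e := excess.

Let N0 : 0 < N. Proof. by rewrite expn_gt0 n0. Qed.
Let w0 : 0 < w. Proof. by rewrite expn_gt0. Qed.
Let kS : k = k.-1.+1. Proof. by clear -hk; lia. Qed.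

Lemma sum_link_outside : K * \sum_(v in B0) D v <= n * N.
Proof.
have -> : n * N = n ^ k by rewrite [in RHS]kS expnS.
apply: leq_trans sparse0; rewrite leq_mul2l; apply/orP; right.
rewrite [in cnt k _]kS cntS [X in X <= _]big_mkcond; apply: leq_sum => v _; case: ifP => // vB.
by apply: cnt_mono => s _; rewrite /= ?vB.
Qed.

Lemma markov_outside (f : V -> nat) (c : nat) (X : {set V}) :
  (forall v, v \in X -> N <= c * f v) -> \sum_(v in X) f v <= \sum_(v in B0) D v ->
  K * #|X| <= c * n.
Proof.
move=> fX le_f; rewrite -(leq_pmul2r N0).
have : #|X| * N <= c * \sum_(v in X) f v.
  by rewrite -sum_nat_const big_distrr /=; apply: leq_sum => v /fX.
have := sum_link_outside; move: (\sum_(v in X) _) (\sum_(v in B0) _) le_f => a b ab Kb Xa.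
have h1 : K * (#|X| * N) <= K * (c * a) by rewrite leq_mul2l Xa orbT.
have h2 : K * c * a <= K * c * b by rewrite leq_mul2l ab orbT.
have h3 : c * (K * b) <= c * (n * N) by rewrite leq_mul2l Kb orbT.
by clear -h1 h2 h3; lia.
Qed.

(** A (k-1)-tuple in [B0] has at least [t >= #|A0|] neighbours, hence at least as many neighbours in
    [B0] as non-neighbours in [A0]. Thus few edges outside [A0] force few missing links from
    [A0]. *)
Lemma deficient_le : \sum_(v in A0) Df v <= \sum_(v in B0) D v.
Proof.
under eq_bigr => v _ do rewrite /Df cntE.
rewrite (exchange_big_dep (fun x : k.-1.-tuple V => all (mem B0) x && uniq x)) /=; last first.
  by move=> v x _ /and3P[-> -> _].
under [X in _ <= X]eq_bigr => v _ do rewrite /D cntE.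
rewrite (exchange_big_dep (fun x : k.-1.-tuple V => all (mem B0) x)) /=; last by move=> v x _ /andP[].
rewrite [X in X <= _]big_mkcond [X in _ <= X]big_mkcond /=; apply: leq_sum => x _.
case: ifP => // /andP[xB ux]; rewrite xB !sum1dep_card.
have := codegH ux (size_tuple x); set E := [set v | _] => tE.
have -> : #|[set v | (v \in A0) && bad_link_A H B0 v x]| = #|A0 :\: E|.
  by apply: eq_card => v; rewrite !inE /bad_link_A xB ux andbC.
have -> : #|[set v | (v \in B0) && (true && edge H (v :: x))]| = #|E :\: A0|.
  by apply: eq_card => v; rewrite !inE.
have := cardsID E A0; have := cardsID A0 E; rewrite setIC.
by clear -tE A0_le; lia.
Qed.

Lemma card_heavy_out : K * #|A1 :\: A0| <= Ka * n.
Proof.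
apply: (@markov_outside D) => [v|]; first by rewrite !inE => /andP[].
rewrite [X in X <= _]big_mkcond [X in _ <= X]big_mkcond /=; apply: leq_sum => v _.
by rewrite !inE; case: (v \in A0) => //=; case: ifP.
Qed.

Lemma card_deficient : K * #|W| <= Kc * n.
Proof.
apply: (@markov_outside Df) => [v|]; first by rewrite inE => /andP[_ /ltnW].
apply: leq_trans deficient_le; rewrite [X in X <= _]big_mkcond [X in _ <= X]big_mkcond /=.
by apply: leq_sum => v _; rewrite !inE; case: (v \in A0) => //=; case: ifP.
Qed.

Lemma excess_small : M * e <= n.
Proof.
have lt0 : 0 < Ka + Kc + 1 by rewrite addn1.
rewrite -(leq_pmul2l lt0); have := card_heavy_out; have := card_deficient; move: A0_ge.
rewrite /e /excess /K; move: #|A1 :\: A0| #|W| (t - #|A0|) => a b c h1 h2 h3.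
have -> : (Ka + Kc + 1) * (M * (a + b + c)) = M * (Ka + Kc + 1) * a + M * (Ka + Kc + 1) * b + M * (Ka + Kc + 1) * c.
  by clear; lia.
by clear -h1 h2 h3; lia.
Qed.

Lemma nonuniq_small : 4 * w * cnt k.-1 (fun s => all (mem [set: V]) s && ~~ uniq (map id s)) <= N.
Proof.
have nu := @cnt_nonuniq V V id 1 setT k.-1; rewrite cardsT cardV muln1 in nu.
have {}nu : n * cnt k.-1 (fun s => all (mem [set: V]) s && ~~ uniq (map id s)) <= k.-1 * k.-1 * N.
  by apply: nu => v; rewrite (_ : [set _ | _] = [set v]) ?cards1 //; apply/setP => y; rewrite !inE.
move: nu; move: (cnt _ _) => u nu.
rewrite -(leq_pmul2l n0); apply: (@leq_trans (4 * w * (k * k) * N)); last by rewrite leq_mul2r wn orbT.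
have h1 : 4 * w * (n * u) <= 4 * w * (k.-1 * k.-1 * N) by rewrite leq_mul2l nu orbT.
have kk : k.-1 * k.-1 <= k * k by apply: leq_mul; apply: leq_pred.
have h2 : 4 * w * N * (k.-1 * k.-1) <= 4 * w * N * (k * k) by rewrite leq_mul2l kk orbT.
by clear -h1 h2; lia.
Qed.

Lemma tn2 : 2 * t <= n.
Proof. by rewrite nE mulnC leq_mul2l /m; apply/orP; right; clear -hk hl2; lia. Qed.

(** At least [N / w] tuples lie in [B0], because [A0] is at most half of the vertices. Apart from
    those with repetitions, each is a link or a missing link of [v], so a vertex of [A0] with a
    sparse link misses many. *)
Lemma A0_sub : A0 :\: A1 \subset W.
Proof.
apply/subsetP => v; rewrite !inE -ltnNge => /andP[Dv vA]; rewrite vA /=.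
have cB := cardCE cardV A0; rewrite -/B0 in cB.
have nB : N <= w * #|B0| ^ k.-1.
  have k1 : 0 < k.-1 by clear -hk; lia.
  by rewrite /w -expnMn leq_exp2r //; have := tn2; clear -cB A0_le; lia.
have le_B : #|B0| ^ k.-1 <= D v + (Df v + cnt k.-1 (fun s => all (mem [set: V]) s && ~~ uniq (map id s))).
  rewrite -cnt_all.
  pose P1 s := bad_link_A H B0 v s || (all (mem [set: V]) s && ~~ uniq (map id s)).
  apply: (@leq_trans (D v + cnt k.-1 P1)); last by rewrite leq_add2l; apply: cntU => s _.
  apply: cntU => s _ sB; rewrite /P1 /bad_link_A sB map_id /=.
  have -> : all (mem [set: V]) s by apply/allP => x _; rewrite /= inE.
  by case: uniq => //=; case: edge.
move: nonuniq_small le_B nB; move: (cnt _ _) (#|B0| ^ _) => u b hu le_b le_N.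
have h1 : w * b <= w * (D v + (Df v + u)) by rewrite leq_mul2l le_b orbT.
have h2 : 4 * w * D v <= Ka * D v by rewrite leq_mul2r Kaw orbT.
have h3 : 2 * w * Df v <= Kc * Df v by rewrite leq_mul2r Kcw orbT.
by clear -h1 h2 h3 hu le_N Dv N0; lia.
Qed.

Lemma hit_small (Q : nat) (X : {set V}) : k * Q * #|X| <= n ->
  Q * cnt k.-1 (fun s => all (mem [set: V]) s && has (mem X) s) <= N.
Proof.
move=> le_n; have := cnt_hit setT X k.-1; rewrite cardsT cardV -/N.
move: (cnt _ _) => c hc; rewrite -(leq_pmul2l n0).
apply: (@leq_trans (k * Q * #|X| * N)); last by rewrite leq_mul2r le_n orbT.
have h1 : Q * (n * c) <= Q * (k.-1 * #|X| * N) by rewrite leq_mul2l hc orbT.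
have h2 : k.-1 * (Q * #|X| * N) <= k * (Q * #|X| * N) by rewrite leq_mul2r leq_pred orbT.
by clear -h1 h2; lia.
Qed.

Lemma change_small (Q : nat) (X : {set V}) : Q <= 2 * (Ka + Kc) -> #|X| <= e ->
  Q * cnt k.-1 (fun s => all (mem [set: V]) s && has (mem X) s) <= N.
Proof.
move=> QK Xe; apply: hit_small; apply: leq_trans excess_small; apply: leq_mul => //.
by apply: leq_trans MK; rewrite [2 * k]mulnC -mulnA leq_mul2l QK orbT.
Qed.

(** The classes are defined by links in [B0] but used with links in [B1]; the difference is made of
    tuples hitting [A0 :\: A1] or [A1 :\: A0], which [change_small] bounds. *)
Lemma change_links (P : pred (seq V)) (X Y Z : {set V}) : X :\: Y \subset Z ->
  cnt k.-1 (fun s => all (mem X) s && P s) <= cnt k.-1 (fun s => all (mem Y) s && P s) +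
    cnt k.-1 (fun s => all (mem [set: V]) s && has (mem Z) s).
Proof.
move=> sub; apply: cntU => s _ /andP[/allP sX ->]; rewrite andbT.
have -> : all (mem [set: V]) s by apply/allP => x _; rewrite /= inE.
case: (boolP (has _ s)); rewrite ?orbT // => /hasPn nZ; rewrite orbF.
apply/allP => x xs /=; apply: contraT => xY; have := nZ x xs.
by rewrite /= (subsetP sub) // inE xY; apply: sX.
Qed.

Lemma sub_out_le : #|A1 :\: A0| <= e. Proof. by rewrite /e /excess -addnA leq_addr. Qed.
Lemma sub_in_le : #|A0 :\: A1| <= e.
Proof.
by apply: leq_trans (subset_leq_card A0_sub) _; rewrite /e /excess; clear; lia.
Qed.

Lemma B0_diff : B0 :\: B1 \subset A1 :\: A0.
Proof. by apply/subsetP => x; rewrite !in_setD !in_setC negbK andbC. Qed.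

Lemma B1_diff : B1 :\: B0 \subset A0 :\: A1.
Proof. by apply/subsetP => x; rewrite !in_setD !in_setC negbK andbC. Qed.

Lemma heavy_link v : v \in A1 ->
  N <= 2 * Ka * cnt k.-1 (fun s => all (mem B1) s && edge H (v :: s)).
Proof.
rewrite inE => Dv; have h2 := change_links (fun s => edge H (v :: s)) B0_diff.
have QK : 2 * Ka <= 2 * (Ka + Kc) by rewrite leq_mul2l leq_addr orbT.
have h1 := change_small QK sub_out_le.
by move: h1 (leq_mul (leqnn Ka) h2); rewrite -/(D v); clear -Dv; lia.
Qed.

Lemma light_link b : b \in B1 ->
  Ka * cnt k.-1 (fun s => all (mem B1) s && edge H (b :: s)) <= 2 * N.
Proof.
rewrite !inE -ltnNge => Db; have h2 := change_links (fun s => edge H (b :: s)) B1_diff.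
have QK : Ka <= 2 * (Ka + Kc) by clear; lia.
have h1 := change_small QK sub_in_le.
by move: h1 (leq_mul (leqnn Ka) h2); rewrite -/(D b); clear -Db; lia.
Qed.

Lemma full_link_A a : a \in A1 -> a \notin exceptional ->
  Kc * cnt k.-1 (bad_link_A H B1 a) <= 2 * N.
Proof.
move=> aA; rewrite in_setU in_setD aA andbT negb_or negbK => /andP[aA0].
rewrite inE aA0 /= -leqNgt => Dfa.
have h2 := change_links (fun s => uniq s && ~~ edge H (a :: s)) B1_diff.
have QK : Kc <= 2 * (Ka + Kc) by clear; lia.
have h1 := change_small QK sub_in_le.
move: h1 (leq_mul (leqnn Kc) h2); rewrite -/(bad_link_A H B0 a) -/(Df a) -/(bad_link_A H B1 a).
by clear -Dfa; lia.
Qed.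

(** For fixed [y], the set of [b :: y] has at least [t >= #|A0|] neighbours, so its non-neighbours
    in [A1] exceed its neighbours in [B1] by at most [#|A1 :\: A0|]. Summed over [y], those
    neighbours form the sparse link of [b] in [B1]. *)
Lemma full_link_B b : b \in B1 -> Ka * cnt k.-1 (bad_link_B H A1 B1 b) <= 4 * N.
Proof.
move=> bB; have kS2 : k.-1 = k.-2.+1 by clear -hk; lia.
have le_c : cnt k.-1 (bad_link_B H A1 B1 b) <=
    #|A1 :\: A0| * n ^ k.-2 + cnt k.-1 (fun s => all (mem B1) s && edge H (b :: s)).
  rewrite kS2 !cntS; under eq_bigr => a _ do rewrite cntE.
  rewrite (exchange_big_dep (fun y : k.-2.-tuple V => all (mem B1) y && uniq (b :: y))) /=; last first.
    by move=> a y _ /and4P[_ -> /=].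
  under [X in _ <= _ + X]eq_bigr => a _ do rewrite cntE.
  rewrite (exchange_big_dep (fun y : k.-2.-tuple V => all (mem B1) y)) /=; last by move=> v x _ /andP[/andP[]].
  apply: (@leq_trans (\sum_(y : k.-2.-tuple V | all (mem B1) y && uniq (b :: y))
     (#|A1 :\: A0| + #|[set a in B1 | edge H (b :: a :: y)]|))).
    apply: leq_sum => y /andP[yB uy]; rewrite sum1dep_card.
    have := @codegH (b :: y) uy; rewrite /= size_tuple -kS2 => /(_ erefl); set E := [set v | _] => tE.
    have eE a : edge H [:: b, a & y] = (a \in E).
      by rewrite inE; apply: edge_perm; perm_count.
    apply: (@leq_trans #|A1 :\: E|).
      by apply/subset_leq_card/subsetP => a; rewrite in_set in_setD eE => /and4P[-> _ _ ->].
    have -> : #|[set a in B1 | edge H [:: b, a & y]]| = #|E :\: A1|.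
      by apply: eq_card => a; rewrite in_set in_setD eE in_setC.
    have := cardsID E A1; have := cardsID A1 E; rewrite setIC.
    have := cardsID A0 A1; have := subset_leq_card (subsetIr A1 A0).
    by clear -tE A0_le; lia.
  rewrite big_split /=; apply: leq_add.
    rewrite sum_nat_const mulnC leq_mul2l; apply/orP; right.
    by apply: leq_trans (max_card _) _; rewrite card_tuple cardV.
  rewrite [X in X <= _]big_mkcond [X in _ <= X]big_mkcond /=; apply: leq_sum => y _.
  case: ifP => [/andP[yB uy]|]; last by case: ifP.
  by rewrite yB sum1dep_card; apply: eq_leq; apply: eq_card => a; rewrite !inE ?andbT.
have h1 := light_link bB.
have h2 : Ka * (#|A1 :\: A0| * n ^ k.-2) <= N.
  rewrite /N kS2 expnS mulnA leq_mul2r; apply/orP; right.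
  apply: leq_trans excess_small; apply: leq_mul; last exact: sub_out_le.
  apply: leq_trans MK; apply: (@leq_trans (1 * (Ka + Kc))); first by rewrite mul1n leq_addr.
  by rewrite leq_mul2r; apply/orP; right; clear -hk; lia.
have h3 : Ka * cnt k.-1 (bad_link_B H A1 B1 b) <= Ka *
    (#|A1 :\: A0| * n ^ k.-2 + cnt k.-1 (fun s => all (mem B1) s && edge H (b :: s))).
  by rewrite leq_mul2l le_c orbT.
by clear -h1 h2 h3; lia.
Qed.

Lemma near_extremal_tileable (p Kb Kcc : nat) :
  p = k * k + 4 * k -> 4 * 2 ^ p * (p * p) <= n ->
  m * (4 * 2 ^ p * p ^ k.-1) <= Kb -> 4 * m * (2 * m) ^ k.-1 <= Kcc -> 4 * w <= Kcc ->
  2 * Kb <= Ka -> 4 * Kcc <= Ka -> 2 * Kcc <= Kc ->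
  8 * e + 8 <= t -> 4 * (m * m) < t ->
  w * (4 * w + 2 * Ka) * (2 * e * m + 4 * k) <= n ->
  tileable H l [set: V].
Proof.
move=> pE np KbE KccE Kccw KbKa KccKa KccKc et mt dn.
have Ka0 : 0 < 2 * Ka by rewrite muln_gt0 (leq_trans _ Kaw) // muln_gt0 w0.
apply: (@completion V H k l n t hk hl1 hl2 unifH cardV nE codegH A1 exceptional e (2 * Ka) Kb Kcc p) => //.
- have := cardsID A0 A1; have := subset_leq_card (subsetIr A1 A0); have := sub_out_le.
  by clear -A0_le; lia.
- have := cardsID A1 A0; have := subset_leq_card (subsetIr A0 A1); have := subset_leq_card A0_sub.
  by rewrite /e /excess; clear; lia.
- by apply: leq_trans (cardU_le _ _) _; rewrite /e /excess; clear; lia.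
- exact: heavy_link.
- move=> b /light_link h; have h' := leq_mul KbKa (leqnn (cnt k.-1 (fun s => all (mem B1) s && edge H (b :: s)))).
  by move: h h'; rewrite -/N -/B1; clear; lia.
- move=> a aA aE; have h := full_link_A aA aE; have h' := leq_mul KccKc (leqnn (cnt k.-1 (bad_link_A H B1 a))).
  by move: h h'; rewrite -/N -/B1; clear; lia.
- move=> b bB; have h := full_link_B bB; have h' := leq_mul KccKa (leqnn (cnt k.-1 (bad_link_B H A1 B1 b))).
  by move: h h'; rewrite -/N -/B1; clear; lia.
Qed.

End NearExtremal.

(** * The threshold *)

Lemma sum_le_each a b c d e f g h i n : (a + b + c) + (d + e) + (f + g) + (h + i) + 1 <= n ->
  [/\ [/\ a <= n, b <= n & c <= n], d <= n /\ e <= n, f <= n /\ g <= n, h <= n /\ i <= n & 0 < n].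
Proof. by move=> le_n; do !split; lia. Qed.

(** The vertices to avoid take at most half of the codegree, which leaves [d = t / 2] choices, a
    fraction [1 / (4 * m)] of [n] or more. The number of steps is linear in [n] with a rate [1 / R]
    small enough to keep the set below [n / Kal]. *)
Lemma absorbing_set_linear (V : finType) (H : {set {set V}}) (k l n t Kal C : nat) :
  3 <= k -> 1 <= l -> l <= k - 2 -> #|V| = n -> n = t * (2 * k - l) ->
  (forall s, uniq s -> size s = k.-1 -> t <= #|[set v | edge H (v :: s)]|) ->
  let m := 2 * k - l in let q := m * m in let R := Kal * C * (m.+1 * q) in
  let E := ((4 * m) ^ q).-1 in
  0 < C -> 4 * m <= Kal -> 4 * (m * (m + 5)) <= t ->
  R * ((2 * R) ^ m * E ^ m.+1).+1 <= n ->
  exists2 A : {set V}, Kal * #|A| <= n &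
    forall r (U : {set V}), r <= C -> [disjoint U & A] -> #|U| = r * m -> tileable H l (A :|: U).
Proof.
move=> hk hl1 hl2 cardV nE codegH m q R E C0 mK mt Rn.
have m5 : 5 <= m by rewrite /m; clear -hk hl1 hl2; lia.
have m0 : 0 < m by apply: leq_trans m5.
have q0 : 0 < q by rewrite muln_gt0 m0.
have Kal0 : 0 < Kal by apply: leq_trans mK; rewrite muln_gt0 m0.
have R0 : 0 < R by rewrite /R !muln_gt0 Kal0 C0 m0.
have t4 : 4 <= t by apply: leq_trans mt; rewrite -{1}[4]muln1 leq_mul2l /= muln_gt0 m0 addnS.
have tn : t <= n by rewrite nE leq_pmulr.
pose s' := n %/ R; pose s := s' * m.+1; pose d := t %/ 2.
have d0 : 0 < d by rewrite divn_gt0 // (leq_trans _ t4).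
have Kq : 1 < (4 * m) ^ q.
  have K1 : 1 < 4 * m by apply: leq_trans (leq_pmulr 4 m0).
  by apply: (leq_trans K1); rewrite -{1}[4 * m]expn1 leq_exp2l.
have EE : E.+1 = (4 * m) ^ q by rewrite prednK // ltnW.
have E0 : 0 < E by rewrite -ltnS EE.
have nd : n <= 4 * m * d.
  rewrite nE [4 * m]mulnC -mulnA mulnC leq_mul2l; apply/orP; right.
  by have := divn_eq t 2; have := ltn_pmod t (isT : 0 < 2); rewrite -/d; clear -d0; lia.
have s'R : s' * R <= n by apply: leq_divM.
have sE : (2 * R) ^ m * E ^ m.+1 < s' by rewrite leq_divRL // mulnC.
have ns' : n <= 2 * R * s'.
  have := divn_eq n R; have := ltn_pmod n R0; rewrite -/s'.
  have : 0 < s' by apply: leq_trans sE.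
  move=> s'0 ltR eqn; have : R * 1 <= R * s' by rewrite leq_mul2l s'0 orbT.
  by clear -ltR eqn; lia.
have geo : ((4 * m) ^ q).-1 ^ s * n ^ m < ((4 * m) ^ q) ^ s.
  by have := geometric_beats_power E0 ns' sE; rewrite EE.
have sR : Kal * (C * (s * q)) <= n.
  by apply: leq_trans s'R; rewrite /R /s; apply: eq_leq; clear; lia.
have Cs : 4 * (C * (s * q)) <= t.
  rewrite -(leq_pmul2r m0) -nE; apply: leq_trans sR.
  by have := leq_mul mK (leqnn (C * (s * q))); clear; lia.
have le_d : d + C * (s * q) + m * (m + 5) <= t.
  have := divn_eq t 2; rewrite -/d; move: Cs mt; move: (C * _) (m * (m + 5)) => x y.
  by clear; lia.
have [A cA absA] := absorbing_set hk hl1 hl2 cardV tn codegH d0 nd le_d geo.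
by exists A => //; apply: leq_trans sR; rewrite leq_mul2l cA orbT.
Qed.

Lemma large_tileable (k l : nat) : 3 <= k -> 1 <= l -> l <= k - 2 ->
  exists n0 : nat, forall (V : finType) (H : {set {set V}}) (n t : nat),
    n0 <= n -> #|V| = n -> n = t * (2 * k - l) -> (forall e, e \in H -> #|e| = k) ->
    (forall s, uniq s -> size s = k.-1 -> t <= #|[set v | edge H (v :: s)]|) ->
    tileable H l [set: V].
Proof.
move=> hk hl1 hl2; have lk : l < k by clear -hk hl2; lia.
pose m := 2 * k - l; have m5 : 5 <= m by rewrite /m; clear -hk hl1 hl2; lia.
have m0 : 0 < m by apply: leq_trans m5.
(* The constants are fixed in the reverse order of use: [Kb] for [find_core], [Kcc] for row
   switching, [Ka] and [Kc] for the vertex classes, [M] for the excess, [K2] for sparsity outside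
   [A0], [Kal] for density towards the leftover, and [C] for the leftover itself. The absorbing set
   depends on all of them through [Kal] and [C]. *)
pose p := k * k + 4 * k; pose w := 2 ^ k.-1.
pose Kb := m * (4 * 2 ^ p * p ^ k.-1).
pose Kcc := 4 * m * (2 * m) ^ k.-1 + 4 * w.
pose Kc := 2 * Kcc; pose Ka := 2 * Kb + 4 * Kcc.
pose Q := w * (4 * w + 2 * Ka).
(* The three terms serve the comparison of links, the room for greedy choices in [completion], and
   the bound of the excess by [t], in this order. *)
pose M := 2 * k * (Ka + Kc) + 4 * Q * m + 16 * m.
pose K2 := M * (Ka + Kc + 1); pose Kal := 9 * m * k * K2.
pose da := (m + 1) * (m + 1) + 2 * k + m; pose d1 := (m + 1) * k.
pose C := 2 ^ k.-1 * Kal * da + Kal * (k * k).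
pose q := m * m; pose R := Kal * C * (m.+1 * q); pose E := ((4 * m) ^ q).-1.
have k0 : 0 < k by clear -hk; lia.
have K20 : 0 < K2 by rewrite /K2 muln_gt0 addn1 andbT /M addn_gt0 muln_gt0 m0 orbT.
have Kal0 : 0 < Kal by rewrite /Kal muln_gt0 K20 !muln_gt0 m0 k0.
have C0 : 0 < C.
  by apply: (@leq_trans (Kal * (k * k))); [rewrite muln_gt0 Kal0 muln_gt0 k0 | rewrite /C leq_addl].
exists ((4 * 2 ^ p * (p * p) + 4 * w * (k * k) + 8 * Q * k) + (16 * m + (4 * (m * m)).+1 * m) +
  (2 ^ k * (3 * K2) * d1 + 3 * K2 * (k * k * m)) +
  (R * ((2 * R) ^ m * E ^ m.+1).+1 + 4 * (m * (m + 5)) * m) + 1).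
move=> V H n t n_large cardV nE unifH codegH.
have [[na nb nc] [nd ne] [nf ng] [nh nj] n0] := sum_le_each n_large.
have tm x : x * m <= n -> x <= t by rewrite nE leq_pmul2r.
have mKal : 4 * m <= Kal.
  rewrite /Kal; apply: (@leq_trans (9 * m * 1 * 1)); first by clear; lia.
  by rewrite !leq_mul // ltnW // ltnW.
have [A KA absA] := absorbing_set_linear hk hl1 hl2 cardV nE codegH C0 mKal (tm _ nj) nh.
have Cd : 2 ^ k.-1 * Kal * da <= C by rewrite /C leq_addr.
have CK : Kal * (k * k) <= C by rewrite /C leq_addl.
case: (almost_tiling hk hl1 hl2 unifH cardV nE n0 codegH K20 Cd CK (leqnn _) nf (leqnn _) (leqnn _) ng KA).
  case=> P [tP YP dPA small]; pose U := ~: (cover P :|: A).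
  have TA : tileable H l A.
    rewrite -[A]setU0; apply: (absA 0) => //; last by rewrite cards0.
    by rewrite -setI_eq0 set0I.
  (* The sizes of [V], [A] and [cover P] are multiples of [m], hence so is the size of what
     remains. *)
  have dU : m %| #|U|.
    have := cardCE cardV (cover P :|: A); rewrite cardsU (disjoint_setI0 dPA) cards0 subn0 -/U => cU.
    have mn : m %| n by rewrite nE dvdn_mull.
    move: mn; rewrite -cU dvdn_addr // dvdn_addr; first exact: (tileable_dvd lk unifH TA).
    by rewrite (card_tiling lk unifH tP YP) dvdn_mull.
  have dUA : [disjoint U & A].
    by rewrite disjoint_subset; apply/subsetP => x; rewrite !inE negb_or => /andP[].
  have TAU : tileable H l (A :|: U).
    apply: (absA (#|U| %/ m)) => //; last by rewrite divnK.
    by apply: leq_trans (leq_div _ _) (ltnW small).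
  have -> : [set: V] = (A :|: U) :|: cover P.
    by apply/setP => x; rewrite !inE; case: (x \in A); case: (x \in cover P).
  apply: tileableU => //; last by apply/tileableP; exists P.
  rewrite disjoint_sym; rewrite disjoint_subset; apply/subsetP => x xP.
  rewrite !inE xP /= orbF; move: dPA; rewrite disjoint_subset => /subsetP /(_ x xP).
  by rewrite inE.
case=> A0 [A0_le A0_ge sparse].
have A0_ge' : K2 * (t - #|A0|) <= n.
  have K3 : 3 * K2 <= Kal.
    rewrite /Kal; apply: leq_mul => //; apply: (@leq_trans (9 * 1 * 1)) => //.
    by rewrite !leq_mul // ltnW // ltnW.
  have := leq_mul K3 (leqnn (t - #|A0|)); move: A0_ge; rewrite -leq_subLR -mulnBr.
  by move: (t - _) => x; clear; lia.
have sparse' : K2 * cnt k (fun s => all (mem (~: A0)) s && edge H s) <= n ^ k.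
  rewrite (eq_cnt (Q := fun s => all (fun x => x \notin A0) s && edge H s)) // => s _.
  by congr (_ && _); apply: eq_all => x; rewrite /= inE.
have Kcw' : 4 * w <= Kcc by rewrite /Kcc leq_addl.
have Kaw : 4 * w <= Ka.
  by rewrite /Ka; move: Kcw'; move: (4 * w) => x; clear; lia.
have Kcw : 2 * w <= Kc.
  by rewrite /Kc; move: Kcw'; clear; lia.
have MK : 2 * k * (Ka + Kc) <= M by rewrite /M -addnA leq_addr.
have Me := excess_small hk n0 codegH A0_le A0_ge' sparse'.
have M16 : 16 * m <= M by rewrite /M leq_addl.
have MQ : 4 * Q * m <= M by rewrite /M [_ + 4 * Q * m]addnC -addnA leq_addr.
set e := excess H k n t A0 Ka Kc in Me.
have Me16 := leq_trans (leq_mul M16 (leqnn e)) Me.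
have MeQ := leq_trans (leq_mul MQ (leqnn e)) Me.
apply: (near_extremal_tileable hk hl1 hl2 unifH cardV nE n0 codegH A0_le A0_ge' sparse' Kaw Kcw nb MK
  (p := p) (Kb := Kb) (Kcc := Kcc)) => //.
- by rewrite /Kcc leq_addr.
- by rewrite /Ka leq_addr.
- by rewrite /Ka leq_addl.
- have h1 : 16 * e <= t by apply: tm; move: Me16; clear; lia.
  by have h2 := tm _ nd; rewrite -/e; clear -h1 h2; lia.
- exact: tm.
- by rewrite -/e -/w -/Q; clear -MeQ nc; lia.
Qed.

Theorem theorem1p2 (k l : nat) (hk : 3 <= k) (hl1 : 1 <= l) (hl2 : l <= k - 2) :
  exists n0 : nat, forall n : nat, n0 <= n -> 2 * k - l %| n ->
    [/\ factor_threshold k n (Ygraph k l) = n %/ (2 * k - l),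
        (forall (V : finType) (H : {set {set V}}),
           #|V| = n -> uniform k H ->
           n %/ (2 * k - l) <= min_codegree k H ->
           has_factor (Ygraph k l) H)
      & (exists H : {set {set 'I_n}},
           [/\ uniform k H,
               (min_codegree k H).+1 = n %/ (2 * k - l)
             & ~~ has_factor (Ygraph k l) H])].
Proof.
have lk : l < k by clear -hk hl2; lia.
have [n0 large] := large_tileable hk hl1 hl2.
have m0 : 0 < 2 * k - l by clear -hk hl2; lia.
(* The second term gives [k <= t], which the barrier needs for its codegree. *)
exists (n0 + k * (2 * k - l)) => n n_large /divnK; set t := n %/ _ => /esym nE.
have n0n : n0 <= n by apply: leq_trans n_large; apply: leq_addr.
have kt : k <= t by rewrite -(leq_pmul2r m0) -nE; apply: leq_trans n_large; apply: leq_addl.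
have t0 : 0 < t by apply: leq_trans kt; clear -hk; lia.
have upper (V : finType) (H : {set {set V}}) :
    #|V| = n -> uniform k H -> t <= min_codegree k H -> has_factor (Ygraph k l) H.
  move=> cardV /'forall_implyP unifH codeg.
  have {}unifH e : e \in H -> #|e| = k by move/unifH/eqP.
  apply: (tileable_factor lk unifH); apply: (large V H n t) => // s us ss.
  have cs : #|setof s| = k.-1 by rewrite card_setof.
  apply: leq_trans codeg (leq_trans (min_codegree_le_degree H cs) _).
  rewrite /degree -[X in _ <= X](card_imset _ (@set1_inj V)) .
  (* [degree] counts edges and the tiling argument counts vertices: an edge containing [setof s]
     corresponds to the one vertex of [f e]. *)
  pose f (e : {set V}) := e :\: setof s.
  have inj_f : {in [set e in H | setof s \subset e] &, injective f}.
    move=> e e'; rewrite !inE => /andP[_ se] /andP[_ se'] eq_f.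
    by rewrite -(setID e (setof s)) -(setID e' (setof s)) (setIidPr se) (setIidPr se') -/(f e) eq_f.
  rewrite -(card_in_imset inj_f); apply/subset_leq_card/subsetP => T /imsetP[e]; rewrite inE => /andP[eH se] ->.
  have /cards1P[v fE] : #|f e| == 1.
    by rewrite cardsD (setIidPr se) cs unifH //; apply/eqP; clear -hk; lia.
  rewrite fE; apply: imset_f; rewrite inE /edge (_ : setof (v :: s) = e) //.
  rewrite -(setID e (setof s)) (setIidPr se) -/(f e) fE.
  by apply/setP => x; rewrite !inE orbC.
have lower : exists H : {set {set 'I_n}},
    [/\ uniform k H, (min_codegree k H).+1 = t & ~~ has_factor (Ygraph k l) H].
  have tn : t.-1 <= n by rewrite nE; apply: leq_trans (leq_pred _) (leq_pmulr _ m0).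
  have cA : #|[set i : 'I_n | i < t.-1]| = t.-1.
    by rewrite -[RHS]subn0 -(card_ord_interval (leq0n _) tn); apply: eq_card => i; rewrite !inE.
  exists (barrier k [set i : 'I_n | i < t.-1]); split.
  - exact: barrier_uniform.
  - exact: (barrier_codegree hk hl1 hl2 t0 kt (card_ord n) nE cA).
  - exact: (barrier_no_factor hk hl1 hl2 t0 kt (card_ord n) nE cA).
split=> //; rewrite /factor_threshold; case: ex_minnP => v Pv min_v.
apply/eqP; rewrite eqn_leq; apply/andP; split.
  apply: min_v; apply/forallP => H; apply/implyP => uH; apply/implyP => codeg.
  by apply: upper => //; apply: card_ord.
(* The barrier has codegree [t.-1] and no factor, so it refutes every [v < t]. *)
rewrite leqNgt; apply/negP => vt; have [H [uH cH /negP]] := lower; apply.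
move/forallP: Pv => /(_ H) /implyP /(_ uH) /implyP; apply.
by rewrite -ltnS cH.
Qed.
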